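(* Let $u$ be an inner function and $\zeta \in \mathbb{T} \setminus \sigma(u)$. Then \[ \sigma(\mathrm{Q}_\zeta^u) = \left\{\frac{\overline{\eta}}{1-\zeta \overline{\eta}} : \eta\in\sigma(u)\right\}, \] \[ \sigma_p(\mathrm{Q}_\zeta^u) = \left\{\frac{\overline{\eta}}{1-\zeta \overline{\eta}} : \eta\in\sigma(u)\cap \mathbb{D}\right\}, \] \[ \sigma_e(\mathrm{Q}_\zeta^u) = \left\{\frac{\overline{\eta}}{1-\zeta \overline{\eta}} : \eta\in\sigma(u)\cap \mathbb{T}\right\}. \] Moreover, the lower estimate \[ \|\mathrm{Q}_\zeta^u\| \geq \frac{1}{\operatorname{dist}\left(\zeta,\sigma(u)\cap\mathbb{T}\right)} \] holds.
   Context: $\mathbb{D}$ is the open unit disk, $\mathbb{T}=\partial\mathbb{D}$, $H^2=H^2(\mathbb{D})$ is the Hardy space. An inner function $u$ is a bounded holomorphic function on $\mathbb{D}$ with $\lim_{r\to1}|u(r\xi)|=1$ for almost every $\xi\in\mathbb{T}$. Its model space is $K_u := H^2 \ominus uH^2$, with the $H^2$-norm. The spectrum of $u$ is $\sigma(u) := \{\lambda\in\overline{\mathbb{D}} : \liminf_{z\to\lambda,\ z\in\mathbb{D}}|u(z)|=0\}$. Let $X_u := S^*|_{K_u}$ be the restriction to $K_u$ of the backward shift $S^*f(z) = (f(z)-f(0))/z$; $K_u$ is $S^*$-invariant. For $\zeta\in\mathbb{T}\setminus\sigma(u)$ the operator $\mathrm{I}-\zeta X_u$ is invertible in $B(K_u)$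 (the bounded linear operators on $K_u$), every $f\in K_u$ extends analytically to a neighbourhood of $\zeta$, and the difference quotient operator $\mathrm{Q}_\zeta^u\in B(K_u)$ is $\mathrm{Q}_\zeta^u := (\mathrm{I}-\zeta X_u)^{-1}X_u$; equivalently, $(\mathrm{Q}_\zeta^u f)(z) = \frac{f(z)-f(\zeta)}{z-\zeta}$ for $f\in K_u$, $z\in\mathbb{D}$. $\|\mathrm{Q}_\zeta^u\|$ is its operator norm on $K_u$. For a bounded operator $A$ on a Hilbert space, $\sigma(A)$ is its spectrum, $\sigma_p(A)=\{\lambda\in\mathbb{C}:\lambda \mathrm{I}-A \text{ is not injective}\}$, and $\sigma_e(A)=\{\lambda\in\mathbb{C}:\lambda \mathrm{I}-A\text{ is not Fredholm}\}$, where an operator is Fredholm if it has closed range and both its kernel and the kernel of its adjoint are finite-dimensional. Convention: the distance to the empty set is $+\infty$ and $1/(+\infty)=0$. *)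

(* Defs.v *)
From HB Require Import structures.
From mathcomp Require Import all_boot all_order all_algebra.
From mathcomp Require Import sesquilinear complex ring.
From mathcomp Require Import all_classical all_reals all_analysis.

Set Implicit Arguments.
Unset Strict Implicit.
Unset Printing Implicit Defensive.

Import Order.TTheory GRing.Theory Num.Theory.
Import numFieldNormedType.Exports.

Local Open Scope classical_set_scope.
Local Open Scope ring_scope.

HB.instance Definition _ (R : realType) := NormedModule.copy R[i] R[i]^o.

(* The norm of a normed space over [R[i]] takes values in [R[i]]; [rnorm] is the
   same norm with values in [R]. *)
Definition rnorm (R : realType) (V : normedModType R[i]) (x : V) : R :=
  complex.Re `|x|.

Section InnerProduct.
Variables (C : numClosedFieldType) (V : lmodType C).
Variable dot : {dot V for Num.conj}.

Lemma dot_CauchySchwarz (x y : V) : `|dot x y| ^+ 2 <= dot x x * dot y y.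
Proof.
have [->|y0] := eqVneq y 0.
  by rewrite !linear0r normr0 expr0n.
have yy : 0 < dot y y by exact: neq0_dnorm_gt0.
pose a := dot x y / dot y y; pose z := x - a *: y.
have zy : dot z y = 0.
  by rewrite /z linearBl /= linearZl_LR /= divfK ?subrr// gt_eqF.
have -> : dot x x = dot z z + `|a| ^+ 2 * dot y y.
  have zay : dot z (a *: y) = 0 by rewrite linearZr_LR /= zy mulr0.
  by rewrite -[in LHS](subrK (a *: y) x) -/z hnormDd //= dnormZ.
rewrite mulrDl -[leLHS]add0r lerD ?mulr_ge0 ?dnorm_ge0//.
rewrite /a normrM normfV (ger0_norm (ltW yy)) exprMn exprVn -mulrA.
by rewrite -expr2 mulfVK// expf_neq0// gt_eqF.
Qed.

Lemma dot_triangle (x y : V) :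
  sqrtC (dot (x + y) (x + y)) <= sqrtC (dot x x) + sqrtC (dot y y).
Proof.
rewrite -(@ler_pXn2r _ 2)// ?nnegrE ?addr_ge0 ?sqrtC_ge0 ?dnorm_ge0//.
rewrite sqrrD !sqrtCK dnormD /= addrAC lerD2r lerD2l.
have -> : dot x y + (dot x y)^* = 'Re (dot x y) *+ 2.
  by rewrite -mulr_natr ReE divfK// pnatr_eq0.
rewrite lerMn2r /=; apply: (le_trans (leif_Re_Creal _).1).
rewrite -(@ler_pXn2r _ 2)// ?nnegrE ?mulr_ge0 ?sqrtC_ge0 ?dnorm_ge0//.
by rewrite exprMn !sqrtCK dot_CauchySchwarz.
Qed.

End InnerProduct.

Section ComplexSeries.
Variable R : realType.
Implicit Types (z : R[i]) (f : nat -> R[i]).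

Lemma normCE z : `|z| = (rnorm z)%:C%C.
Proof. by case: z. Qed.

Lemma cvg_complex f z :
  (fun n => complex.Re (f n)) @ \oo --> complex.Re z ->
  (fun n => complex.Im (f n)) @ \oo --> complex.Im z -> f @ \oo --> z.
Proof.
have dec (a b : R[i]) : a - b = (complex.Re a - complex.Re b)%:C%C +
                    'i%C * (complex.Im a - complex.Im b)%:C%C.
  by case: a b => ? ? [? ?]; simpc.
move=> fre fim; apply/(@cvgrPdist_lt _ R[i]) => e e0.
have [er ei] : 0 < complex.Re e /\ e = (complex.Re e)%:C%C.
  by case: e e0 => a b; rewrite ltcE /= => /andP[/eqP -> ->].
have e2 : 0 < complex.Re e / 2 by rewrite divr_gt0.
move/cvgrPdist_lt : fre => /(_ _ e2) fre.
move/cvgrPdist_lt : fim => /(_ _ e2) fim.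
near=> n.
have h1 : `|complex.Re z - complex.Re (f n)| < complex.Re e / 2 by near: n.
have h2 : `|complex.Im z - complex.Im (f n)| < complex.Re e / 2 by near: n.
rewrite dec.
apply: (le_lt_trans (ler_normD _ _)); rewrite normrM.
have -> : `|'i%C : R[i]| = 1.
  by rewrite normCE /rnorm /=; rewrite expr0n expr1n add0r sqrtr1.
rewrite mul1r ei (splitr (complex.Re e)) [ltRHS]rmorphD; apply: ltrD.
  by rewrite normCE /rnorm /= expr0n addr0 sqrtr_sqr ltcR.
by rewrite normCE /rnorm /= expr0n addr0 sqrtr_sqr ltcR.
Unshelve. all: by end_near. Qed.

Lemma Re_le_rnorm z : `|complex.Re z| <= rnorm z.
Proof.
case: z => a b; rewrite /rnorm /= -[leLHS]sqrtr_sqr ler_sqrt ?addr_ge0 ?sqr_ge0//.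
  by rewrite lerDl sqr_ge0.
Qed.

Lemma Im_le_rnorm z : `|complex.Im z| <= rnorm z.
Proof.
case: z => a b; rewrite /rnorm /= -[leLHS]sqrtr_sqr ler_sqrt ?addr_ge0 ?sqr_ge0//.
  by rewrite lerDr sqr_ge0.
Qed.

Lemma Re_series f n :
  complex.Re (series f n) = series (fun k => complex.Re (f k)) n.
Proof. 
rewrite /series /=; elim: n => [|n IH]; first by rewrite !big_geq.
by rewrite !big_nat_recr //= -IH; case: (\sum_(_ <= _ < _) _) (f n) => ? ? [].
Qed.

Lemma Im_series f n :
  complex.Im (series f n) = series (fun k => complex.Im (f k)) n.
Proof. 
rewrite /series /=; elim: n => [|n IH]; first by rewrite !big_geq.
by rewrite !big_nat_recr //= -IH; case: (\sum_(_ <= _ < _) _) (f n) => ? ? [].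
Qed.

Lemma is_cvg_series_dom (u v : nat -> R) : (forall n, `|u n| <= v n) ->
  cvgn (series v) -> cvgn (series u).
Proof.
move=> uv cv; apply: (@normed_cvg _ R^o); apply: series_le_cvg cv => n //=.
exact: le_trans (uv n).
Qed.

Lemma is_cvg_complex_series (v : nat -> R) f :
  (forall n, rnorm (f n) <= v n) -> cvgn (series v) -> cvgn (series f).
Proof.
move=> fv cv.
have cr : cvgn (series (fun k => complex.Re (f k))).
  by apply: is_cvg_series_dom cv => n; apply: le_trans (Re_le_rnorm _) (fv n).
have ci : cvgn (series (fun k => complex.Im (f k))).
  by apply: is_cvg_series_dom cv => n; apply: le_trans (Im_le_rnorm _) (fv n).
apply/cvg_ex; exists (limn (series (fun k => complex.Re (f k))) +i*
              limn (series (fun k => complex.Im (f k))))%C.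
apply: cvg_complex => /=.
  by rewrite (_ : (fun _ => _) = series (fun k => complex.Re (f k)))//;
    apply/funext => n; rewrite Re_series.
by rewrite (_ : (fun _ => _) = series (fun k => complex.Im (f k)))//;
  apply/funext => n; rewrite Im_series.
Qed.

End ComplexSeries.

Section Hardy.
Variable R : realType.
Implicit Types (a b : nat -> R[i]).

Definition ell2 : {pred (nat -> R[i])} :=
  fun a => `[< cvgn (series (fun n => rnorm (a n) ^+ 2)) >].

Lemma ell2P a : reflect (cvgn (series (fun n => rnorm (a n) ^+ 2))) (a \in ell2).
Proof. exact: asboolP. Qed.

Lemma rnorm_ge0 (V : normedModType R[i]) (x : V) : 0 <= rnorm x.
Proof.
have := normr_ge0 x; rewrite /rnorm; case: `|x| => c d.
by rewrite lecE /= => /andP[].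
Qed.

Lemma rnormM (x y : R[i]) : rnorm (x * y) = rnorm x * rnorm y.
Proof. by apply: complexI; rewrite rmorphM /= -!normCE normrM. Qed.

Lemma rnormD (x y : R[i]) : rnorm (x + y) <= rnorm x + rnorm y.
Proof. by rewrite -lecR rmorphD /= -!normCE ler_normD. Qed.

Lemma rnorm_conj (x : R[i]) : rnorm x^* = rnorm x.
Proof. by apply: complexI; rewrite -!normCE norm_conjC. Qed.

Lemma ell2_submod_closed : submod_closed ell2.
Proof.
split.
  apply/ell2P; rewrite (_ : series _ = fun=> 0); first exact: is_cvg_cst.
  by apply/funext => n; rewrite /series /= big1// => i _; rewrite /rnorm normr0 expr0n.
move=> c a b /ell2P ha /ell2P hb; apply/ell2P.
pose v : nat -> R := (2 * rnorm c ^+ 2) *: (fun n => rnorm (a n) ^+ 2)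
  + 2 *: (fun n => rnorm (b n) ^+ 2).
apply: (@is_cvg_series_dom _ _ v) => [n|].
  rewrite ger0_norm ?sqr_ge0//.
  have -> : v n = 2 * rnorm c ^+ 2 * rnorm (a n) ^+ 2 + 2 * rnorm (b n) ^+ 2 by [].
  have h : rnorm (c * a n + b n) <= rnorm c * rnorm (a n) + rnorm (b n).
    by rewrite -rnormM rnormD.
  apply: (@le_trans _ _ ((rnorm c * rnorm (a n) + rnorm (b n)) ^+ 2)).
    by rewrite ler_pXn2r// nnegrE ?addr_ge0 ?mulr_ge0 ?rnorm_ge0.
  rewrite -subr_ge0 (_ : _ - _ = (rnorm c * rnorm (a n) - rnorm (b n)) ^+ 2).
    exact: sqr_ge0.
  by ring.
by apply: is_cvg_seriesD; apply: is_cvg_seriesZ.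
Qed.

HB.instance Definition _ := GRing.isSubmodClosed.Build R[i] (nat -> R[i]) ell2
  ell2_submod_closed.

(* The Hardy space H^2 of the unit disk: the power series with square-summable
   coefficients. An element is represented by its Taylor coefficients at 0, and
   [heval f z] below is its value at a point [z] of the disk. *)
Record hardy := Hardy { coef :> nat -> R[i]; coefP : coef \in ell2 }.

HB.instance Definition _ := [isSub for coef].
HB.instance Definition _ := [Choice of hardy by <:].
HB.instance Definition _ := [SubChoice_isSubLmodule of hardy by <:].

Implicit Types f g h : hardy.

Lemma hardyP f g : (forall n, f n = g n) -> f = g.
Proof. by move=> fg; apply/val_inj/funext. Qed.

Definition heval f (z : R[i]) : R[i] := limn (series (fun n => f n * z ^+ n)).

Definition hdot f g : R[i] := limn (series (fun n => f n * (g n)^*)).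

Lemma hdot_cvg f g : cvgn (series (fun n => f n * (g n)^*)).
Proof.
have /ell2P cf := coefP f; have /ell2P cg := coefP g.
pose v : nat -> R := (fun n => rnorm (f n) ^+ 2) + (fun n => rnorm (g n) ^+ 2).
apply: (@is_cvg_complex_series _ v) => [n|]; last exact: is_cvg_seriesD.
have -> : v n = rnorm (f n) ^+ 2 + rnorm (g n) ^+ 2 by [].
rewrite rnormM rnorm_conj -subr_ge0.
rewrite (_ : _ - _ = (rnorm (f n) - rnorm (g n)) ^+ 2 + rnorm (f n) * rnorm (g n)).
  by rewrite addr_ge0 ?sqr_ge0// mulr_ge0 ?rnorm_ge0.
by ring.
Qed.

Lemma hdotxx f : hdot f f = (limn (series (fun n => rnorm (f n) ^+ 2)))%:C%C.
Proof.
have /ell2P cf := coefP f.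
apply: cvg_lim; first exact: norm_hausdorff.
have fE : (fun n => f n * (f n)^*) = fun n => (rnorm (f n) ^+ 2)%:C%C.
  by apply/funext => n; rewrite -normCK normCE rmorphXn.
rewrite fE; apply: cvg_complex => /=.
  by under eq_fun do rewrite Re_series; exact: cf.
under eq_fun do rewrite Im_series /series /= big1//.
exact: cvg_cst.
Qed.

Lemma hdot_linearl g : linear_for *%R (hdot^~ g).
Proof.
move=> c f h; rewrite /hdot.
have cf := @hdot_cvg f g; have ch := @hdot_cvg h g.
pose u : nat -> R[i] := fun n => f n * (g n)^*.
pose v : nat -> R[i] := fun n => h n * (g n)^*.
have -> : (fun n => (c *: f + h) n * (g n)^*) = c *: u + v.
  by apply/funext => n; rewrite mulrDl -mulrA.
rewrite seriesD seriesZ.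
apply: (@cvg_lim _ (@norm_hausdorff _ R[i])).
apply: (@cvgD _ R[i]); last exact: ch.
by apply: (@cvgZl_tmp _ R[i]); exact: cf.
Qed.

Lemma hdotC f g : hdot f g = (-1) ^+ false * (hdot g f)^*.
Proof.
rewrite expr0 mul1r; apply: cvg_lim; first exact: norm_hausdorff.
have cg := @hdot_cvg g f.
have -> : series (fun n => f n * (g n)^*) =
    fun k => (series (fun n => g n * (f n)^*) k)^*.
  apply/funext => k; rewrite /series /= rmorph_sum; apply: eq_bigr => i _.
  by rewrite rmorphM /= conjCK mulrC.
apply/(@cvgrPdist_lt _ R[i]) => e e0; near=> n.
rewrite -rmorphB norm_conjC.
by near: n; move/(@cvgrPdist_lt _ R[i]) : cg => /(_ _ e0).
Unshelve. all: by end_near. Qed.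

Lemma hdot_linearr f : linear_for (Num.conj \; *%R) (hdot f).
Proof.
move=> c g h; rewrite !(hdotC f) /= !expr0 !mul1r hdot_linearl.
by rewrite rmorphD rmorphM.
Qed.

HB.instance Definition _ := bilinear_isBilinear.Build R[i] hardy hardy R[i]
  *%R (Num.conj \; *%R) hdot (hdot_linearl, hdot_linearr).
HB.instance Definition _ := isHermitianSesquilinear.Build R[i] hardy false
  Num.conj hdot hdotC.

Lemma hdot_gt0 f : f != 0 -> 0 < hdot f f.
Proof.
have /ell2P cf := coefP f; rewrite hdotxx ltcR => f0.
have [n fn0] : exists n, f n != 0.
  apply: contrapT => /forallNP fn; move/eqP: f0; apply; apply: hardyP => n.
  by have /negP := fn n; rewrite negbK => /eqP.
have h : series (fun n => rnorm (f n) ^+ 2) n.+1 <=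
    limn (series (fun n => rnorm (f n) ^+ 2)).
  apply: nondecreasing_cvgn_le => //.
  by apply: nondecreasing_series => k _ _; exact: sqr_ge0.
apply: lt_le_trans h; rewrite /series /= big_nat_recr//=.
rewrite ltr_wpDl ?sumr_ge0//; first by move=> i _; exact: sqr_ge0.
by rewrite exprn_gt0// -ltcR -normCE normr_gt0.
Qed.

HB.instance Definition _ := isDotProduct.Build R[i] hardy hdot hdot_gt0.

Definition hnorm f : R[i] := sqrtC (hdot f f).

Lemma hnormrD f g : hnorm (f + g) <= hnorm f + hnorm g.
Proof. exact: dot_triangle. Qed.

Lemma hnormrZ (c : R[i]) f : hnorm (c *: f) = `|c| * hnorm f.
Proof.
by rewrite /hnorm dnormZ sqrtCM ?sqrCK// ?nnegrE ?exprn_ge0// dnorm_ge0.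
Qed.

Lemma hnormr0_eq0 f : hnorm f = 0 -> f = 0.
Proof. by move/eqP; rewrite sqrtC_eq0 dnorm_eq0 => /eqP. Qed.

HB.instance Definition _ :=
  Lmodule_isNormed.Build R[i] hardy hnormrD hnormrZ hnormr0_eq0.

End Hardy.
Section Shift.
Variable R : realType.
Implicit Types f g h : hardy R.

Lemma heval_cvg f (z : R[i]) : `|z| < 1 -> cvgn (series (fun n => f n * z ^+ n)).
Proof.
rewrite normCE ltcR => z1; have /ell2P cf := coefP f.
pose v : nat -> R := (fun n => rnorm (f n) ^+ 2) + geometric 1 (rnorm z ^+ 2).
apply: (@is_cvg_complex_series _ v) => [n|]; last first.
  apply: is_cvg_seriesD => //; apply: is_cvg_geometric_series.
  by rewrite ger0_norm ?sqr_ge0// expr_lt1// rnorm_ge0.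
have -> : v n = rnorm (f n) ^+ 2 + rnorm (z ^+ n) ^+ 2.
  congr (_ + _); rewrite /geometric /= mul1r exprAC; congr (_ ^+ 2).
  by apply: complexI; rewrite rmorphXn /= -!normCE normrX.
rewrite rnormM -subr_ge0.
rewrite (_ : _ - _ = (rnorm (f n) - rnorm (z ^+ n)) ^+ 2 + rnorm (f n) * rnorm (z ^+ n)).
  by rewrite addr_ge0 ?sqr_ge0// mulr_ge0 ?rnorm_ge0.
by ring.
Qed.

Lemma bshift_subproof f : (fun n => f n.+1) \in @ell2 R.
Proof.
have /ell2P cf := coefP f; apply/ell2P.
rewrite (_ : series _ = fun n => series (fun n => rnorm (f n) ^+ 2) n.+1
    - rnorm (f 0%N) ^+ 2).
  apply: is_cvgB; last exact: is_cvg_cst.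
  by apply: (@cvgP _ _ (limn (series (fun n => rnorm (f n) ^+ 2)))); rewrite cvg_shiftS.
apply/funext => n; rewrite /series /= [in RHS]big_nat_recl//= [RHS]addrC addKr.
by [].
Qed.

(* The backward shift; see [bshiftE] for the formula [(f z - f 0) / z]. *)
Definition bshift f : hardy R := Hardy (bshift_subproof f).

Lemma heval_bshift f (z : R[i]) : `|z| < 1 ->
  heval f z = f 0%N + z * heval (bshift f) z.
Proof.
move=> z1; have cS := @heval_cvg (bshift f) z z1.
apply: (@cvg_lim _ (@norm_hausdorff _ R[i])).
rewrite -cvg_shiftS /=.
have -> : (fun n => series (fun k => f k * z ^+ k) n.+1) =
    cst (f 0%N) + z *: series (fun k => bshift f k * z ^+ k).
  apply/funext => n; rewrite /series /= big_nat_recl//= expr0 mulr1.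
  rewrite [RHS]/(_ + _ * _) mulr_sumr; congr (_ + _); apply: eq_bigr => i _.
  by rewrite exprS mulrCA.
apply: (@cvgD _ R[i]); first exact: cvg_cst.
by apply: (@cvgZl_tmp _ R[i]); exact: cS.
Qed.

Lemma bshiftE f (z : R[i]) : z != 0 -> `|z| < 1 ->
  heval (bshift f) z = (heval f z - heval f 0) / z.
Proof.
move=> z0 z1; rewrite (@heval_bshift f z)// (@heval_bshift f 0) ?normr0//.
by rewrite mul0r addr0 addrAC subrr add0r mulrC mulKf.
Qed.

Lemma fshift_subproof f : (fun n => if n is m.+1 then f m else 0) \in @ell2 R.
Proof.
have /ell2P cf := coefP f; apply/ell2P.
apply: (@cvgP _ _ (limn (series (fun n => rnorm (f n) ^+ 2)))).
rewrite -cvg_shiftS (_ : (fun _ => _) = series (fun n => rnorm (f n) ^+ 2))//.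
apply/funext => n; rewrite /series /= big_nat_recl//=.
by rewrite /rnorm normr0 expr0n add0r.
Qed.

Definition fshift f : hardy R := Hardy (fshift_subproof f).

Lemma heval_fshift f (z : R[i]) : `|z| < 1 -> heval (fshift f) z = z * heval f z.
Proof.
move=> z1; rewrite heval_bshift// add0r; congr (_ * heval _ _).
Qed.

Lemma hdot_bshift f g : hdot (bshift f) g = hdot f (fshift g).
Proof.
rewrite /hdot; apply/esym/(@cvg_lim _ (@norm_hausdorff _ R[i])).
rewrite -cvg_shiftS /=.
rewrite (_ : (fun _ => _) = series (fun n => bshift f n * (g n)^*)).
  exact: hdot_cvg.
by apply/funext => n; rewrite /series /= big_nat_recl//= conjC0 mulr0 add0r.
Qed.

End Shift.

Section InnerFunctions.
Variable R : realType.
Implicit Types (u : R[i] -> R[i]) (z : R[i]).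

Definition disk : set R[i] := [set z | `|z| < 1].
Definition circle : set R[i] := [set z | `|z| = 1].

Definition expi (t : R) : R[i] := (cos t +i* sin t)%C.

(* A function on the disk is given as a function on [R[i]] whose values outside
   the disk are irrelevant. *)
Definition inner_function u :=
  [/\ forall z, disk z -> derivable u z 1,
      exists M : R, forall z, disk z -> rnorm (u z) <= M
    & {ae (@lebesgue_measure R), forall t : R,
        rnorm (u (r%:C%C * expi t)) @[r --> 1^'-] --> (1 : R)}].

Definition inner_spectrum u : set R[i] :=
  [set l | `|l| <= 1 /\
    limf_einf (fun z => (rnorm (u z))%:E) (within disk (nbhs l)) = 0%E].

(* The infimum of the empty set is [+oo], so the distance to it is [+oo]. *)
Definition dist (z : R[i]) (E : set R[i]) : \bar R :=
  ereal_inf [set (rnorm (z - e))%:E | e in E].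

End InnerFunctions.

Section ModelSpace.
Variables (R : realType) (u : R[i] -> R[i]).

(* The subspace [u H^2] of [H^2]. *)
Definition inner_multiples : set (hardy R) :=
  [set g | exists h : hardy R, forall z, disk z -> heval g z = u z * heval h z].

Definition orth_inner_multiples : {pred hardy R} :=
  fun f => `[< forall g, inner_multiples g -> hdot f g = 0 >].

Lemma orth_inner_multiples_submod_closed : submod_closed orth_inner_multiples.
Proof.
split; first by apply/asboolP => g _; rewrite linear0l.
move=> c f g /asboolP f0 /asboolP g0; apply/asboolP => h hu.
by rewrite hdot_linearl f0// g0// mulr0 addr0.
Qed.

HB.instance Definition _ := GRing.isSubmodClosed.Build R[i] (hardy R)
  orth_inner_multiples orth_inner_multiples_submod_closed.

(* The model space K_u, the orthogonal complement of [u H^2] in [H^2]. *)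
Record model_space :=
  ModelSpace { mval :> hardy R; mvalP : mval \in orth_inner_multiples }.

HB.instance Definition _ := [isSub for mval].
HB.instance Definition _ := [Choice of model_space by <:].
HB.instance Definition _ := [SubChoice_isSubLmodule of model_space by <:].

Implicit Types f g : model_space.

Definition mdot f g : R[i] := hdot (mval f) (mval g).

Lemma mdot_linearl g : linear_for *%R (mdot^~ g).
Proof. by move=> c f h; exact: hdot_linearl. Qed.

Lemma mdot_linearr f : linear_for (Num.conj \; *%R) (mdot f).
Proof. by move=> c g h; exact: hdot_linearr. Qed.

Lemma mdotC f g : mdot f g = (-1) ^+ false * (mdot g f)^*.
Proof. exact: hdotC. Qed.

Lemma mdot_gt0 f : f != 0 -> 0 < mdot f f.
Proof. by move=> f0; apply: hdot_gt0; apply: contra_neq f0 => f0; exact: val_inj. Qed.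

HB.instance Definition _ := bilinear_isBilinear.Build R[i] model_space model_space
  R[i] *%R (Num.conj \; *%R) mdot (mdot_linearl, mdot_linearr).
HB.instance Definition _ := isHermitianSesquilinear.Build R[i] model_space false
  Num.conj mdot mdotC.
HB.instance Definition _ := isDotProduct.Build R[i] model_space mdot mdot_gt0.

Definition mnorm f : R[i] := `|mval f|.

Lemma mnormrD f g : mnorm (f + g) <= mnorm f + mnorm g.
Proof. exact: ler_normD. Qed.

Lemma mnormrZ (c : R[i]) f : mnorm (c *: f) = `|c| * mnorm f.
Proof. exact: normrZ. Qed.

Lemma mnormr0_eq0 f : mnorm f = 0 -> f = 0.
Proof. by move=> /normr0_eq0 f0; exact: val_inj. Qed.

HB.instance Definition _ :=
  Lmodule_isNormed.Build R[i] model_space mnormrD mnormrZ mnormr0_eq0.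

Lemma model_normE f : `|f| = sqrtC (mdot f f).
Proof. by []. Qed.

Lemma model_shift_subproof f : bshift f \in orth_inner_multiples.
Proof.
have /asboolP f0 := mvalP f; apply/asboolP => g [h gh].
rewrite hdot_bshift; apply: f0; exists (fshift h) => z z1.
by rewrite !heval_fshift// gh// mulrCA.
Qed.

(* The operator [X_u], i.e. the backward shift restricted to [K_u]. *)
Definition model_shift f : model_space := ModelSpace (model_shift_subproof f).

End ModelSpace.

Section Operators.
Variables (R : realType) (V : normedModType R[i]).
Implicit Types A B : V -> V.

Definition bounded_op A := linear A /\ continuous A.

Definition inverse_op A B := [/\ bounded_op B, cancel A B & cancel B A].

(* The inverse of [A] in the algebra of bounded operators; [0] if there is none. *)
Definition opinv A : V -> V := xget (fun=> 0) [set B | inverse_op A B].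

Definition opnorm A : R := sup [set rnorm (A x) | x in [set x | `|x| <= 1]].

Definition spectrum A : set R[i] :=
  [set l | ~ exists B, inverse_op (fun x => l *: x - A x) B].

Definition point_spectrum A : set R[i] :=
  [set l | ~ injective (fun x => l *: x - A x)].

Definition kernel_op A : set V := [set x | A x = 0].

(* For a subspace [N]: [N] is contained in the span of finitely many vectors. *)
Definition finite_dim (N : set V) := exists (n : nat) (e : 'I_n -> V),
  forall x, N x -> exists c : 'I_n -> R[i], x = \sum_(i < n) c i *: e i.

Variable dot : {dot V for Num.conj}.

Definition adjoint_op A B := forall x y, dot (A x) y = dot x (B y).

Definition fredholm A :=
  [/\ closed (range A), finite_dim (kernel_op A)
    & exists B, [/\ bounded_op B, adjoint_op A B & finite_dim (kernel_op B)]].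

Definition essential_spectrum A : set R[i] :=
  [set l | ~ fredholm (fun x => l *: x - A x)].

End Operators.

(* The operator Q = (I - zeta X_u)^-1 X_u on K_u. *)
Definition difference_quotient (R : realType) (u : R[i] -> R[i]) (zeta : R[i]) :
    model_space u -> model_space u :=
  opinv (fun f => f - zeta *: model_shift f) \o @model_shift R u.

(* Main.v *)
From HB Require Import structures.
Require Import Defs.
From mathcomp Require Import all_boot all_order all_algebra.
From mathcomp Require Import sesquilinear complex ring lra.
From mathcomp Require Import all_classical all_reals all_analysis.

Set Implicit Arguments.
Unset Strict Implicit.
Unset Printing Implicit Defensive.

Import Order.TTheory GRing.Theory Num.Theory.
Import numFieldNormedType.Exports.

Local Open Scope classical_set_scope.
Local Open Scope ring_scope.

(* Put X = X_u. Since Q = (1 - zeta X)^-1 X, for c = 1 + lambda zeta one has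
   lambda - Q = c (1 - zeta X)^-1 (lambda / c - X) if c <> 0, and lambda - Q is
   invertible if c = 0; so everything reduces to the operators m - X, with m the
   conjugate of eta.

   Inside the disk the equation (m - X) g = f is solved by power series: the
   solution lies in K_u for one choice of its constant coefficient if u(eta) <> 0,
   and if u(eta) = 0 the kernel is spanned by 1 / (1 - m z) and the range is closed of
   codimension one. On the circle m - X is injective with dense range, and it is
   onto only if it is bounded below (gliding hump). If eta is in the spectrum of u,
   the reproducing kernels at points where u is small are approximate
   eigenvectors, so that m - X is not bounded below; this also gives the lower
   estimate of the norm.

   The remaining case is eta on the circle outside of the spectrum. There u is bounded
   away from 0 on the inner side of an arc through eta. The function
   F_f(m) = ((m - X)^-1 f)(0) is defined on both sides of the arc, with the same
   boundary values almost everywhere, hence Cauchy's theorem holds for it on a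
   rectangle (in logarithmic coordinates) crossing the arc. Applying this to
   <(m - X)^-1 f, p> times a weight vanishing at the two points where the boundary of
   the rectangle meets the circle bounds <f, p> by |(m - X) f| |p|. *)

(** Only almost everywhere boundary values of [u] are known on the arc, so nothing is continued
    analytically: the contour crosses the arc and the two sides are matched in the limit. The match
    starts from one explicit function: for [f = X u], [F_f(m)] is [u(1/m) - u(0)] outside of the
    disk and [1 / conj(u(conj m)) - u(0)] inside, and the jump tends to 0 where [|u|] tends to 1.
    Linear combinations and the passage between [f] and [X f], in both directions, carry it to the
    projections of all monomials, which span a dense set; hence the bound must not depend on [f].

    The bound is a residue computation. With [E] running near [m] one has [(E - X)^-1 (m - X) f = f
    - (E - m) (E - X)^-1 f]. Divided by [z - z0], where [E(z0) = m], and integrated against the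
    weight, the last term gives 0 by Cauchy and [f] a nonzero multiple of itself. The left side is
    controlled by the resolvent, which may grow like the inverse square of the distance to the
    circle: one factor comes from dividing by [1 - m z], one from the kernel that corrects the
    solution back into K_u. Hence the zeros of the weight are double. *)

Section ComplexNorm.
Variable R : realType.
Implicit Types (x y z : R[i]) (a b : R).

Lemma complexRI (z : R[i]) : z = (complex.Re z)%:C%C + 'i%C * (complex.Im z)%:C%C.
Proof. by case: z => a b; simpc. Qed.

Lemma rnorm_sqr z : ((rnorm z) ^+ 2)%:C%C = z * z^*.
Proof. by rewrite rmorphXn /= -normCE normCK. Qed.

Lemma rnorm0 : rnorm (0 : R[i]) = 0.
Proof. by apply: complexI; rewrite -normCE normr0. Qed.

Lemma rnorm1 : rnorm (1 : R[i]) = 1.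
Proof. by apply: complexI; rewrite -normCE normr1. Qed.

Lemma rnorm_eq0 z : (rnorm z == 0) = (z == 0).
Proof. by rewrite -(normr_eq0 z) normCE; apply/eqP/eqP => [->|[]]. Qed.

Lemma rnorm_gt0 z : (0 < rnorm z) = (z != 0).
Proof. by rewrite lt_neqAle rnorm_ge0 andbT eq_sym rnorm_eq0. Qed.

Lemma rnormN z : rnorm (- z) = rnorm z.
Proof. by apply: complexI; rewrite -!normCE normrN. Qed.

Lemma rnormB x y : rnorm (x - y) = rnorm (y - x).
Proof. by rewrite -rnormN opprB. Qed.

Lemma rnorm_le_sub x y : rnorm (x - y) <= rnorm x + rnorm y.
Proof. by rewrite (le_trans (rnormD _ _))// rnormN. Qed.

Lemma rnorm_sub_le x y : rnorm x - rnorm y <= rnorm (x - y).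
Proof. by rewrite lerBlDr (le_trans _ (rnormD _ _))// subrK. Qed.

Lemma rnorm_tri x y z : rnorm (x - z) <= rnorm (x - y) + rnorm (y - z).
Proof. by rewrite (le_trans _ (rnormD _ _))// addrA subrK. Qed.

Lemma rnorm_dist x y : `|rnorm x - rnorm y| <= rnorm (x - y).
Proof.
by rewrite ler_norml rnorm_sub_le andbT lerNl opprB rnormB rnorm_sub_le.
Qed.

Lemma rnormX z n : rnorm (z ^+ n) = rnorm z ^+ n.
Proof. by apply: complexI; rewrite -!normCE rmorphXn /= -normCE normrX. Qed.

Lemma rnormV z : rnorm z^-1 = (rnorm z)^-1.
Proof. by apply: complexI; rewrite -!normCE fmorphV /= -normCE normfV. Qed.

Lemma rnormR a : rnorm a%:C%C = `|a|.
Proof. by rewrite /rnorm /= expr0n addr0 sqrtr_sqr. Qed.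

Lemma rnorm_i : rnorm ('i%C : R[i]) = 1.
Proof. by rewrite /rnorm /= expr0n expr1n add0r sqrtr1. Qed.

Lemma rnorm_sum (I : Type) (r : seq I) (P : pred I) (F : I -> R[i]) :
  rnorm (\sum_(i <- r | P i) F i) <= \sum_(i <- r | P i) rnorm (F i).
Proof.
elim/big_ind2 : _ => [|? ? ? ? h1 h2|//]; first by rewrite rnorm0.
exact: le_trans (rnormD _ _) (lerD h1 h2).
Qed.

Lemma rnorm_le_ReIm z : rnorm z <= `|complex.Re z| + `|complex.Im z|.
Proof.
by rewrite {1}(complexRI z) (le_trans (rnormD _ _))// rnormM rnorm_i mul1r !rnormR.
Qed.

Lemma rnorm_lt1 z : (`|z| < 1) = (rnorm z < 1).
Proof. by rewrite normCE ltcR. Qed.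

Lemma diskP z : disk z <-> rnorm z < 1.
Proof. by rewrite /disk /= rnorm_lt1. Qed.

Lemma circleP z : circle z <-> rnorm z = 1.
Proof. by rewrite /circle /= normCE; split => [[]|->]. Qed.

Lemma cReD x y : complex.Re (x + y) = complex.Re x + complex.Re y.
Proof. by case: x y => ? ? []. Qed.

Lemma cImD x y : complex.Im (x + y) = complex.Im x + complex.Im y.
Proof. by case: x y => ? ? []. Qed.

Lemma cReM x y : complex.Re (x * y) =
  complex.Re x * complex.Re y - complex.Im x * complex.Im y.
Proof. by case: x y => ? ? []. Qed.

Lemma cImM x y : complex.Im (x * y) =
  complex.Re x * complex.Im y + complex.Im x * complex.Re y.
Proof. by case: x y => ? ? []. Qed.

Lemma normr_rnorm (V : normedModType R[i]) (x : V) : `|x| = (rnorm x)%:C%C.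
Proof.
have := normr_ge0 x; rewrite /rnorm; case: `|x| => c d.
by rewrite lecE /= => /andP[/eqP -> _].
Qed.

End ComplexNorm.

(** * Limits in the complex plane *)

Section ComplexLimits.
Variables (R : realType) (T : Type) (F : set_system T).
Context {FF : Filter F}.
Implicit Types (f g : T -> R[i]) (l k : R[i]).

(** Balls of [R[i]] have radii in [R[i]], and a positive element there is a positive real; the
    limits below are handled with radii in [R]. *)
Lemma cvgCP f l : f @ F --> l <->
  (forall e : R, 0 < e -> \forall x \near F, rnorm (l - f x) < e).
Proof.
split=> [/(@cvgrPdist_lt _ R[i]) h e e0|h].
  have {}e0 : 0 < e%:C%C by rewrite ltcR.
  by apply: filterS (h _ e0) => x; rewrite normCE ltcR.
apply/(@cvgrPdist_lt _ R[i]) => -[a b]; rewrite ltcE /= => /andP[/eqP -> a0].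
by apply: filterS (h _ a0) => x; rewrite normCE ltcR.
Qed.

Lemma cvg_Re f l : f @ F --> l -> (fun x => complex.Re (f x)) @ F --> complex.Re l.
Proof.
move=> /cvgCP h; apply/cvgrPdist_lt => e e0; apply: filterS (h _ e0) => x.
by apply: le_lt_trans; rewrite -raddfB; exact: Re_le_rnorm.
Qed.

Lemma cvg_Im f l : f @ F --> l -> (fun x => complex.Im (f x)) @ F --> complex.Im l.
Proof.
move=> /cvgCP h; apply/cvgrPdist_lt => e e0; apply: filterS (h _ e0) => x.
by apply: le_lt_trans; rewrite -raddfB; exact: Im_le_rnorm.
Qed.

Lemma cvg_rnorm f l : f @ F --> l -> (fun x => rnorm (f x)) @ F --> rnorm l.
Proof.
move=> /cvgCP h; apply/cvgrPdist_lt => e e0; apply: filterS (h _ e0) => x.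
by apply: le_lt_trans; exact: rnorm_dist.
Qed.

Lemma cvg_conj f l : f @ F --> l -> (fun x => (f x)^*) @ F --> l^*.
Proof.
move=> /cvgCP h; apply/cvgCP => e e0; apply: filterS (h _ e0) => x.
by rewrite -rmorphB rnorm_conj.
Qed.

Lemma cvgCD f g l k : f @ F --> l -> g @ F --> k -> (fun x => f x + g x) @ F --> l + k.
Proof. exact: (@cvgD R[i] R[i]). Qed.

Lemma cvgCN f l : f @ F --> l -> (fun x => - f x) @ F --> - l.
Proof. exact: (@cvgN R[i] R[i]). Qed.

Lemma cvgCB f g l k : f @ F --> l -> g @ F --> k -> (fun x => f x - g x) @ F --> l - k.
Proof. by move=> fl gk; exact: (cvgCD fl (cvgCN gk)). Qed.

Lemma cvgCM f g l k : f @ F --> l -> g @ F --> k -> (fun x => f x * g x) @ F --> l * k.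
Proof. by move=> fl gk; exact: (@cvgM R[i] T F FF f g l k fl gk). Qed.

Lemma cvgCV f l : l != 0 -> f @ F --> l -> (fun x => (f x)^-1) @ F --> l^-1.
Proof. exact: cvgV. Qed.

Lemma cvgC_squeeze (k : T -> R) f l :
  (\forall x \near F, rnorm (f x - l) <= k x) -> k @ F --> (0 : R) -> f @ F --> l.
Proof.
move=> fk /cvgrPdist_lt h; apply/cvgCP => e e0.
apply: filterS2 fk (h _ e0) => x; rewrite sub0r normrN rnormB => h1 h2.
exact: le_lt_trans h1 (le_lt_trans (ler_norm _) h2).
Qed.

End ComplexLimits.

Lemma cvg_real_complex (R : realType) (T : Type) (F : set_system T)
    {FF : Filter F} (g : T -> R) (l : R) :
  g @ F --> l -> (fun x => (g x)%:C%C) @ F --> l%:C%C.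
Proof.
move=> /cvgrPdist_lt h; apply/cvgCP => e e0; apply: filterS (h _ e0) => x.
by rewrite -rmorphB rnormR.
Qed.

Lemma nbhsCP (R : realType) (z : R[i]) (A : set R[i]) :
  nbhs z A <-> exists2 d : R, 0 < d & forall w, rnorm (z - w) < d -> A w.
Proof.
split=> [/nbhs_ballP[[a b]]|[d d0 h]].
  rewrite /= ltcE /= => /andP[/eqP -> a0] h; exists a => // w zw; apply: h.
  by rewrite -ball_normE /ball_ /= normCE ltcR.
apply/nbhs_ballP; exists d%:C%C; first by rewrite /= ltcR.
by move=> w; rewrite -ball_normE /ball_ /= normCE ltcR => /h.
Qed.

(** * Integrals of complex functions over an interval *)

Section ComplexIntegral.
Variable R : realType.
Notation mu := (@lebesgue_measure R).
Implicit Types (a b c t : R) (F G : R -> R[i]).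

(** Continuity of the restriction to [[a, b]]: the limit at an endpoint is one-sided. *)
Record contin_on a b F : Prop := ContinOn {
  contin_on_cvg : forall t, a <= t <= b ->
    F s @[s --> within `[a, b]%classic (nbhs t)] --> F t }.

Lemma contin_on_cst a b z : contin_on a b (fun=> z).
Proof. by split => t _; exact: cvg_cst. Qed.

Lemma contin_onD a b F G : contin_on a b F -> contin_on a b G ->
  contin_on a b (fun t => F t + G t).
Proof. by move=> [f] [g]; split => t h; apply: cvgCD; [exact: f|exact: g]. Qed.

Lemma contin_onM a b F G : contin_on a b F -> contin_on a b G ->
  contin_on a b (fun t => F t * G t).
Proof. by move=> [f] [g]; split => t h; apply: cvgCM; [exact: f|exact: g]. Qed.

Lemma contin_onB a b F G : contin_on a b F -> contin_on a b G ->
  contin_on a b (fun t => F t - G t).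
Proof. by move=> [f] [g]; split => t h; apply: cvgCB; [exact: f|exact: g]. Qed.

Lemma contin_on_conj a b F : contin_on a b F -> contin_on a b (fun t => (F t)^*).
Proof. by move=> [f]; split => t h; apply: cvg_conj; exact: f. Qed.

Lemma contin_on_sub a b c d F : a <= c -> d <= b -> contin_on a b F -> contin_on c d F.
Proof.
move=> ac db [f]; split => t /andP[ct td].
have tab : a <= t <= b by rewrite (le_trans ac ct) (le_trans td db).
apply: cvg_trans (f t tab); apply: cvg_app => A; rewrite /within /= /nbhs /=.
apply: filterS => s h; rewrite in_itv/= => /andP[cs sd]; apply: h.
by rewrite in_itv/= (le_trans ac cs) (le_trans sd db).
Qed.

Lemma contin_on_real a b (g : R -> R) : continuous g ->
  contin_on a b (fun t => (g t)%:C%C).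
Proof.
move=> cg; split => t _; apply: cvg_real_complex.
by apply: cvg_within_filter; exact: cg.
Qed.

Lemma contin_on_part a b (p : R[i] -> R) F :
  (forall (S : set_system R) l, Filter S -> F @ S --> l ->
     (fun x => p (F x)) @ S --> p l) ->
  contin_on a b F -> {within `[a, b]%classic, continuous (p \o F)}.
Proof.
move=> hp [f]; apply/subspace_continuousP => t /= tab; apply: hp.
by apply: f; move: tab; rewrite in_itv.
Qed.

Lemma contin_on_integrable a b (p : R[i] -> R) F :
  (forall (S : set_system R) l, Filter S -> F @ S --> l ->
     (fun x => p (F x)) @ S --> p l) ->
  contin_on a b F -> mu.-integrable `[a, b]%classic (EFin \o (p \o F)).
Proof.
move=> hp f; apply: continuous_compact_integrable; first exact: segment_compact.
exact: contin_on_part f.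
Qed.

Lemma contin_on_intRe a b F : contin_on a b F ->
  mu.-integrable `[a, b]%classic (EFin \o (fun t => complex.Re (F t))).
Proof. by apply: contin_on_integrable => S l FS; exact: cvg_Re. Qed.

Lemma contin_on_intIm a b F : contin_on a b F ->
  mu.-integrable `[a, b]%classic (EFin \o (fun t => complex.Im (F t))).
Proof. by apply: contin_on_integrable => S l FS; exact: cvg_Im. Qed.

Definition Cint a b F : R[i] :=
  ((\int[mu]_(t in `[a, b]) complex.Re (F t)) +i*
   (\int[mu]_(t in `[a, b]) complex.Im (F t)))%C.

Lemma eq_Cint a b F G : (forall t, a <= t <= b -> F t = G t) -> Cint a b F = Cint a b G.
Proof.
move=> FG; congr (_ +i* _)%C; apply: eq_Rintegral => t; rewrite inE/= in_itv/= => h;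
  by rewrite FG.
Qed.

Lemma CintD a b F G : contin_on a b F -> contin_on a b G ->
  Cint a b (fun t => F t + G t) = Cint a b F + Cint a b G.
Proof.
move=> f g; rewrite /Cint; simpc; congr (_ +i* _)%C.
  rewrite -RintegralD//; [|exact: contin_on_intRe|exact: contin_on_intRe].
  by apply: eq_Rintegral => t _; exact: cReD.
rewrite -RintegralD//; [|exact: contin_on_intIm|exact: contin_on_intIm].
by apply: eq_Rintegral => t _; exact: cImD.
Qed.

Lemma CintZ a b (z : R[i]) F : contin_on a b F ->
  Cint a b (fun t => z * F t) = z * Cint a b F.
Proof.
move=> f; have fR := contin_on_intRe f; have fI := contin_on_intIm f.
have iR (c : R) : mu.-integrable `[a, b]%classic (EFin \o (fun t => c * complex.Re (F t))).
  exact: (@integrableZl _ _ _ mu _ (measurable_itv _) c _ fR).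
have iI (c : R) : mu.-integrable `[a, b]%classic (EFin \o (fun t => c * complex.Im (F t))).
  exact: (@integrableZl _ _ _ mu _ (measurable_itv _) c _ fI).
rewrite /Cint; case: z => x y; simpc; congr (_ +i* _)%C.
  rewrite -!RintegralZl// -RintegralB//.
  by apply: eq_Rintegral => t _; rewrite cReM.
rewrite -!RintegralZl// -RintegralD//.
by apply: eq_Rintegral => t _; rewrite cImM.
Qed.

Lemma CintB a b F G : contin_on a b F -> contin_on a b G ->
  Cint a b (fun t => F t - G t) = Cint a b F - Cint a b G.
Proof.
move=> f g; rewrite -mulN1r -CintZ// -CintD//.
  by apply: eq_Cint => t _; rewrite mulN1r.
exact: contin_onM (contin_on_cst _ _ _) g.
Qed.

Lemma Cint_cst a b z : a <= b -> Cint a b (fun=> z) = (b - a)%:C%C * z.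
Proof.
move=> ab; have mI : mu `[a, b]%classic = (b - a)%:E.
  rewrite [LHS]lebesgue_measure_itv/= lte_fin; case: ltP => // ba.
  have -> : b = a by apply/le_anti; rewrite ba ab.
  by rewrite subrr.
have e r : \int[mu]_(_ in `[a, b]) r = (b - a) * r.
  by rewrite mulrC -[b - a]/(fine (b - a)%:E) -mI; exact: Rintegral_cst.
by rewrite /Cint !e; case: z => x y; simpc.
Qed.

Lemma Cint_split a b c F : a <= b -> b <= c -> contin_on a c F ->
  Cint a c F = Cint a b F + Cint b c F.
Proof.
move=> ab bc f; have fR := contin_on_intRe f; have fI := contin_on_intIm f.
have key (g : R -> R) : mu.-integrable `[a, c]%classic (EFin \o g) ->
    \int[mu]_(t in `[a, c]) g t =
    \int[mu]_(t in `[a, b]) g t + \int[mu]_(t in `[b, c]) g t.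
  move=> ig; have := @Rintegral_itvB _ g (BLeft a) (BRight c) b ig.
  rewrite !bnd_simp => /(_ ab bc) h.
  have <- : \int[mu]_(t in `]b, c]) g t = \int[mu]_(t in `[b, c]) g t.
    apply: Rintegral_itv_obnd_cbnd; apply: integrableS ig => //.
    by apply: subset_itv; rewrite bnd_simp.
  by rewrite -h addrC subrK.
by rewrite /Cint; simpc; rewrite !key.
Qed.

Lemma Rint_ReE a b F : contin_on a b F -> complex.Re (Cint a b F) =
  \int[mu]_(t in `[a, b]) complex.Re (F t).
Proof. by []. Qed.

Lemma le_rnorm_Cint a b F (k : R) : a <= b -> contin_on a b F ->
  (forall t, a <= t <= b -> rnorm (F t) <= k) -> rnorm (Cint a b F) <= (b - a) * k.
Proof.
move=> ab f Fk.
have k0 : 0 <= k by apply: le_trans (Fk a _); rewrite ?rnorm_ge0// lexx ab.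
have bak : 0 <= (b - a) * k by rewrite mulr_ge0// subr_ge0.
have [->|I0] := eqVneq (Cint a b F) 0; first by rewrite rnorm0.
set I := Cint a b F in I0 *.
(* Rotating the value of the integral to the positive axis reduces the bound to
   the real part. *)
pose w := I^* / (rnorm I)%:C%C.
have I1 : (rnorm I)%:C%C != 0 :> R[i] by rewrite -normCE normr_eq0.
have w1 : rnorm w = 1.
  by rewrite rnormM rnormV rnormR rnorm_conj ger0_norm ?rnorm_ge0// mulfV// rnorm_eq0.
have wI : w * I = (rnorm I)%:C%C.
  by rewrite /w mulrAC [X in X / _]mulrC -rnorm_sqr rmorphXn /= expr2 mulfK.
have fw : contin_on a b (fun t => w * F t) by exact: contin_onM (contin_on_cst _ _ _) f.
have -> : rnorm I = complex.Re (w * I) by rewrite wI.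
rewrite -CintZ// Rint_ReE//.
have -> : (b - a) * k = complex.Re (Cint a b (fun=> k%:C%C)).
  by rewrite Cint_cst//; simpc.
rewrite Rint_ReE; last exact: contin_on_cst.
apply: le_Rintegral => //; [exact: contin_on_intRe| |].
  exact/contin_on_intRe/contin_on_cst.
move=> t /=; rewrite in_itv/= => /Fk h.
apply: le_trans (le_trans (Re_le_rnorm _) _); first exact: ler_norm.
by rewrite rnormM w1 mul1r.
Qed.

(** Dominated convergence with a constant majorant, for the real and imaginary parts. Convergence
    almost everywhere is what the boundary values of an inner function provide. *)
Lemma Cint_dominated a b (F : nat -> R -> R[i]) (G : R -> R[i]) (k : R) :
  (forall n, contin_on a b (F n)) -> contin_on a b G ->
  (forall n t, a <= t <= b -> rnorm (F n t) <= k) ->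
  {ae mu, forall t, a <= t <= b -> F n t @[n --> \oo] --> G t} ->
  Cint a b (F n) @[n --> \oo] --> Cint a b G.
Proof.
move=> fc gc Fk FG.
have key (p : R[i] -> R) :
    (forall (g : R -> R[i]), contin_on a b g ->
        mu.-integrable `[a, b]%classic (EFin \o (p \o g))) ->
    (forall z, `|p z| <= rnorm z) ->
    (forall (f : nat -> R[i]) l, f @ \oo --> l -> (fun n => p (f n)) @ \oo --> p l) ->
    \int[mu]_(t in `[a, b]) p (F n t) @[n --> \oo] --> \int[mu]_(t in `[a, b]) p (G t).
  move=> ip pn pc.
  have [] := @dominated_convergence _ _ _ mu `[a, b]%classic (measurable_itv _)
    (fun n t => (p (F n t))%:E) (fun t => (p (G t))%:E) (cst k%:E).
  - by move=> n; have /integrableP[] := ip _ (fc n).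
  - by have /integrableP[] := ip _ gc.
  - have FA := @ae_filter_ringOfSetsType _ _ _ mu.
    apply: filterS FG => t h /=; rewrite in_itv/= => /h {}h.
    by apply: cvg_EFin; [exact: nearW|exact: pc].
  - exact: (contin_on_intRe (contin_on_cst a b k%:C%C)).
  - apply: aeW => t n /=; rewrite in_itv/= => tab.
    by rewrite lee_fin; exact: le_trans (pn _) (Fk n t tab).
  - move=> iG _; rewrite -[X in _ --> X]fineK; last exact: integrable_fin_num.
    exact: fine_cvg.
apply: cvg_complex => /=.
- by apply: key => [g|z|f l]; [exact: contin_on_intRe|exact: Re_le_rnorm|exact: cvg_Re].
- by apply: key => [g|z|f l]; [exact: contin_on_intIm|exact: Im_le_rnorm|exact: cvg_Im].
Qed.

End ComplexIntegral.

(** * Complex differentiability *)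

Section Holomorphic.
Variable R : realType.
Implicit Types (H G : R[i] -> R[i]) (z w : R[i]).

Lemma near_atP z (P : R[i] -> Prop) : (\forall w \near z, P w) <->
  exists2 d : R, 0 < d & forall w, rnorm (z - w) < d -> P w.
Proof. exact: nbhsCP. Qed.

Record tends H z (l : R[i]) : Prop := Tends { tends_cvg : H @ nbhs z --> l }.

Lemma tendsP H z l : tends H z l <-> forall e : R, 0 < e ->
  exists2 d : R, 0 < d & forall w, rnorm (z - w) < d -> rnorm (l - H w) < e.
Proof.
split=> [[] h e e0|h].
  have [d d0 hd] := proj1 (@near_atP z _) (proj1 (@cvgCP R _ (nbhs z) _ H l) h e e0).
  by exists d.
split; apply: (proj2 (@cvgCP R _ (nbhs z) _ H l)) => e e0.
by apply: (proj2 (@near_atP z _)); exact: h.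
Qed.

Lemma tends_cst (k : R[i]) z : tends (fun=> k) z k.
Proof. by split; exact: (@cvg_cst _ k _ (nbhs z) _). Qed.

Lemma tends_id z : tends id z z.
Proof. by split; exact: cvg_id. Qed.

Lemma tendsD H G z l k : tends H z l -> tends G z k ->
  tends (fun w => H w + G w) z (l + k).
Proof. by move=> [h] [g]; split; exact: (@cvgCD R _ (nbhs z) _ _ _ _ _ h g). Qed.

Lemma tendsN H z l : tends H z l -> tends (fun w => - H w) z (- l).
Proof. by move=> [h]; split; exact: (@cvgCN R _ (nbhs z) _ _ _ h). Qed.

Lemma tendsM H G z l k : tends H z l -> tends G z k ->
  tends (fun w => H w * G w) z (l * k).
Proof. by move=> [h] [g]; split; exact: (@cvgCM R _ (nbhs z) _ _ _ _ _ h g). Qed.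

Lemma tendsV H z l : l != 0 -> tends H z l -> tends (fun w => (H w)^-1) z l^-1.
Proof. by move=> l0 [h]; split; exact: (@cvgCV R _ (nbhs z) _ _ _ l0 h). Qed.

Lemma tends_comp H G z k l : tends G z k -> tends H k l -> tends (fun w => H (G w)) z l.
Proof. by move=> [g] [h]; split; exact: cvg_comp g h. Qed.

Lemma tends_near H G z l : (\forall w \near z, H w = G w) -> tends G z l -> tends H z l.
Proof.
move=> /near_atP[d d0 HG] /tendsP h; apply/tendsP => e e0; have [d' d'0 g] := h e e0.
exists (Num.min d d'); first by rewrite lt_min d0.
by move=> w; rewrite lt_min => /andP[h1 h2]; rewrite HG//; exact: g.
Qed.

Lemma tends_neq0 H z l : tends H z l -> l != 0 -> \forall w \near z, H w != 0.
Proof.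
move=> /tendsP h l0; have := h (rnorm l); rewrite rnorm_gt0 => /(_ l0)[d d0 k].
apply/near_atP; exists d => // w /k; apply: contraTneq => ->.
by rewrite subr0 ltxx.
Qed.

(* Carathéodory's form of complex differentiability at [z]. *)
Inductive hol H z : Prop := Hol (phi : R[i] -> R[i]) of
  tends phi z (phi z) & \forall w \near z, H w = H z + phi w * (w - z).

Lemma hol_cst (k : R[i]) z : hol (fun=> k) z.
Proof.
apply: (@Hol _ _ (fun=> 0)); first exact: tends_cst.
by apply: filterE => w; rewrite mul0r addr0.
Qed.

Lemma hol_id z : hol id z.
Proof.
apply: (@Hol _ _ (fun=> 1)); first exact: tends_cst.
by apply: filterE => w /=; rewrite mul1r addrC subrK.
Qed.

Lemma hol_tends H z : hol H z -> tends H z (H z).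
Proof.
move=> [phi phiz e]; apply: tends_near e _.
have := tendsD (tends_cst (H z) z) (tendsM phiz (tendsD (tends_id z) (tends_cst (- z) z))).
by rewrite subrr mulr0 addr0.
Qed.

Lemma hol_near H G z : (\forall w \near z, H w = G w) -> hol G z -> hol H z.
Proof.
move=> HG [phi phiz e]; have Hz := nbhs_singleton HG.
by apply: (Hol phiz); apply: filterS2 HG e => w -> ->; rewrite Hz.
Qed.

Lemma holD H G z : hol H z -> hol G z -> hol (fun w => H w + G w) z.
Proof.
move=> [p pz ep] [q qz eq]; apply: (@Hol _ _ (fun w => p w + q w)).
  exact: tendsD.
by apply: filterS2 ep eq => w -> ->; ring.
Qed.

Lemma holM H G z : hol H z -> hol G z -> hol (fun w => H w * G w) z.
Proof.
move=> hH hG; have cG := hol_tends hG.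
case: hH hG => p pz ep [q qz eq].
apply: (@Hol _ _ (fun w => p w * G w + H z * q w)).
  exact: (tendsD (tendsM pz cG) (tendsM (tends_cst _ z) qz)).
by apply: filterS2 ep eq => w -> eG; rewrite mulrDl -mulrA [G w in X in X + _]eG; ring.
Qed.

Lemma holN H z : hol H z -> hol (fun w => - H w) z.
Proof.
move=> [p pz ep]; apply: (@Hol _ _ (fun w => - p w)); first exact: tendsN.
by apply: filterS ep => w ->; ring.
Qed.

Lemma holB H G z : hol H z -> hol G z -> hol (fun w => H w - G w) z.
Proof. by move=> h g; apply: holD h _; exact: holN. Qed.

Lemma holV H z : hol H z -> H z != 0 -> hol (fun w => (H w)^-1) z.
Proof.
move=> hH Hz; have cH := hol_tends hH; have H0 := tends_neq0 cH Hz.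
case: hH => p pz ep; apply: (@Hol _ _ (fun w => - (p w * (H w * H z)^-1))).
  have HzHz : H z * H z != 0 by rewrite mulf_neq0.
  exact: (tendsN (tendsM pz (tendsV HzHz (tendsM cH (tends_cst (H z) z))))).
apply: filterS2 ep H0 => w ew Hw0; rewrite mulNr.
have -> : p w * (H w * H z)^-1 * (w - z) = (H w - H z) / (H w * H z).
  have -> : H w - H z = p w * (w - z) by rewrite ew; ring.
  by ring.
by field; rewrite Hw0 Hz.
Qed.

Lemma hol_comp H G z : hol G z -> hol H (G z) -> hol (fun w => H (G w)) z.
Proof.
move=> hG [p pz ep]; have cG := hol_tends hG.
case: hG => q qz eq; apply: (@Hol _ _ (fun w => p (G w) * q w)).
  exact: (tendsM (tends_comp cG pz) qz).
have epG : \forall w \near z, H (G w) = H (G z) + p (G w) * (G w - G z).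
  exact: (tends_cvg cG ep).
apply: filterS2 epG eq => w -> eG.
have -> : G w - G z = q w * (w - z) by rewrite eG; ring.
by rewrite mulrA.
Qed.

Lemma holX H z n : hol H z -> hol (fun w => H w ^+ n) z.
Proof.
move=> h; elim: n => [|n IH]; first exact: hol_cst.
by under eq_fun do rewrite exprS; exact: holM.
Qed.

Lemma hol_sum (I : Type) (r : seq I) (H : I -> R[i] -> R[i]) z :
  (forall i, hol (H i) z) -> hol (fun w => \sum_(i <- r) H i w) z.
Proof.
move=> h; elim: r => [|i r IH].
  by under eq_fun do rewrite big_nil; exact: hol_cst.
by under eq_fun do rewrite big_cons; exact: holD.
Qed.

Lemma derivable_hol H z : derivable H z 1 -> hol H z.
Proof.
move=> /cvg_ex[l hl].
pose p w := if w == z then l else (H w - H z) / (w - z).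
apply: (@Hol _ _ p); last first.
  apply: filterE => w; rewrite /p; case: eqVneq => [->|wz].
    by rewrite subrr mulr0 addr0.
  by rewrite divfK ?subr_eq0// addrC subrK.
apply/tendsP => e e0.
have h0 := proj1 (@cvgCP R _ (0^') (dnbhs_filter _) _ l) hl e e0.
have [d d0 h] := proj1 (@near_atP 0 _) h0.
exists d => // w wz; rewrite /p eqxx; case: eqVneq => [_|nwz].
  by rewrite subrr rnorm0.
have := h (w - z); rewrite sub0r rnormN rnormB wz => /(_ isT).
rewrite subr_eq0 nwz => /(_ isT) /=; rewrite /GRing.scale /= mulr1 subrK.
by rewrite mulrC.
Qed.

End Holomorphic.

(** * Contour integrals over rectangles *)

Section Rectangles.
Variable R : realType.
Notation mu := (@lebesgue_measure R).
Implicit Types (H G : R[i] -> R[i]) (a b c d x y : R).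

Definition pt x y : R[i] := (x +i* y)%C.

Lemma rnorm_pt x y : rnorm (pt x y) <= `|x| + `|y|.
Proof. exact: rnorm_le_ReIm. Qed.

Lemma ptB x y x' y' : pt x y - pt x' y' = pt (x - x') (y - y').
Proof. by []. Qed.

Lemma tends_contin_on H (g : R -> R[i]) a b :
  (forall s t, rnorm (g s - g t) <= `|s - t|) ->
  (forall t, a <= t <= b -> tends H (g t) (H (g t))) -> contin_on a b (fun t => H (g t)).
Proof.
move=> g1 Hg; split => t /Hg/tendsP h; apply/cvgCP => e e0; have [d d0 {}h] := h e e0.
apply: cvg_within; near=> s; apply: h; apply: le_lt_trans (g1 _ _) _; near: s.
by apply: (@cvgr_dist_lt R R).
Unshelve. all: by end_near. Qed.

Lemma contin_h H a b y : (forall x, a <= x <= b -> tends H (pt x y) (H (pt x y))) ->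
  contin_on a b (fun x => H (pt x y)).
Proof.
apply: tends_contin_on => s t; rewrite ptB subrr.
by apply: le_trans (rnorm_pt _ _) _; rewrite normr0 addr0.
Qed.

Lemma contin_v H c d x : (forall y, c <= y <= d -> tends H (pt x y) (H (pt x y))) ->
  contin_on c d (fun y => H (pt x y)).
Proof.
apply: tends_contin_on => s t; rewrite ptB subrr.
by apply: le_trans (rnorm_pt _ _) _; rewrite normr0 add0r.
Qed.

(** The counterclockwise contour integral of [H] over the boundary of [[a, b] x [c, d]]: bottom
    minus top, then right minus left with [dz = i dy]. *)
Definition Rint H a b c d : R[i] :=
  Cint a b (fun x => H (pt x c)) - Cint a b (fun x => H (pt x d)) +
  'i%C * (Cint c d (fun y => H (pt b y)) - Cint c d (fun y => H (pt a y))).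

Definition hol_rect H a b c d :=
  forall x y, a <= x <= b -> c <= y <= d -> hol H (pt x y).

Lemma hol_rect_sub H a b c d a' b' c' d' :
  a <= a' -> b' <= b -> c <= c' -> d' <= d -> hol_rect H a b c d -> hol_rect H a' b' c' d'.
Proof.
move=> aa bb cc dd h x y /andP[x1 x2] /andP[y1 y2]; apply: h.
  by rewrite (le_trans aa x1) (le_trans x2 bb).
by rewrite (le_trans cc y1) (le_trans y2 dd).
Qed.

Lemma hol_rect_h H a b c d y : c <= y <= d -> hol_rect H a b c d ->
  contin_on a b (fun x => H (pt x y)).
Proof. by move=> cyd h; apply: contin_h => x axb; apply: hol_tends; exact: h. Qed.

Lemma hol_rect_v H a b c d x : a <= x <= b -> hol_rect H a b c d ->
  contin_on c d (fun y => H (pt x y)).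
Proof. by move=> axb h; apply: contin_v => y cyd; apply: hol_tends; exact: h. Qed.

Lemma Rint_hsplit H a m b c d : a <= m <= b -> c <= d -> hol_rect H a b c d ->
  Rint H a b c d = Rint H a m c d + Rint H m b c d.
Proof.
move=> /andP[am mb] cd h.
have hc : contin_on a b (fun x => H (pt x c)) by apply: hol_rect_h h; rewrite lexx cd.
have hd : contin_on a b (fun x => H (pt x d)) by apply: hol_rect_h h; rewrite lexx cd.
by rewrite /Rint (Cint_split am mb hc) (Cint_split am mb hd); ring.
Qed.

Lemma Rint_vsplit H a b c m d : a <= b -> c <= m <= d -> hol_rect H a b c d ->
  Rint H a b c d = Rint H a b c m + Rint H a b m d.
Proof.
move=> ab /andP[cm md] h.
have ha : contin_on c d (fun y => H (pt a y)) by apply: hol_rect_v h; rewrite lexx ab.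
have hb : contin_on c d (fun y => H (pt b y)) by apply: hol_rect_v h; rewrite lexx ab.
by rewrite /Rint (Cint_split cm md ha) (Cint_split cm md hb); ring.
Qed.

Record contin_edges H a b c d : Prop := ContinEdges {
  ce_c : contin_on a b (fun x => H (pt x c));
  ce_d : contin_on a b (fun x => H (pt x d));
  ce_a : contin_on c d (fun y => H (pt a y));
  ce_b : contin_on c d (fun y => H (pt b y)) }.

Lemma hol_edges H a b c d : a <= b -> c <= d -> hol_rect H a b c d ->
  contin_edges H a b c d.
Proof.
move=> ab cd h; split; (apply: hol_rect_h h || apply: hol_rect_v h);
  by rewrite lexx ?ab ?cd.
Qed.

Lemma RintD H G a b c d : contin_edges H a b c d -> contin_edges G a b c d ->
  Rint (fun z => H z + G z) a b c d = Rint H a b c d + Rint G a b c d.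
Proof. by move=> [h1 h2 h3 h4] [g1 g2 g3 g4]; rewrite /Rint !CintD//; ring. Qed.

Lemma RintZ (k : R[i]) H a b c d : contin_edges H a b c d ->
  Rint (fun z => k * H z) a b c d = k * Rint H a b c d.
Proof. by move=> [h1 h2 h3 h4]; rewrite /Rint !CintZ//; ring. Qed.

(** On opposite edges the integrand differs by a constant; the two pairs contribute opposite
    multiples of the area. *)
Lemma Rint_affine (k l : R[i]) a b c d : a <= b -> c <= d ->
  Rint (fun z => k + l * z) a b c d = 0.
Proof.
move=> ab cd.
have e (z : R[i]) : hol (fun z => k + l * z) z.
  by apply: holD; [exact: hol_cst|apply: holM; [exact: hol_cst|exact: hol_id]].
have [h1 h2 h3 h4] : contin_edges (fun z => k + l * z) a b c d.
  by apply: hol_edges => // x y _ _; exact: e.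
rewrite /Rint -!CintB//.
rewrite (@eq_Cint _ _ _ _ (fun=> l * pt 0 (c - d))); last first.
  by move=> x _; rewrite -(subrr x) -ptB; ring.
rewrite (@eq_Cint _ c d _ (fun=> l * pt (b - a) 0)); last first.
  by move=> y _; rewrite -(subrr y) -ptB; ring.
rewrite !Cint_cst//.
have -> : pt 0 (c - d) = - ('i%C * (d - c)%:C%C).
  by apply/eqP; rewrite eq_complex /=; apply/andP; split; apply/eqP; ring.
by rewrite -[pt (b - a) 0]/((b - a)%:C%C); ring.
Qed.

Lemma le_rnorm_Rint H a b c d (k : R) : a <= b -> c <= d -> contin_edges H a b c d ->
  (forall x y, a <= x <= b -> c <= y <= d -> [|| x == a, x == b, y == c | y == d] ->
    rnorm (H (pt x y)) <= k) ->
  rnorm (Rint H a b c d) <= 2 * ((b - a) + (d - c)) * k.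
Proof.
move=> ab cd [h1 h2 h3 h4] hk.
have aa : a <= a <= b by rewrite lexx. have bb : a <= b <= b by rewrite lexx ab.
have cc : c <= c <= d by rewrite lexx. have dd : c <= d <= d by rewrite lexx cd.
have i1 : rnorm (Cint a b (fun x => H (pt x c))) <= (b - a) * k.
  by apply: le_rnorm_Cint => // x hx; apply: hk => //; rewrite eqxx !orbT.
have i2 : rnorm (Cint a b (fun x => H (pt x d))) <= (b - a) * k.
  by apply: le_rnorm_Cint => // x hx; apply: hk => //; rewrite eqxx !orbT.
have i3 : rnorm (Cint c d (fun x => H (pt b x))) <= (d - c) * k.
  by apply: le_rnorm_Cint => // x hx; apply: hk => //; rewrite eqxx !orbT.
have i4 : rnorm (Cint c d (fun x => H (pt a x))) <= (d - c) * k.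
  by apply: le_rnorm_Cint => // x hx; apply: hk => //; rewrite eqxx.
have j1 := rnorm_le_sub (Cint a b (fun x => H (pt x c))) (Cint a b (fun x => H (pt x d))).
have j2 := rnorm_le_sub (Cint c d (fun x => H (pt b x))) (Cint c d (fun x => H (pt a x))).
rewrite /Rint; apply: le_trans (rnormD _ _) _; rewrite rnormM rnorm_i mul1r.
lra.
Qed.

End Rectangles.

(** * Cauchy's theorem for rectangles *)

Section Goursat.
Variable R : realType.
Notation mu := (@lebesgue_measure R).
Implicit Types (H G : R[i] -> R[i]) (a b c d x y : R).

(** The first-order Taylor polynomial [G] at [z] integrates to 0; what remains is at most [e] times
    the distance to [z], hence at most [e] times the half-perimeter. *)
Lemma Rint_local H z (e : R) : hol H z -> 0 < e ->
  exists2 r : R, 0 < r & forall a b c d, a <= b -> c <= d -> hol_rect H a b c d ->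
    a <= complex.Re z <= b -> c <= complex.Im z <= d -> (b - a) + (d - c) < r ->
    rnorm (Rint H a b c d) <= 2 * e * ((b - a) + (d - c)) ^+ 2.
Proof.
move=> [p pz ep] e0.
have /tendsP/(_ e e0)[r1 r10 h1] := pz.
have /near_atP[r2 r20 h2] := ep.
exists (Num.min r1 r2) => [|a b c d ab cd hH /andP[xa xb] /andP[yc yd]].
  by rewrite lt_min r10.
rewrite lt_min => /andP[s1 s2]; set s := (b - a) + (d - c) in s1 s2 *.
have s0 : 0 <= s by rewrite addr_ge0// subr_ge0.
pose G w := (H z - p z * z) + p z * w.
have cH := hol_edges ab cd hH.
have cG : contin_edges (fun w => (-1) * G w) a b c d.
  apply: hol_edges => // x y _ _; apply: holM; first exact: hol_cst.
  by apply: holD; [exact: hol_cst|apply: holM; [exact: hol_cst|exact: hol_id]].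
have cG' : contin_edges G a b c d.
  apply: hol_edges => // x y _ _.
  by apply: holD; [exact: hol_cst|apply: holM; [exact: hol_cst|exact: hol_id]].
have -> : Rint H a b c d = Rint (fun w => H w + (-1) * G w) a b c d.
  by rewrite RintD// RintZ// Rint_affine// mulr0 addr0.
have cS : contin_edges (fun w => H w + (-1) * G w) a b c d.
  case: cH cG => [? ? ? ?] [? ? ? ?]; split; exact: contin_onD.
have := @le_rnorm_Rint R _ a b c d (e * s) ab cd cS.
have -> : 2 * (b - a + (d - c)) * (e * s) = 2 * e * s ^+ 2 by rewrite -/s; ring.
apply => x y /andP[ax xb'] /andP[cy yd'] _.
have ws : rnorm (z - pt x y) <= s.
  case: z xa xb yc yd {h1 h2 pz ep G cG cG' cS} => zx zy /= xa xb yc yd.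
  rewrite -[(zx +i* zy)%C]/(pt zx zy) ptB; apply: le_trans (rnorm_pt _ _) _.
  by apply: lerD; rewrite ler_norml; apply/andP; split; lra.
rewrite (h2 _ (le_lt_trans ws s2)) /G.
have -> : H z + p (pt x y) * (pt x y - z) + -1 * (H z - p z * z + p z * pt x y)
    = (p z - p (pt x y)) * (z - pt x y) by ring.
rewrite rnormM; apply: ler_pM; rewrite ?rnorm_ge0//.
by apply/ltW/h1; exact: le_lt_trans ws s1.
Qed.

Definition half (L : R) n := L / 2 ^+ n.

Lemma halfS (L : R) n : half L n = half L n.+1 + half L n.+1.
Proof. by rewrite /half exprS; field; rewrite expf_neq0. Qed.

Lemma half_ge0 (L : R) n : 0 <= L -> 0 <= half L n.
Proof. by move=> L0; rewrite /half divr_ge0// exprn_ge0. Qed.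

Lemma half_small (L r : R) : 0 <= L -> 0 < r -> exists n, half L n < r.
Proof.
move=> L0 r0; have [n Ln] : exists n, L / r < n%:R.
  by exists (Num.truncn (L / r)).+1; rewrite truncnS_gt.
exists n; rewrite /half ltr_pdivrMr ?exprn_gt0//.
rewrite ltr_pdivrMr// mulrC in Ln; apply: lt_le_trans Ln _.
rewrite ler_pM2l// -natrX ler_nat; exact/ltnW/ltn_expl.
Qed.

Lemma nested_point (q : nat -> R) (L : R) :
  (forall n, q n <= q n.+1 /\ q n.+1 + half L n.+1 <= q n + half L n) -> 0 <= L ->
  exists x, forall n, q n <= x <= q n + half L n.
Proof.
move=> hq L0.
have m1 n k : q n <= q (n + k)%N.
  by elim: k => [|k IH]; rewrite ?addn0// addnS; apply: le_trans IH _; have [] := hq (n + k)%N.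
have m2 n k : q (n + k)%N + half L (n + k) <= q n + half L n.
  by elim: k => [|k IH]; rewrite ?addn0// addnS; apply: le_trans IH; have [] := hq (n + k)%N.
have ub n k : q k <= q n + half L n.
  have [nk|/ltnW kn] := leqP n k.
    have := m2 n (k - n)%N; rewrite subnKC//; apply: le_trans.
    by rewrite lerDl half_ge0.
  have := m1 k (n - k)%N; rewrite subnKC// => h; apply: le_trans h _.
  by rewrite lerDl half_ge0.
have hs : has_sup (range q).
  by split; [exists (q 0%N), 0%N|exists (q 0%N + half L 0) => _ [k _ <-]].
exists (sup (range q)) => n; apply/andP; split.
  by apply: ub_le_sup; [case: hs|exists n].
by apply: ge_sup; [case: hs|move=> _ [k _ <-]].
Qed.

Lemma quarter_max (k : R) (A B C D : R[i]) :
  k + k + (k + k) <= rnorm (A + B + (C + D)) ->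
  [\/ k <= rnorm A, k <= rnorm B, k <= rnorm C | k <= rnorm D].
Proof.
move=> h; have T := rnormD (A + B) (C + D).
have T1 := rnormD A B; have T2 := rnormD C D.
have [h1|h1] := leP k (rnorm A); first exact: Or41.
have [h2|h2] := leP k (rnorm B); first exact: Or42.
have [h3|h3] := leP k (rnorm C); first exact: Or43.
apply: Or44; lra.
Qed.

(** Bisection: some quarter carries at least a quarter of the integral, so the integrals over nested
    rectangles stay above [K] times the square of the half-perimeter. At the common point this
    contradicts [Rint_local]. *)
Lemma Goursat H a b c d : a <= b -> c <= d -> hol_rect H a b c d -> Rint H a b c d = 0.
Proof.
move=> ab cd hH; apply/eqP; apply: contrapT => /negP I0.
pose L := b - a; pose M := d - c; pose s := L + M.
have L0 : 0 <= L by rewrite subr_ge0. have M0 : 0 <= M by rewrite subr_ge0.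
(* A degenerate rectangle is excluded by the local bound itself, which is 0 when the half-perimeter
   is 0. *)
have s0 : 0 < s.
  rewrite lt_neqAle addr_ge0// andbT eq_sym; apply/negP => /eqP sE; move/negP: I0; apply.
  rewrite -rnorm_eq0; apply/eqP/le_anti; rewrite rnorm_ge0 andbT.
  have hac : hol H (pt a c) by apply: hH; rewrite lexx.
  have [x x0 /(_ a b c d ab cd hH)] := Rint_local hac ltr01.
  rewrite /= !lexx ab cd -/L -/M -/s sE expr0n mulr0.
  by apply.
pose K := rnorm (Rint H a b c d) / s ^+ 2.
have K0 : 0 < K by rewrite divr_gt0 ?exprn_gt0// rnorm_gt0.
pose bad n (p : R * R) := [/\ a <= p.1, p.1 + half L n <= b, c <= p.2,
  p.2 + half M n <= d & K * (half s n) ^+ 2 <=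
    rnorm (Rint H p.1 (p.1 + half L n) p.2 (p.2 + half M n))].
pose sub n (p q : R * R) := [/\ p.1 <= q.1, q.1 + half L n.+1 <= p.1 + half L n,
  p.2 <= q.2 & q.2 + half M n.+1 <= p.2 + half M n].
have step n p : exists q, bad n p -> bad n.+1 q /\ sub n p q.
  have [|nb] := pselect (bad n p); last by exists p => /nb.
  case: p => x y [/= ax xb cy yd hK].
  have l0 := half_ge0 n.+1 L0; have m0 := half_ge0 n.+1 M0.
  rewrite /= (halfS L) (halfS M) in xb yd hK.
  set l := half L n.+1 in l0 xb yd hK *; set m := half M n.+1 in m0 yd hK *.
  have ex : x + (l + l) = x + l + l by rewrite addrA.
  have ey : y + (m + m) = y + m + m by rewrite addrA.
  have hR : hol_rect H x (x + (l + l)) y (y + (m + m)) by apply: hol_rect_sub hH.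
  have hR1 : hol_rect H x (x + l) y (y + (m + m)) by apply: hol_rect_sub hH => //; lra.
  have hR2 : hol_rect H (x + l) (x + l + l) y (y + (m + m)).
    by apply: hol_rect_sub hH => //; lra.
  have E : Rint H x (x + (l + l)) y (y + (m + m)) =
      Rint H x (x + l) y (y + m) + Rint H x (x + l) (y + m) (y + m + m) +
     (Rint H (x + l) (x + l + l) y (y + m) +
      Rint H (x + l) (x + l + l) (y + m) (y + m + m)).
    rewrite ex ey in hR hR1 hR2 *.
    rewrite (@Rint_hsplit R H x (x + l))//; [|by apply/andP; split; lra|by lra].
    rewrite (@Rint_vsplit R H x (x + l) y (y + m))//; [|by lra|by apply/andP; split; lra].
    rewrite (@Rint_vsplit R H (x + l) (x + l + l) y (y + m))//; first by lra.
    by apply/andP; split; lra.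
  have sE : K * half s n ^+ 2 = K * half s n.+1 ^+ 2 + K * half s n.+1 ^+ 2 +
      (K * half s n.+1 ^+ 2 + K * half s n.+1 ^+ 2).
    by rewrite (halfS s); ring.
  rewrite E sE in hK; have hl := halfS L n; have hm := halfS M n.
  rewrite -/l -/m in hl hm.
  have piece x' y' : x <= x' <= x + l -> y <= y' <= y + m ->
      K * half s n.+1 ^+ 2 <= rnorm (Rint H x' (x' + l) y' (y' + m)) ->
      bad n.+1 (x', y') /\ sub n (x, y) (x', y').
    rewrite /bad /sub /= -/l -/m hl hm => /andP[x1 x2] /andP[y1 y2] hk.
    by clear -ax xb cy yd l0 m0 x1 x2 y1 y2 hk; split; split => //; lra.
  have [h|h|h|h] := quarter_max hK.
  - by exists (x, y) => _; apply: piece h; rewrite lexx lerDl ?l0 ?m0.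
  - by exists (x, y + m) => _; apply: piece h; rewrite lexx lerDl ?l0 ?m0.
  - by exists (x + l, y) => _; apply: piece h; rewrite lexx lerDl ?l0 ?m0.
  - by exists (x + l, y + m) => _; apply: piece h; rewrite lexx lerDl ?l0 ?m0.
have /choice[f hf] : forall np : nat * (R * R), exists q,
    bad np.1 np.2 -> bad np.1.+1 q /\ sub np.1 np.2 q.
  by case=> n p; exact: step.
pose g := fix g n := if n is m.+1 then f (m, g m) else (a, c).
have gbad n : bad n (g n).
  elim: n => [|n IH]; last by have [] := hf (n, g n) IH.
  rewrite /bad /half /= !divr1 -/L -/M; split=> //; try by rewrite /L /M; lra.
  have -> : a + L = b by rewrite /L; ring.
  have -> : c + M = d by rewrite /M; ring.
  by rewrite /K divfK// expf_neq0// gt_eqF.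
have gsub n : sub n (g n) (g n.+1) by have [] := hf (n, g n) (gbad n).
have [x hx] : exists x, forall n, (g n).1 <= x <= (g n).1 + half L n.
  by apply: nested_point => // n; have [] := gsub n.
have [y hy] : exists y, forall n, (g n).2 <= y <= (g n).2 + half M n.
  by apply: nested_point => // n; have [] := gsub n.
have holxy : hol H (pt x y).
  have [h1 h2 h3 h4 _] := gbad 0%N.
  move: (hx 0%N) (hy 0%N) => /andP[x1 x2] /andP[y1 y2].
  by apply: hH; [rewrite (le_trans h1 x1) (le_trans x2 h2)
                |rewrite (le_trans h3 y1) (le_trans y2 h4)].
(* With [e = K / 4] the local bound is half of [K * half s n ^+ 2], the lower bound carried along by
   the bisection. *)
have K4 : 0 < K / 4 by rewrite divr_gt0.
have [r r0 hr] := Rint_local holxy K4.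
have [n nr] := half_small (ltW s0) r0.
have [h1 h2 h3 h4 h5] := gbad n.
have l0 := half_ge0 n L0; have m0 := half_ge0 n M0.
have sE : half s n = half L n + half M n by rewrite /half /s mulrDl.
have := hr (g n).1 ((g n).1 + half L n) (g n).2 ((g n).2 + half M n).
rewrite !lerDl => /(_ l0 m0 (hol_rect_sub h1 h2 h3 h4 hH) (hx n) (hy n)).
have -> (p q : R) : p + half L n - p + (q + half M n - q) = half s n.
  by rewrite sE; ring.
move=> /(_ nr) /(le_trans h5).
have : 0 < K * half s n ^+ 2 by rewrite mulr_gt0// exprn_gt0// divr_gt0// exprn_gt0.
lra.
Qed.

End Goursat.

(** * Cauchy's theorem across a line of boundary values *)

Section Crossing.
Variable R : realType.
Notation mu := (@lebesgue_measure R).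
Implicit Types (H G : R[i] -> R[i]) (a b c d x y : R).

Lemma cvg_seq_right (v : nat -> R) : (forall n, 0 < v n) -> v @ \oo --> (0 : R) ->
  v @ \oo --> (0 : R)^'+.
Proof.
move=> v0 /cvgrPdist_lt vl A [e /= e0 hA].
by have := vl _ e0; apply: filterS => n h; apply: hA.
Qed.

Lemma cvg_harmonicZ (r : R) : (fun n => r / n.+1%:R) @ \oo --> (0 : R).
Proof.
have : r * harmonic n @[n --> \oo] --> r * 0 by apply: cvgMl_tmp; exact: cvg_harmonic.
by rewrite mulr0.
Qed.

(* Cauchy's theorem across a vertical line on which nothing is known except that
   the one-sided boundary values agree almost everywhere. *)
Lemma Rint_crossing H a b c d x0 (M : R) : a < x0 < b -> c <= d ->
  (forall x y, a <= x <= b -> c <= y <= d -> rnorm (H (pt x y)) <= M) ->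
  (forall x y, a <= x <= b -> x != x0 -> c <= y <= d -> hol H (pt x y)) ->
  contin_on a b (fun x => H (pt x c)) -> contin_on a b (fun x => H (pt x d)) ->
  {ae mu, forall y, c <= y <= d ->
    (fun e : R => H (pt (x0 + e) y) - H (pt (x0 - e) y)) @ (0 : R)^'+ --> (0 : R[i])} ->
  Rint H a b c d = 0.
Proof.
move=> /andP[ax xb] cd HM Hh hc hd Hae.
pose r := Num.min (x0 - a) (b - x0).
have r0 : 0 < r by rewrite lt_min !subr_gt0 ax.
have [ra rb] : r <= x0 - a /\ r <= b - x0 by rewrite /r !ge_min !lexx orbT.
pose e n : R := r / n.+1%:R.
have e0 n : 0 < e n by rewrite divr_gt0.
have er n : e n <= r by rewrite ler_pdivrMr// ler_peMr ?ler1n// ltW.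
have eR : e @ \oo --> (0 : R)^'+ by apply: cvg_seq_right => //; exact: cvg_harmonicZ.
have el : e @ \oo --> (0 : R) by exact: cvg_harmonicZ.
have M0 : 0 <= M.
  by apply: le_trans (rnorm_ge0 _) (HM x0 c _ _); rewrite ?lexx// !ltW.
pose D n y := H (pt (x0 + e n) y) - H (pt (x0 - e n) y).
pose J n y := Cint (x0 - e n) (x0 + e n) (fun x => H (pt x y)).
have v x : a <= x <= b -> x != x0 -> contin_on c d (fun y => H (pt x y)).
  by move=> hx nx; apply: contin_v => y hy; apply: hol_tends; exact: Hh.
have pm n : [/\ a <= x0 - e n, x0 - e n < x0, x0 < x0 + e n & x0 + e n <= b].
  by have := e0 n; have := er n; split; lra.
have cD n : contin_on c d (D n).
  have [h1 h2 h3 h4] := pm n.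
  apply: contin_onB; apply: v.
  - by rewrite h4 andbT; lra.
  - by rewrite gt_eqF.
  - by rewrite h1 /=; lra.
  - by rewrite lt_eqF.
(* Cauchy's theorem on the rectangles left and right of the strip of half-width [e n] leaves the
   short horizontal pieces [J] and the difference [D] of the values on the two sides of the
   strip. *)
have E n : Rint H a b c d = J n c - J n d + 'i%C * Cint c d (D n).
  have [h1 h2 h3 h4] := pm n.
  have g1 : Rint H a (x0 - e n) c d = 0.
    apply: Goursat => // x y /andP[x1 x2] hy; apply: Hh => //.
      by rewrite x1; lra.
    by rewrite lt_eqF//; lra.
  have g2 : Rint H (x0 + e n) b c d = 0.
    apply: Goursat => // x y /andP[x1 x2] hy; apply: Hh => //.
      by rewrite x2 andbT; lra.
    by rewrite gt_eqF//; lra.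
  have split3 y : contin_on a b (fun x => H (pt x y)) -> Cint a b (fun x => H (pt x y)) =
      Cint a (x0 - e n) (fun x => H (pt x y)) + J n y +
      Cint (x0 + e n) b (fun x => H (pt x y)).
    move=> hy; rewrite (@Cint_split _ a (x0 - e n) b)//; last by lra.
    rewrite (@Cint_split _ (x0 - e n) (x0 + e n) b)//; [by rewrite addrA|by lra|].
    by apply: contin_on_sub hy; lra.
  rewrite /Rint in g1 g2; rewrite /Rint !split3// CintB//; last 2 first.
  - by apply: v; [rewrite h4 andbT; lra|rewrite gt_eqF].
  - by apply: v; [rewrite h1 /=; lra|rewrite lt_eqF].
  rewrite -[RHS]addr0 -[X in _ = _ + X]addr0 -{1}g1 -g2; ring.
have JM n y : c <= y <= d -> contin_on a b (fun x => H (pt x y)) ->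
    rnorm (J n y) <= 2 * M * e n.
  move=> hy cy; have [h1 h2 h3 h4] := pm n.
  have -> : 2 * M * e n = (x0 + e n - (x0 - e n)) * M by ring.
  apply: le_rnorm_Cint; [by lra|by apply: contin_on_sub cy|].
  by move=> x /andP[x1 x2]; apply: HM => //; apply/andP; split; lra.
have JL y : c <= y <= d -> contin_on a b (fun x => H (pt x y)) ->
    (fun n => J n y) @ \oo --> (0 : R[i]).
  move=> hy cy; apply: (@cvgC_squeeze _ _ _ _ (fun n => 2 * M * e n)).
    by apply: filterE => n; rewrite subr0; exact: JM.
  have : 2 * M * e n @[n --> \oo] --> 2 * M * 0 by apply: cvgMl_tmp.
  by rewrite mulr0.
(* [D n] is bounded by [M + M] and tends to 0 almost everywhere. *)
have DL : (fun n => Cint c d (D n)) @ \oo --> Cint c d (fun=> (0 : R[i])).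
  apply: (@Cint_dominated _ _ _ _ _ (M + M)) => //; first exact: contin_on_cst.
    move=> n y hy; have [h1 h2 h3 h4] := pm n.
    apply: le_trans (rnorm_le_sub _ _) _; apply: lerD; apply: HM => //.
      by rewrite h4 andbT; lra.
    by rewrite h1 /=; lra.
  have FA := @ae_filter_ringOfSetsType _ _ _ mu.
  by apply: filterS Hae => y hy /hy; exact: cvg_comp eR.
have L : (fun n => J n c - J n d + 'i%C * Cint c d (D n)) @ \oo --> (0 : R[i]).
  have -> : (0 : R[i]) = 0 - 0 + 'i%C * Cint c d (fun=> 0).
    by rewrite Cint_cst// mulr0 mulr0; ring.
  apply: cvgCD; first by apply: cvgCB; apply: JL => //; rewrite lexx cd.
  by apply: cvgCM DL; exact: cvg_cst.
have L' : (fun n : nat => Rint H a b c d) @ \oo --> (0 : R[i]).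
  by have -> : (fun n : nat => Rint H a b c d) =
      (fun n => J n c - J n d + 'i%C * Cint c d (D n)) by apply/funext => n; exact: E.
apply/eqP; apply: contrapT => /negP; rewrite -rnorm_gt0 => I0.
have [N _ hN] := proj1 (@cvgCP R _ _ _ _ _) L' _ I0.
by have := hN N (leqnn N); rewrite /= sub0r rnormN ltxx.
Qed.

End Crossing.

(** * The complex exponential and means over circles *)

Section Exponential.
Variable R : realType.
Implicit Types (z w : R[i]) (x y t r : R).

Lemma expi0 : expi 0 = 1 :> R[i].
Proof. by rewrite /expi cos0 sin0. Qed.

Lemma expiD s t : expi (s + t) = expi s * expi t.
Proof.
rewrite /expi cosD sinD; apply/eqP; rewrite eq_complex /=.
by apply/andP; split; apply/eqP; ring.
Qed.

Lemma expiN t : expi (- t) = (expi t)^*.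
Proof. by rewrite /expi cosN sinN. Qed.

Lemma rnorm_expi t : rnorm (expi t) = 1.
Proof. by rewrite /rnorm /= cos2Dsin2 sqrtr1. Qed.

Lemma expi2pi : expi (2 * pi) = 1 :> R[i].
Proof. by rewrite /expi mulr_natl cos2pi sin2pi. Qed.

Definition cexp z : R[i] := (expR (complex.Re z))%:C%C * expi (complex.Im z).

Lemma cexp_pt x y : cexp (pt x y) = (expR x)%:C%C * expi y.
Proof. by []. Qed.

Lemma cexpD z w : cexp (z + w) = cexp z * cexp w.
Proof.
by rewrite /cexp cReD cImD expRD expiD rmorphM /=; ring.
Qed.

Lemma rnorm_cexp z : rnorm (cexp z) = expR (complex.Re z).
Proof. by rewrite rnormM rnormR rnorm_expi mulr1 ger0_norm// expR_ge0. Qed.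

Lemma cexp_neq0 z : cexp z != 0.
Proof. by rewrite -rnorm_eq0 rnorm_cexp gt_eqF// expR_gt0. Qed.

Lemma cexp0 : cexp 0 = 1.
Proof. by rewrite /cexp /= expR0 expi0 mulr1. Qed.

Lemma slope_small (f : R -> R) (l : R) : is_derive (0 : R) 1 f l -> forall e, 0 < e ->
  exists2 d : R, 0 < d & forall x, `|x| < d -> `|f x - f 0 - l * x| <= e * `|x|.
Proof.
move=> [df <-] e e0; move/cvgrPdist_lt : df => /(_ _ e0)[d /= d0 h].
exists d => // x xd; have [->|x0] := eqVneq x 0.
  by rewrite subrr mulr0 subr0 normr0 mulr0.
have := h x; rewrite /= sub0r normrN xd => /(_ isT x0).
rewrite /GRing.scale /= mulr1 addr0 => /ltW k.
have -> : f x - f 0 - 'D_1 f 0 * x = - (('D_1 f 0 - x^-1 * (f x - f 0)) * x) by field.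
by rewrite normrN normrM ler_wpM2r.
Qed.

(** The real derivatives of exp, cos and sin at 0 give complex differentiability at 0, which [cexpD]
    then moves to any point. *)
Lemma cexp_small (e : R) : 0 < e -> exists2 d : R, 0 < d &
  forall h, rnorm h < d -> rnorm (cexp h - 1 - h) <= e * rnorm h.
Proof.
(* The four error terms below are at most 1, 3, 1 and 4 times [e' * n], within the 16 allowed;
   [e' <= 1] and [n < e'] control the products. *)
move=> e0; have [e' [e'0 e'8 e'1]] : exists e' : R, [/\ 0 < e', e' <= e / 16 & e' <= 1].
  by exists (Num.min (e / 16) 1); rewrite lt_min ltr01 divr_gt0// !ge_min !lexx orbT.
have [d1 d10 h1] := slope_small (is_derive_expR 0) e'0.
have [d2 d20 h2] := slope_small (is_derive_cos 0) e'0.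
have [d3 d30 h3] := slope_small (is_derive_sin 0) e'0.
exists (Num.min (Num.min d1 e') (Num.min d2 d3)); first by rewrite !lt_min d10 d20 d30 e'0.
move=> [x y]; rewrite !lt_min => /andP[/andP[hd1 he'] /andP[hd2 hd3]].
set n := rnorm _ in hd1 he' hd2 hd3 *.
have n0 : 0 <= n by exact: rnorm_ge0.
have xn : `|x| <= n by exact: (Re_le_rnorm (x +i* y)%C).
have yn : `|y| <= n by exact: (Im_le_rnorm (x +i* y)%C).
have := h1 x (le_lt_trans xn hd1); have := h2 y (le_lt_trans yn hd2).
have := h3 y (le_lt_trans yn hd3).
rewrite expR0 cos0 sin0 subr0 oppr0 mul0r subr0 !mul1r => k3 k2 k1.
have ex : `|expR x - 1| <= 2 * n.
  have -> : expR x - 1 = (expR x - 1 - x) + x by ring.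
  apply: le_trans (ler_normD _ _) _; apply: le_trans (lerD k1 (lexx _)) _.
  have : e' * `|x| <= 1 * n by apply: ler_pM => //; exact: ltW.
  lra.
have cy1 : `|cos y| <= 1 by rewrite ler_norml cos_geN1 cos_le1.
have sy1 : `|sin y| <= 1 by rewrite ler_norml sin_geN1 sin_le1.
have -> : cexp (x +i* y)%C - 1 - (x +i* y)%C =
    (((expR x - 1 - x) + expR x * (cos y - 1)) +i*
     ((sin y - y) + (expR x - 1) * sin y))%C.
  rewrite /cexp /expi /=; apply/eqP; rewrite eq_complex /=; apply/andP; split; apply/eqP; ring.
apply: le_trans (rnorm_le_ReIm _) _ => /=.
have a1 := ler_normD (expR x - 1 - x) (expR x * (cos y - 1)).
have a2 := ler_normD (sin y - y) ((expR x - 1) * sin y).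
have b1 : `|expR x * (cos y - 1)| <= 3 * (e' * n).
  rewrite normrM; apply: ler_pM => //.
    have -> : expR x = (expR x - 1) + 1 by ring.
    by apply: le_trans (ler_normD _ _) _; rewrite normr1; lra.
  by apply: le_trans k2 _; rewrite ler_pM2l.
have b2 : `|(expR x - 1) * sin y| <= 2 * n * (2 * e').
  rewrite normrM; apply: ler_pM => //.
  rewrite -[sin y](subrK y); apply: le_trans (ler_normD _ _) _.
  have : e' * `|y| <= 1 * n by apply: ler_pM => //; exact: ltW.
  lra.
have c1 : e' * `|x| <= e' * n by rewrite ler_pM2l.
have c3 : e' * `|y| <= e' * n by rewrite ler_pM2l.
have c8 : e' * n <= e / 16 * n by rewrite ler_wpM2r.
have en : 0 <= e * n by rewrite mulr_ge0// ltW.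
lra.
Qed.
Lemma hol_cexp z : hol cexp z.
Proof.
pose p w := if w == z then cexp z else (cexp w - cexp z) / (w - z).
apply: (@Hol _ _ _ p); last first.
  apply: filterE => w; rewrite /p; case: eqVneq => [->|wz].
    by rewrite subrr mulr0 addr0.
  by rewrite divfK ?subr_eq0// addrC subrK.
apply/tendsP => e e0; have k0 : 0 < e / (2 * rnorm (cexp z)).
  by rewrite divr_gt0// mulr_gt0// rnorm_gt0 cexp_neq0.
have [d d0 h] := cexp_small k0.
exists d => // w wz; rewrite /p eqxx; case: eqVneq => [_|nwz].
  by rewrite subrr rnorm0.
rewrite rnormB in wz.
have wz0 : w - z != 0 by rewrite subr_eq0.
have -> : cexp z - (cexp w - cexp z) / (w - z) =
    - (cexp z * (cexp (w - z) - 1 - (w - z)) / (w - z)).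
  have -> : cexp w = cexp z * cexp (w - z) by rewrite -cexpD addrC subrK.
  by field.
rewrite rnormN rnormM (rnormM (cexp z)) rnormV ltr_pdivrMr ?rnorm_gt0//.
apply: (@le_lt_trans _ _ (rnorm (cexp z) * (e / (2 * rnorm (cexp z)) * rnorm (w - z)))).
  by apply: ler_pM; rewrite ?rnorm_ge0 ?lexx//; exact: h.
have -> : rnorm (cexp z) * (e / (2 * rnorm (cexp z)) * rnorm (w - z)) = e * rnorm (w - z) / 2.
  have nz : rnorm (cexp z) != 0 by rewrite rnorm_eq0 cexp_neq0.
  by field.
have := mulr_gt0 e0 (_ : 0 < rnorm (w - z)); rewrite rnorm_gt0 => /(_ wz0).
lra.
Qed.

Lemma contin_on_expi a b : contin_on a b (fun t => expi t : R[i]).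
Proof.
have := @contin_v R cexp a b 0 (fun y _ => hol_tends (hol_cexp _)).
have -> : (fun y => cexp (pt 0 y)) = (fun t => expi t) => //.
by apply/funext => y; rewrite cexp_pt expR0 mul1r.
Qed.

Definition cpt r t : R[i] := r%:C%C * expi t.

Lemma rnorm_cpt r t : 0 <= r -> rnorm (cpt r t) = r.
Proof. by move=> r0; rewrite rnormM rnormR rnorm_expi mulr1 ger0_norm. Qed.

Lemma cpt_neq0 r t : 0 < r -> cpt r t != 0.
Proof. by move=> r0; rewrite -rnorm_eq0 rnorm_cpt ?ltW// gt_eqF. Qed.

Lemma contin_on_cpt r a b : contin_on a b (fun t => cpt r t).
Proof. by apply: contin_onM; [exact: contin_on_cst|exact: contin_on_expi]. Qed.

Lemma contin_on_circ (G : R[i] -> R[i]) r a b : 0 <= r ->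
  (forall z, rnorm z = r -> tends G z (G z)) -> contin_on a b (fun t => G (cpt r t)).
Proof.
move=> r0 hG; split => t tab.
have [c] := @contin_on_cpt r a b; have [g] := hG _ (rnorm_cpt t r0).
exact: cvg_comp (c t tab) g.
Qed.

(** The integral of [F(z) dz / (i z)] over the circle; this is why the Cauchy kernel appears below
    as [z / (z - w)]. *)
Definition circ r (F : R[i] -> R[i]) : R[i] := Cint 0 (2 * pi) (fun t => F (cpt r t)).

Lemma pi2_ge0 : 0 <= 2 * pi :> R.
Proof. by rewrite mulr_ge0// pi_ge0. Qed.

(** The exponential wraps a rectangle of height [2 pi] around an annulus, and by periodicity its
    horizontal edges cancel. *)
Lemma circ_pt (G : R[i] -> R[i]) (x1 x2 : R) :
  Rint (G \o cexp) x1 x2 0 (2 * pi) = 'i%C * (circ (expR x2) G - circ (expR x1) G).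
Proof.
rewrite /Rint; set A := Cint x1 x2 _; set B := Cint x1 x2 _.
have -> : A = B by apply: eq_Cint => t _; rewrite /= !cexp_pt expi0 expi2pi.
by rewrite subrr add0r.
Qed.

Lemma cross_tends (H : R[i] -> R[i]) x0 y : tends H (pt x0 y) (H (pt x0 y)) ->
  (fun e : R => H (pt (x0 + e) y) - H (pt (x0 - e) y)) @ (0 : R)^'+ --> (0 : R[i]).
Proof.
move=> /tendsP h; apply/cvgCP => e e0.
have e2 : 0 < e / 2 by rewrite divr_gt0.
have [d d0 {}h] := h _ e2; exists d => //= s sd _; rewrite /ball_ /= sub0r normrN in sd.
rewrite sub0r rnormN; apply: le_lt_trans (rnorm_tri _ (H (pt x0 y)) _) _.
rewrite [ltRHS]splitr rnormB; apply: ltrD; apply: h; rewrite ptB subrr;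
  apply: le_lt_trans (rnorm_pt _ _) _; rewrite normr0 addr0.
  by rewrite opprD addrA subrr add0r normrN.
by rewrite opprB addrCA subrr addr0.
Qed.

(** In logarithmic coordinates [Rint_crossing] equates the mean over the circle of radius [r] with
    those over small circles, which tend to a multiple of [G 0]. On the circle of radius [rho] only
    continuity is asked, so it may pass through a point where differentiability is unknown. *)
Lemma circ_vanish (G : R[i] -> R[i]) r rho (M : R) : 0 < rho < r ->
  (forall z, rnorm z <= r -> rnorm (G z) <= M) ->
  (forall z, rnorm z <= r -> tends G z (G z)) ->
  (forall z, rnorm z <= r -> z != 0 -> rnorm z != rho -> hol G z) ->
  G 0 = 0 -> circ r G = 0.
Proof.
move=> /andP[rho0 rhor] GM Gt Gh G0; have r0 := lt_trans rho0 rhor.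
have E s : 0 < s < rho -> circ r G = circ s G.
  move=> /andP[s0 sr]; apply/eqP; rewrite -subr_eq0.
  have lnr : ln s < ln rho < ln r by rewrite !ltr_ln ?posrE// sr rhor.
  have nx x y : x <= ln r -> rnorm (cexp (pt x y)) <= r.
    by move=> xr; rewrite rnorm_cexp /= -[leRHS]lnK ?posrE// ler_expR.
  have ct x y : x <= ln r -> tends (G \o cexp) (pt x y) ((G \o cexp) (pt x y)).
    by move=> xr; apply: tends_comp (hol_tends (hol_cexp _)) _; apply: Gt; exact: nx.
  have := @Rint_crossing R (G \o cexp) (ln s) (ln r) 0 (2 * pi) (ln rho) M lnr pi2_ge0.
  rewrite circ_pt !lnK ?posrE// => h; have /eqP : 'i%C * (circ r G - circ s G) = 0.
    apply: h.
    - by move=> x y /andP[_ xr] _; apply: GM; exact: nx.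
    - move=> x y /andP[_ xr] xn _; apply: hol_comp; first exact: hol_cexp.
      apply: Gh; [exact: nx|exact: cexp_neq0|].
      by rewrite rnorm_cexp /= -[X in _ != X]lnK ?posrE// (inj_eq (@expR_inj _)).
    - by apply: contin_h => x /andP[_ xr]; exact: ct.
    - by apply: contin_h => x /andP[_ xr]; exact: ct.
    - apply: aeW => y _; apply: cross_tends; apply: ct.
      by apply: ltW; case/andP: lnr.
  by rewrite mulf_eq0 -rnorm_eq0 rnorm_i oner_eq0.
have C s : 0 < s < rho -> contin_on 0 (2 * pi) (fun t => G (cpt s t)).
  move=> /andP[s0 sr]; apply: contin_on_circ => [|z zs]; first exact: ltW.
  by apply: Gt; rewrite zs ltW// (lt_trans sr).
apply/eqP; rewrite -rnorm_eq0; apply/eqP/le_anti; rewrite rnorm_ge0 andbT.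
apply/ler_addgt0Pl => e e0; rewrite addr0.
have p1 : 0 < 2 * pi + 1 :> R by rewrite ltr_wpDl// pi2_ge0.
have e1 : 0 < e / (2 * pi + 1) by rewrite divr_gt0.
have /tendsP/(_ _ e1)[d d0 hd] : tends G 0 (G 0) by apply: Gt; rewrite rnorm0 ltW.
pose s := Num.min d rho / 2.
have md : 0 < Num.min d rho by rewrite lt_min d0.
have [mi1 mi2] : Num.min d rho <= d /\ Num.min d rho <= rho by rewrite !ge_min !lexx orbT.
have s0 : 0 < s by rewrite divr_gt0.
have sd : s < d by rewrite /s; lra.
have sr : 0 < s < rho by rewrite s0 /s; lra.
rewrite (E s)//; apply: le_trans (@le_rnorm_Cint _ _ _ _ (e / (2 * pi + 1)) pi2_ge0 (C s sr) _) _.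
  move=> t _; have := hd (cpt s t); rewrite G0 !sub0r !rnormN (rnorm_cpt _ (ltW s0)) => /(_ sd)/ltW.
  exact.
by rewrite subr0 mulrA ler_pdivrMr// mulrC ler_wpM2l ?(ltW e0)// lerDl ler01.
Qed.

End Exponential.

(** * Means of powers and the Cauchy kernel *)

Section Taylor.
Variable R : realType.
Implicit Types (z w : R[i]) (r t : R).

Lemma Cint_conj a b (F : R -> R[i]) : contin_on a b F ->
  Cint a b (fun t => (F t)^*) = (Cint a b F)^*.
Proof.
move=> cF; rewrite /Cint; apply/eqP; rewrite eq_complex /=; apply/andP; split; apply/eqP.
  by apply: eq_Rintegral => t _; case: (F t).
rewrite -mulN1r -RintegralZl//; last exact: contin_on_intIm.
by apply: eq_Rintegral => t _; rewrite mulN1r; case: (F t).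
Qed.

Lemma Cint_sum a b (F : nat -> R -> R[i]) (N : nat) : a <= b ->
  (forall n, contin_on a b (F n)) ->
  contin_on a b (fun t => \sum_(n < N) F n t) /\
  Cint a b (fun t => \sum_(n < N) F n t) = \sum_(n < N) Cint a b (F n).
Proof.
move=> ab cF; elim: N => [|N [IH1 IH2]].
  split; first by under eq_fun do rewrite big_ord0; exact: contin_on_cst.
  by rewrite big_ord0; under [X in Cint _ _ X]eq_fun do rewrite big_ord0;
    rewrite Cint_cst// mulr0.
have e : (fun t => \sum_(n < N.+1) F n t) = (fun t => \sum_(n < N) F n t + F N t).
  by apply/funext => t; rewrite big_ord_recr.
by rewrite e big_ord_recr /= -IH2; split; [exact: contin_onD|rewrite CintD].
Qed.

Lemma circX r n : 0 < r -> circ r (fun z => z ^+ n) = (2 * pi)%:C%C * (n == 0)%:R.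
Proof.
move=> r0; case: n => [|n] /=.
  rewrite /circ; under eq_fun do rewrite expr0.
  by rewrite Cint_cst ?pi2_ge0// subr0.
have hX z : hol (fun z => z ^+ n.+1) z by apply: holX; exact: hol_id.
rewrite mulr0; apply: (@circ_vanish _ _ _ (r / 2) (r ^+ n.+1)).
- by rewrite divr_gt0//=; lra.
- by move=> z zr; rewrite rnormX lerXn2r// ?nnegrE ?rnorm_ge0// ltW.
- by move=> z _; apply: hol_tends (hX z).
- by move=> z _ _ _; exact: hX.
- by rewrite expr0n.
Qed.

Lemma cpt_conj r t : 0 < r -> (cpt r t)^* = (r ^+ 2)%:C%C * (cpt r t)^-1.
Proof.
move=> r0; have e := rnorm_sqr (cpt r t); rewrite rnorm_cpt 1?ltW// in e.
by rewrite e mulrAC mulfV ?mul1r// cpt_neq0.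
Qed.

Lemma tends_inv n z : z != 0 -> tends (fun w => w ^- n) z (z ^- n).
Proof.
move=> z0; apply: (@hol_tends _ (fun w => w ^- n)); apply: holV; last by rewrite expf_neq0.
by apply: holX; exact: hol_id.
Qed.

Lemma tends_contin_circ (F : R[i] -> R[i]) r : 0 < r ->
  (forall z, rnorm z = r -> tends F z (F z)) ->
  contin_on 0 (2 * pi) (fun t => F (cpt r t)).
Proof. by move=> r0 h; apply: contin_on_circ => //; exact: ltW. Qed.

Lemma circ_inv r n : 0 < r -> circ r (fun z => z ^- n) = (2 * pi)%:C%C * (n == 0)%:R.
Proof.
move=> r0.
have c : contin_on 0 (2 * pi) (fun t => cpt r t ^+ n).
  apply: (@tends_contin_circ (fun z => z ^+ n)) => // z _.
  by apply: (@hol_tends _ (fun z => z ^+ n)); apply: holX; exact: hol_id.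
have -> : circ r (fun z => z ^- n) = ((r ^+ 2) ^- n)%:C%C * (circ r (fun z => z ^+ n))^*.
  rewrite /circ -Cint_conj// -CintZ; last exact: contin_on_conj.
  apply: eq_Cint => t _; rewrite rmorphXn /= cpt_conj//. rewrite [(_ / _) ^+ n]exprMn exprVn mulrA.
  rewrite fmorphV !rmorphXn /= mulVf ?mul1r//.
  by rewrite -!rmorphXn /= -rnorm_eq0 rnormR normr_eq0 !expf_neq0// gt_eqF.
rewrite circX//; case: n {c} => [|n] /=.
  by rewrite expr0 invr1 !mul1r mulr1 -[LHS]/((2 * pi +i* - 0)%C) oppr0.
by rewrite !mulr0 rmorph0 mulr0.
Qed.

Lemma geometric_rest z w N : z != 0 -> z != w ->
  z / (z - w) = \sum_(n < N) w ^+ n * z ^- n + (w / z) ^+ N * (z / (z - w)).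
Proof.
move=> z0; rewrite -subr_eq0 => zw; elim: N => [|N IH].
  by rewrite big_ord0 add0r expr0 mul1r.
rewrite {1}IH big_ord_recr /= -addrA; congr (_ + _).
rewrite exprS exprMn exprVn.
by field; rewrite zw expf_neq0.
Qed.

Lemma rnorm_sub_gt0 r z w : rnorm w < r -> rnorm z = r -> r - rnorm w <= rnorm (z - w).
Proof. by move=> wr <-; exact: rnorm_sub_le. Qed.

Lemma circ_geometric (F : R[i] -> R[i]) r w (M : R) N : 0 < r -> rnorm w < r ->
  (forall z, rnorm z = r -> tends F z (F z)) ->
  (forall z, rnorm z = r -> rnorm (F z) <= M) ->
  rnorm (circ r (fun z => F z * (z / (z - w)))
         - \sum_(n < N) w ^+ n * circ r (fun z => F z * z ^- n))
  <= 2 * pi * (M * ((rnorm w / r) ^+ N * (r / (r - rnorm w)))).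
Proof.
move=> r0 wr cF FM.
have z0 z : rnorm z = r -> z != 0 by move=> zr; rewrite -rnorm_eq0 zr gt_eqF.
have zw z : rnorm z = r -> z != w.
  by move=> zr; apply: contraTneq wr => <-; rewrite zr ltxx.
have tq z : rnorm z = r -> tends (fun z => z / (z - w)) z (z / (z - w)).
  move=> zr; apply: (@hol_tends _ (fun z => z / (z - w))).
  apply: holM; first exact: hol_id.
  apply: holV; last by rewrite subr_eq0 zw.
  by apply: holB; [exact: hol_id|exact: hol_cst].
have c1 : contin_on 0 (2 * pi) (fun t => F (cpt r t) * (cpt r t / (cpt r t - w))).
  apply: (@tends_contin_circ (fun z => F z * (z / (z - w)))) => // z zr.
  by apply: tendsM; [exact: cF|exact: tq].
have c2 n : contin_on 0 (2 * pi) (fun t => F (cpt r t) * (cpt r t) ^- n).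
  apply: (@tends_contin_circ (fun z => F z * z ^- n)) => // z zr.
  by apply: tendsM; [exact: cF|apply: tends_inv; exact: z0].
have c3 n : contin_on 0 (2 * pi) (fun t => w ^+ n * (F (cpt r t) * (cpt r t) ^- n)).
  by apply: contin_onM => //; exact: contin_on_cst.
have [c4 e4] := Cint_sum N (pi2_ge0 R) c3.
have -> : \sum_(n < N) w ^+ n * circ r (fun z => F z * z ^- n) =
    \sum_(n < N) Cint 0 (2 * pi) (fun t => w ^+ n * (F (cpt r t) * (cpt r t) ^- n)).
  by apply: eq_bigr => n _; rewrite CintZ.
rewrite -e4 /circ -CintB//.
set k := M * _.
have -> : 2 * pi * k = (2 * pi - 0) * k by rewrite subr0.
apply: le_rnorm_Cint; [exact: pi2_ge0|exact: contin_onB|].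
move=> t _; rewrite {}/k; have zr := rnorm_cpt t (ltW r0); set z := cpt r t in zr *.
have -> : F z * (z / (z - w)) - \sum_(n < N) w ^+ n * (F z * z ^- n) =
    F z * ((w / z) ^+ N * (z / (z - w))).
  rewrite {1}(@geometric_rest z w N) ?z0 ?zw// mulrDr mulr_sumr addrAC.
  rewrite (_ : \sum_(n < N) w ^+ n * _ = \sum_(n < N) F z * (w ^+ n * z ^- n)).
    by rewrite subrr add0r.
  by apply: eq_bigr => n _; rewrite mulrCA.
have d0 : 0 < r - rnorm w by rewrite subr_gt0.
have q : rnorm (z / (z - w)) <= r / (r - rnorm w).
  rewrite rnormM rnormV zr ler_pM2l// lef_pV2 ?posrE ?rnorm_sub_gt0//.
  by rewrite rnorm_gt0 subr_eq0 zw.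
rewrite rnormM ler_pM ?rnorm_ge0 ?FM//.
rewrite rnormM rnormX rnormM rnormV zr ler_wpM2l// exprn_ge0//.
by rewrite divr_ge0 ?rnorm_ge0// ltW.
Qed.

Lemma le_geometric0 (x C q : R) : 0 <= q -> q < 1 -> (forall N, x <= C * q ^+ N) -> x <= 0.
Proof.
move=> q0 q1 h.
have c : C * q ^+ N @[N --> \oo] --> C * 0.
  by apply: cvgMl_tmp; apply: cvg_expr; rewrite ger0_norm.
rewrite mulr0 in c; rewrite -(cvg_lim (@Rhausdorff R) c).
by apply: limr_ge; [apply/cvg_ex; exists 0|exact: filterE].
Qed.

(** Only the term of index 0 of the geometric expansion has a nonzero mean, so the remainder
    estimates, which decay with [N], all bound the same difference. *)
Lemma circ_cauchy_kernel r w : 0 < r -> rnorm w < r ->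
  circ r (fun z => z / (z - w)) = (2 * pi)%:C%C.
Proof.
move=> r0 wr; apply/eqP; rewrite -subr_eq0 -rnorm_eq0; apply/eqP/le_anti.
rewrite rnorm_ge0 andbT.
apply: (@le_geometric0 _ (2 * pi * (r / (r - rnorm w)) * (rnorm w / r)) (rnorm w / r)).
- by rewrite divr_ge0 ?rnorm_ge0// ltW.
- by rewrite ltr_pdivrMr// mul1r.
move=> N; have := @circ_geometric (fun=> 1) r w 1 N.+1 r0 wr.
rewrite big_ord_recl big1 => [|i _]; last first.
  have -> : (fun z : R[i] => 1 * z ^- lift ord0 i) = (fun z => z ^- (lift ord0 i)).
    by apply/funext => z; rewrite mul1r.
  by rewrite circ_inv// mulr0 mulr0.
have -> : (fun z : R[i] => 1 * z ^- @ord0 N) = (fun z => z ^- 0).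
  by apply/funext => z; rewrite mul1r.
have -> : (fun z : R[i] => 1 * (z / (z - w))) = (fun z => z / (z - w)).
  by apply/funext => z; rewrite mul1r.
rewrite circ_inv// expr0 mul1r mulr1 addr0 => h; apply: le_trans (h _ _) _.
- by move=> z _; exact: tends_cst.
- by move=> z _; rewrite rnorm1.
rewrite exprS le_eqVlt; apply/orP; left; apply/eqP; ring.
Qed.

End Taylor.

(** * Cauchy's formula, Taylor coefficients and Parseval's identity *)

Section BoundedHolomorphic.
Variables (R : realType) (u : R[i] -> R[i]) (M : R).
Hypothesis hu : forall z, rnorm z < 1 -> hol u z.
Hypothesis uM : forall z, rnorm z < 1 -> rnorm (u z) <= M.
Implicit Types (z w : R[i]) (r t : R).

(** Cauchy's formula for the Taylor coefficient; by [circ_taylor] any radius below 1 gives the same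
    value. *)
Definition taylor n : R[i] := ((2 * pi)^-1)%:C%C * circ 2^-1 (fun z => u z * z ^- n).

Lemma pi2_gt0 : 0 < 2 * pi :> R. Proof. by rewrite mulr_gt0// pi_gt0. Qed.

Lemma circ_hol_eq (G : R[i] -> R[i]) r s : 0 < s <= r ->
  (forall z, s <= rnorm z <= r -> hol G z) -> circ r G = circ s G.
Proof.
move=> /andP[s0 sr] hG; have r0 := lt_le_trans s0 sr.
have lnr : ln s <= ln r by rewrite ler_ln.
have h : hol_rect (G \o @cexp R) (ln s) (ln r) 0 (2 * pi).
  move=> x y /andP[x1 x2] _; apply: hol_comp; first exact: hol_cexp.
  apply: hG; rewrite rnorm_cexp /=.
  by rewrite -[s in s <= _]lnK ?posrE// ler_expR x1 -[leRHS]lnK ?posrE// ler_expR.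
have := Goursat lnr (pi2_ge0 R) h; rewrite circ_pt !lnK ?posrE//.
move/eqP; rewrite mulf_eq0 -rnorm_eq0 rnorm_i oner_eq0 /= subr_eq0.
by move/eqP.
Qed.

Lemma hol_quot z n : z != 0 -> rnorm z < 1 -> hol (fun z => u z * z ^- n) z.
Proof.
move=> z0 z1; apply: holM; first exact: hu.
by apply: holV; [apply: holX; exact: hol_id|rewrite expf_neq0].
Qed.

Lemma circ_taylor r n : 0 < r < 1 ->
  circ r (fun z => u z * z ^- n) = (2 * pi)%:C%C * taylor n.
Proof.
move=> /andP[r0 r1]; rewrite /taylor mulrA -rmorphM /= mulfV ?gt_eqF ?pi2_gt0// mul1r.
have hz z : 0 < rnorm z -> rnorm z < 1 -> hol (fun z => u z * z ^- n) z.
  by rewrite rnorm_gt0; exact: hol_quot.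
have [r2|r2] := leP 2^-1 r.
  apply: circ_hol_eq; first by rewrite r2 andbT.
  by move=> z /andP[h1 h2]; apply: hz; lra.
apply/esym; apply: circ_hol_eq; first by rewrite r0 ltW.
by move=> z /andP[h1 h2]; apply: hz; lra.
Qed.

(** The divided difference [h] of [u] at [w] is continuous at [w] and holomorphic elsewhere, so
    [circ_vanish] applies to [z * h z]; expanding its mean gives the formula. *)
Lemma circ_cauchy r w : 0 < r < 1 -> rnorm w < r ->
  circ r (fun z => u z * (z / (z - w))) = (2 * pi)%:C%C * u w.
Proof.
move=> /andP[r0 r1] wr; have w1 := lt_trans wr r1.
have [p pw ep] := hu w1.
pose h z := if z == w then p w else (u z - u w) / (z - w).
have hw : tends h w (h w).
  have -> : h w = p w by rewrite /h eqxx.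
  apply: tends_near pw; have [d d0 hd] := proj1 (@near_atP R w _) ep.
  apply/near_atP; exists d => // z /hd e; rewrite /h; case: eqVneq => [->//|zw].
  by rewrite e addrC addKr mulfK// subr_eq0.
have hz z : rnorm z < 1 -> z != w -> hol h z.
  move=> z1 zw; apply: (@hol_near _ _ (fun z => (u z - u w) / (z - w))).
    have d0 : 0 < rnorm (z - w) by rewrite rnorm_gt0 subr_eq0.
    apply/near_atP; exists (rnorm (z - w)) => // s; rewrite /h.
    by case: eqVneq => [->|//]; rewrite ltxx.
  apply: holM; first by apply: holB; [exact: hu|exact: hol_cst].
  by apply: holV; [apply: holB; [exact: hol_id|exact: hol_cst]|rewrite subr_eq0].
have ht z : rnorm z < 1 -> tends h z (h z).
  by move=> z1; have [->//|zw] := eqVneq z w; apply: hol_tends; exact: hz.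
(* Near [w] the bound comes from continuity; at distance at least [d] from [w] it is [2 * M / d]. *)
have [K hK] : exists K, forall z, rnorm z <= r -> rnorm (h z) <= K.
  have /tendsP/(_ _ ltr01)[d d0 hd] := hw.
  exists (rnorm (h w) + 1 + 2 * M / d) => z zr.
  have z1 := le_lt_trans zr r1.
  have Md : 0 <= 2 * M / d.
    have M0 : 0 <= M := le_trans (rnorm_ge0 _) (uM w1).
    by apply: divr_ge0; [apply: mulr_ge0|exact: ltW].
  have [dz|dz] := ltP (rnorm (w - z)) d.
    have := rnorm_sub_le (h z) (h w); have := hd _ dz; rewrite rnormB; lra.
  have zw : z != w by apply: contraTneq dz => ->; rewrite subrr rnorm0 -ltNge.
  have : rnorm (h z) <= 2 * M / d.
    rewrite /h (negbTE zw) rnormM rnormV ler_pM ?invr_ge0 ?rnorm_ge0//.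
      apply: le_trans (rnorm_le_sub _ _) _; have := uM z1; have := uM w1; lra.
    rewrite rnormB in dz; rewrite lef_pV2 ?posrE//; exact: lt_le_trans d0 dz.
  have := rnorm_ge0 (h w); lra.
have K0 : 0 <= K by apply: le_trans (rnorm_ge0 _) (hK 0 _); rewrite rnorm0 ltW.
(* The exceptional circle must pass through [w] and have positive radius. For [w = 0] the origin is
   already exempt in [circ_vanish], and any radius below [r] will do. *)
pose rho := if w == 0 then r / 2 else rnorm w.
have rho1 : 0 < rho < r.
  rewrite /rho; case: eqVneq => [_|w0]; last by rewrite rnorm_gt0 w0.
  by apply/andP; split; lra.
have G0 : circ r (fun z => z * h z) = 0.
  apply: (circ_vanish rho1 (M := r * K)).
  - by move=> z zr; rewrite rnormM ler_pM ?rnorm_ge0// hK.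
  - by move=> z zr; apply: tendsM (tends_id z) _; apply: ht; exact: le_lt_trans zr r1.
  - move=> z zr z0 zrho; apply: holM; first exact: hol_id.
    apply: hz; first exact: le_lt_trans zr r1.
    apply: contraNneq zrho => zw; rewrite /rho -zw; move: z0.
    by case: eqVneq.
  - by rewrite mul0r.
have zw z : rnorm z = r -> z != w.
  by move=> zr; apply: contraTneq wr => <-; rewrite zr ltxx.
have tq z : rnorm z = r -> tends (fun z => z / (z - w)) z (z / (z - w)).
  move=> zr; apply: (@hol_tends _ (fun z => z / (z - w))).
  apply: holM; first exact: hol_id.
  apply: holV; last by rewrite subr_eq0 zw.
  by apply: holB; [exact: hol_id|exact: hol_cst].
have c1 : contin_on 0 (2 * pi) (fun t => u (cpt r t) * (cpt r t / (cpt r t - w))).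
  apply: (@tends_contin_circ _ (fun z => u z * (z / (z - w)))) => // z zr.
  by apply: tendsM; [apply: hol_tends; apply: hu; rewrite zr|exact: tq].
have c2 : contin_on 0 (2 * pi) (fun t => cpt r t / (cpt r t - w)).
  exact: (@tends_contin_circ _ (fun z => z / (z - w))).
have c3 : contin_on 0 (2 * pi) (fun t => u w * (cpt r t / (cpt r t - w))).
  by apply: contin_onM c2; exact: contin_on_cst.
apply/eqP; rewrite -subr_eq0 -[X in _ == X]G0 mulrC -(circ_cauchy_kernel r0 wr).
rewrite /circ -CintZ// -CintB//; apply/eqP; apply: eq_Cint => t _.
have zr := rnorm_cpt t (ltW r0); rewrite /h (negbTE (zw _ zr)).
by ring.
Qed.

Lemma taylor_approx r w N : 0 < r < 1 -> rnorm w < r ->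
  rnorm (u w - \sum_(n < N) w ^+ n * taylor n) <=
  M * ((rnorm w / r) ^+ N * (r / (r - rnorm w))).
Proof.
move=> r01 wr; have /andP[r0 r1] := r01.
have z1 z : rnorm z = r -> rnorm z < 1 by move=> ->.
have := @circ_geometric R u r w M N r0 wr (fun z zr => hol_tends (hu (z1 z zr)))
  (fun z zr => uM (z1 z zr)).
rewrite circ_cauchy//; under eq_bigr do rewrite circ_taylor// mulrCA.
rewrite -mulr_sumr -mulrBr rnormM rnormR ger0_norm ?pi2_ge0// ler_pM2l//.
exact: pi2_gt0.
Qed.

(* On the circle of radius [r] the conjugate of [z ^+ n] is [r ^+ (2 * n) * z ^- n]. *)
Lemma parseval r k : 0 < r < 1 ->
  (fun N => \sum_(n < N) (r ^+ (2 * n))%:C%C * ((taylor n)^* * taylor (n + k)))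
    @ \oo --> ((2 * pi)^-1)%:C%C * circ r (fun z => u z * (u z)^* * z ^- k).
Proof.
move=> r01; have /andP[r0 r1] := r01.
have [s rs s01] : exists2 s : R, r < s & 0 < s < 1.
  by exists ((1 + r) / 2); [lra|apply/andP; split; lra].
have s0 : 0 < s by case/andP: s01.
have z1 z : rnorm z = r -> rnorm z < 1 by move=> ->.
have z0 z : rnorm z = r -> z != 0 by move=> zr; rewrite -rnorm_eq0 zr gt_eqF.
have M0 : 0 <= M by apply: le_trans (rnorm_ge0 _) (uM (z := 0) _); rewrite rnorm0.
have cu : contin_on 0 (2 * pi) (fun t => u (cpt r t)).
  by apply: tends_contin_circ => // z /z1 /hu /hol_tends.
have cn n : contin_on 0 (2 * pi) (fun t => (cpt r t) ^- n).
  by apply: (@tends_contin_circ _ (fun z => z ^- n)) => // z /z0; exact: tends_inv.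
(* Only the conjugated factor is replaced by a Taylor polynomial: each term then integrates [u]
   against a power and gives a coefficient exactly. *)
pose T N z := \sum_(n < N) z ^+ n * taylor n.
have cT N : contin_on 0 (2 * pi) (fun t => T N (cpt r t)).
  apply: tends_contin_circ => // z _; apply: hol_tends; apply: hol_sum => n.
  by apply: holM; [apply: holX; exact: hol_id|exact: hol_cst].
have c1 : contin_on 0 (2 * pi) (fun t => u (cpt r t) * (u (cpt r t))^* * cpt r t ^- k).
  by apply: contin_onM => //; apply: contin_onM => //; exact: contin_on_conj.
have c2 N : contin_on 0 (2 * pi)
    (fun t => u (cpt r t) * (T N (cpt r t))^* * cpt r t ^- k).
  by apply: contin_onM => //; apply: contin_onM => //; exact: contin_on_conj.
pose C := M * (M * (s / (s - r)) * (r ^+ k)^-1).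
have E N : \sum_(n < N) (r ^+ (2 * n))%:C%C * ((taylor n)^* * taylor (n + k)) =
    ((2 * pi)^-1)%:C%C * circ r (fun z => u z * (T N z)^* * z ^- k).
  pose F n t := (r ^+ (2 * n))%:C%C * (taylor n)^* * (u (cpt r t) * cpt r t ^- (n + k)).
  have cF n : contin_on 0 (2 * pi) (F n).
    by apply: contin_onM; [exact: contin_on_cst|exact: contin_onM].
  have [_ eF] := Cint_sum N (pi2_ge0 R) cF.
  have -> : circ r (fun z => u z * (T N z)^* * z ^- k) =
      Cint 0 (2 * pi) (fun t => \sum_(n < N) F n t).
    apply: eq_Cint => t _; rewrite /T rmorph_sum mulr_sumr mulr_suml /=.
    apply: eq_bigr => n _; rewrite /F rmorphM rmorphXn /= cpt_conj//.
    rewrite [(_ / _) ^+ n]exprMn exprVn -rmorphXn /= -exprM exprD invfM.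
    by ring.
  rewrite eF mulr_sumr; apply: eq_bigr => n _; rewrite /F CintZ; last exact: contin_onM.
  rewrite -/(circ r (fun z => u z * z ^- (n + k))) circ_taylor//.
  have -> : ((2 * pi)^-1)%:C%C = ((2 * pi)%:C%C)^-1 :> R[i] by rewrite fmorphV.
  have p0 : (2 * pi)%:C%C != 0 :> R[i].
    by rewrite -rnorm_eq0 rnormR normr_eq0 gt_eqF// pi2_gt0.
  move: p0; move: (2 * pi)%:C%C (_ ^+ (2 * n))%:C%C => p q p0.
  by field.
under eq_fun do rewrite E.
apply: cvgCM; first exact: cvg_cst.
apply: (@cvgC_squeeze _ _ _ _ (fun N => 2 * pi * C * (r / s) ^+ N)).
  apply: filterE => N; rewrite rnormB /circ -CintB//.
  have -> : 2 * pi * C * (r / s) ^+ N = (2 * pi - 0) * (C * (r / s) ^+ N).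
    by rewrite subr0 mulrA.
  apply: le_rnorm_Cint; [exact: pi2_ge0|exact: contin_onB|].
  move=> t _; have zr := rnorm_cpt t (ltW r0); set z := cpt r t in zr *.
  rewrite -mulrBl -mulrBr -rmorphB /= !rnormM rnorm_conj rnormV rnormX zr /C.
  rewrite -!mulrA; apply: ler_pM; first exact: rnorm_ge0.
  - by rewrite mulr_ge0 ?rnorm_ge0// invr_ge0 exprn_ge0// ltW.
  - by apply: uM; exact: z1.
  apply: (@le_trans _ _ (M * ((r / s) ^+ N * (s / (s - r))) * (r ^+ k)^-1)); last first.
    by rewrite le_eqVlt; apply/orP; left; apply/eqP; ring.
  rewrite ler_pM2r ?invr_gt0 ?exprn_gt0//.
  by have := @taylor_approx s z N s01; rewrite zr; apply.
have c : 2 * pi * C * (r / s) ^+ N @[N --> \oo] --> 2 * pi * C * 0.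
  apply: cvgMl_tmp; apply: cvg_expr; rewrite ger0_norm ?divr_ge0 ?ltW//.
  by rewrite ltr_pdivrMr// mul1r.
by rewrite mulr0 in c.
Qed.

End BoundedHolomorphic.

(** * The real-valued norm *)

Section RealNorm.
Variables (R : realType) (V : normedModType R[i]).
Implicit Types (x y z : V) (c : R[i]).

Lemma vnormD x y : rnorm (x + y) <= rnorm x + rnorm y.
Proof. by rewrite -lecR rmorphD /= -!normr_rnorm ler_normD. Qed.

Lemma vnormZ c x : rnorm (c *: x) = rnorm c * rnorm x.
Proof. by apply: complexI; rewrite rmorphM /= -!normr_rnorm normrZ. Qed.

Lemma vnormN x : rnorm (- x) = rnorm x.
Proof. by rewrite /rnorm normrN. Qed.

Lemma vnorm0 : rnorm (0 : V) = 0.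
Proof. by rewrite /rnorm normr0. Qed.

Lemma vnorm_eq0 x : (rnorm x == 0) = (x == 0).
Proof. by rewrite -(normr_eq0 x) normr_rnorm; apply/eqP/eqP => [->|[]]. Qed.

Lemma vnormB x y : rnorm (x - y) = rnorm (y - x).
Proof. by rewrite -vnormN opprB. Qed.

Lemma vnorm_le_sub x y : rnorm (x - y) <= rnorm x + rnorm y.
Proof. by rewrite (le_trans (vnormD _ _))// vnormN. Qed.

Lemma vnorm_sub_le x y : rnorm x - rnorm y <= rnorm (x - y).
Proof. by rewrite lerBlDr (le_trans _ (vnormD _ _))// subrK. Qed.

Lemma vnorm_tri x y z : rnorm (x - z) <= rnorm (x - y) + rnorm (y - z).
Proof. by rewrite (le_trans _ (vnormD _ _))// addrA subrK. Qed.

Lemma vnorm_half x y z (e : R) : rnorm (x - y) <= e / 2 -> rnorm (z - y) <= e / 2 ->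
  rnorm (x - z) <= e.
Proof.
move=> h1 h2; apply: le_trans (vnorm_tri _ y _) _.
by rewrite [leRHS]splitr (vnormB y); exact: lerD.
Qed.

Lemma eq_vnorm_small x y : (forall e : R, 0 < e -> rnorm (x - y) <= e) -> x = y.
Proof.
move=> h; apply/eqP; rewrite -subr_eq0 -vnorm_eq0; apply/eqP/le_anti.
by rewrite rnorm_ge0 andbT; apply/ler_addgt0Pl => e e0; rewrite addr0 h.
Qed.

End RealNorm.

(** * Norm, completeness and Neumann series in H^2 *)

Section HardyNorm.
Variable R : realType.
Implicit Types (f g h : hardy R) (c : R[i]).

Notation sq f := (fun n => rnorm (f n) ^+ 2).

Lemma hdotE f : hdot f f = (rnorm f ^+ 2)%:C%C.
Proof.
rewrite rmorphXn /= -normr_rnorm -[`|f|]/(hnorm f) /hnorm sqrtCK.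
by [].
Qed.

Lemma hnorm_lim f : series (sq f) @ \oo --> rnorm f ^+ 2.
Proof.
have /ell2P cf := coefP f; have := hdotE f; rewrite hdotxx => -[<-].
exact: cf.
Qed.

Lemma series_le_hnorm f N : series (sq f) N <= rnorm f ^+ 2.
Proof.
rewrite -(cvg_lim (@Rhausdorff R) (@hnorm_lim f)); apply: nondecreasing_cvgn_le.
  by apply: nondecreasing_series => k _ _; exact: sqr_ge0.
by have /ell2P := coefP f.
Qed.

Lemma coef_le_hnorm f n : rnorm (f n) <= rnorm f.
Proof.
rewrite -(@ler_pXn2r _ 2)// ?nnegrE ?rnorm_ge0//; apply: le_trans (@series_le_hnorm f n.+1).
rewrite /series /= big_nat_recr//= ler_wpDl// sumr_ge0// => i _; exact: sqr_ge0.
Qed.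

Lemma ell2_bounded (a : nat -> R[i]) B : (forall N, series (sq a) N <= B) -> a \in @ell2 R.
Proof.
move=> h; apply/ell2P; apply: nondecreasing_is_cvgn.
  by apply: nondecreasing_series => k _ _; exact: sqr_ge0.
by exists B => _ [n _ <-].
Qed.

Lemma hnorm_le f B : 0 <= B -> (forall N, series (sq f) N <= B ^+ 2) -> rnorm f <= B.
Proof.
move=> B0 h; rewrite -(@ler_pXn2r _ 2)// ?nnegrE ?rnorm_ge0//.
rewrite -(cvg_lim (@Rhausdorff R) (@hnorm_lim f)); apply: limr_le.
  by have /ell2P := coefP f.
by apply: filterE.
Qed.

Lemma hdot_CS f g : rnorm (hdot f g) <= rnorm f * rnorm g.
Proof.
rewrite -(@ler_pXn2r _ 2)// ?nnegrE ?mulr_ge0 ?rnorm_ge0// exprMn -lecR.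
have := dot_CauchySchwarz (@hdot R) f g.
by rewrite /= normCE !hdotE -rmorphXn -rmorphM.
Qed.

Lemma fshiftE f n : fshift f n = if n is m.+1 then f m else 0. Proof. by []. Qed.
Lemma bshiftE_coef f n : bshift f n = f n.+1. Proof. by []. Qed.

Lemma fshiftD f g : fshift (f + g) = fshift f + fshift g.
Proof. by apply: hardyP => -[|n] //=; rewrite /GRing.add /= addr0. Qed.

Lemma fshiftZ c f : fshift (c *: f) = c *: fshift f.
Proof. by apply: hardyP => -[|n] //; exact/esym/(mulr0 c). Qed.

Lemma bshiftD f g : bshift (f + g) = bshift f + bshift g. Proof. exact: hardyP. Qed.
Lemma bshiftZ c f : bshift (c *: f) = c *: bshift f. Proof. exact: hardyP. Qed.

Lemma bshiftK f : bshift (fshift f) = f. Proof. exact: hardyP. Qed.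

Lemma hdot_bshiftr f g : hdot f (bshift g) = hdot (fshift f) g.
Proof.
by rewrite (hdotC f) (hdotC (fshift f)) !expr0 !mul1r hdot_bshift.
Qed.

Lemma hnorm_fshift f : rnorm (fshift f) = rnorm f.
Proof.
apply/eqP; rewrite -(@eqrXn2 _ 2)// ?rnorm_ge0//; apply/eqP/complexI.
by rewrite -!hdotE -hdot_bshift bshiftK.
Qed.

Lemma hnorm_bshift f : rnorm (bshift f) <= rnorm f.
Proof.
apply: hnorm_le => [|N]; first exact: rnorm_ge0.
apply: le_trans (@series_le_hnorm f N.+1).
by rewrite /series /= big_nat_recl//= lerDr sqr_ge0.
Qed.

Definition hlim (s : nat -> hardy R) f :=
  forall e : R, 0 < e -> exists N, forall n, (N <= n)%N -> rnorm (f - s n) <= e.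

(** The coefficients converge one by one; the Cauchy bound passes to the limit in each partial sum
    of squares, hence to the norm. *)
Lemma hardy_complete (s : nat -> hardy R) :
  (forall e : R, 0 < e -> exists N, forall m n, (N <= m)%N -> (N <= n)%N ->
     rnorm (s m - s n) <= e) ->
  exists f, hlim s f.
Proof.
move=> cs.
have cc k : cvgn (fun n => s n k).
  have cr (p : R[i] -> R) : (forall x y, `|p x - p y| <= rnorm (x - y)) ->
      cvgn (fun n => p (s n k)).
      move=> hp; apply/cauchy_cvgP/cauchy_exP => e e0.
    have e2 : 0 < e / 2 by rewrite divr_gt0.
    have [N hN] := cs _ e2.
    exists (p (s N k)); exists N => // n /= Nn; rewrite -ball_normE /ball_ /=.
    apply: le_lt_trans (hp _ _) _; apply: le_lt_trans (@coef_le_hnorm (s N - s n) k) _.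
    by apply: le_lt_trans (hN N n (leqnn N) Nn) _; lra.
  have c1 : cvgn (fun n => complex.Re (s n k)).
    by apply: cr => x y; rewrite -raddfB; exact: Re_le_rnorm.
  have c2 : cvgn (fun n => complex.Im (s n k)).
    by apply: cr => x y; rewrite -raddfB; exact: Im_le_rnorm.
  apply/cvg_ex; exists ((limn (fun n => complex.Re (s n k))) +i*
     (limn (fun n => complex.Im (s n k))))%C.
  by apply: cvg_complex.
pose a k := limn (fun n => s n k).
have partial (e : R) N m : 0 <= e -> (forall n, (N <= n)%N -> rnorm (s m - s n) <= e) ->
    forall K, series (sq (fun k => s m k - a k)) K <= e ^+ 2.
  move=> e0 hN K.
  have c : (fun n => series (sq (fun k => s m k - s n k)) K) @ \oo -->
      series (sq (fun k => s m k - a k)) K.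
    elim: K => [|K IH].
      by rewrite /series /= big_geq//; under eq_fun do rewrite big_geq//; exact: cvg_cst.
    rewrite /series /= big_nat_recr//=; under eq_fun do rewrite big_nat_recr//=.
    apply: cvgD; first exact: IH.
    pose k := K; have cB : rnorm (s m k - s n k) @[n --> \oo] --> rnorm (s m k - a k).
      by apply: cvg_rnorm; apply: cvgCB; [exact: cvg_cst|exact: cc].
    by rewrite expr2; under eq_fun do rewrite expr2; exact: cvgM.
  rewrite -(cvg_lim (@Rhausdorff R) c); apply: limr_le; first by apply/cvg_ex; eexists; exact: c.
  exists N => // n /= Nn; apply: le_trans (@series_le_hnorm (s m - s n) K) _.
  by rewrite ler_pXn2r ?nnegrE ?rnorm_ge0// hN.
have [N1 h1] := cs _ ltr01.
have d0 : (fun k => s N1 k - a k) \in @ell2 R.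
  by apply: ell2_bounded; apply: (partial 1 N1) => // n; exact: h1.
(* Square summability has been shown for the difference of [s N1] and the coefficientwise limit [a],
   so [a] is entered as [s N1 - (s N1 - a)]. *)
exists (s N1 - Hardy d0) => e e0; have [N hN] := cs _ e0.
exists N => n Nn; rewrite vnormB; apply: hnorm_le; first exact: ltW.
move=> K; have := partial e N n (ltW e0) (fun m => hN n m Nn) K.
apply: le_trans; rewrite le_eqVlt; apply/orP; left; apply/eqP.
congr (series _ K); apply/funext => k; congr (rnorm _ ^+ 2).
have alg (x y z : R[i]) : x - (y - (y - z)) = x - z by ring.
exact: alg.
Qed.

Definition bounded_by (B : R) (T : hardy R -> hardy R) :=
  forall f, rnorm (T f) <= B * rnorm f.

Lemma neumann (T : hardy R -> hardy R) (q : R) : linear T -> 0 <= q -> q < 1 ->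
  bounded_by q T -> forall g, exists f, f - T f = g.
Proof.
move=> lT q0 q1 bT g.
have TD f h : T (f + h) = T f + T h by have := lT 1 f h; rewrite !scale1r.
have T0 : T 0 = 0 by apply: (addIr (T 0)); rewrite -TD !add0r.
have TN f : T (- f) = - T f.
  by apply: (addIr (T f)); rewrite -TD !addNr.
pose t n := iter n T g; pose s n := \sum_(k < n) t k.
have tq n : rnorm (t n) <= q ^+ n * rnorm g.
  elim: n => [|n IH]; first by rewrite expr0 mul1r.
  by apply: le_trans (bT _) _; rewrite exprS -mulrA ler_wpM2l.
have sT n : s n - T (s n) = g - t n.
  elim: n => [|n IH]; first by rewrite /s big_ord0 T0 !subrr.
  have -> : s n.+1 = s n + t n by rewrite /s big_ord_recr.
  rewrite TD opprD addrACA IH -[T (t n)]/(t n.+1).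
  by rewrite addrA subrK.
have sd n k : rnorm (s (n + k)%N - s n) <= q ^+ n * (rnorm g / (1 - q)).
  have h : rnorm (s (n + k)%N - s n) <= (\sum_(i < k) q ^+ i) * (q ^+ n * rnorm g).
    elim: k => [|k IH]; first by rewrite addn0 subrr vnorm0 big_ord0 mul0r.
    rewrite addnS big_ord_recr /= mulrDl.
    have -> : s (n + k).+1 - s n = (s (n + k)%N - s n) + t (n + k)%N.
      by rewrite /s big_ord_recr /= addrAC.
    apply: le_trans (vnormD _ _) _; apply: lerD => //.
    by apply: le_trans (tq _) _; rewrite mulrA -exprD addnC.
  apply: le_trans h _; rewrite mulrCA ler_wpM2l ?exprn_ge0// mulrC ler_wpM2l ?rnorm_ge0//.
  have := subrX1 q k; have qk := exprn_ge0 k q0 => e.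
  have q10 : 0 < 1 - q by rewrite subr_gt0.
  have -> : \sum_(i < k) q ^+ i = (1 - q ^+ k) / (1 - q).
    have -> : 1 - q ^+ k = (1 - q) * \sum_(i < k) q ^+ i.
      by rewrite -[LHS]opprB e -mulNr opprB.
    by rewrite mulrC mulKf// gt_eqF.
  by rewrite -[leRHS]mul1r ler_pM2r ?invr_gt0//; lra.
have small (C e : R) : 0 < e -> exists N, forall n, (N <= n)%N -> q ^+ n * C <= e.
  move=> e0; have : q ^+ n * C @[n --> \oo] --> 0 * C.
    by apply: cvgMr_tmp; apply: cvg_expr; rewrite ger0_norm.
  rewrite mul0r => /cvgrPdist_lt/(_ _ e0)[N _ hN]; exists N => n /hN /=.
  by rewrite sub0r normrN => /(le_lt_trans (ler_norm _))/ltW.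
have [f hf] : exists f, hlim s f.
  apply: hardy_complete => e e0; have e2 : 0 < e / 2 by rewrite divr_gt0.
  have [N hN] := small (rnorm g / (1 - q)) _ e2.
  exists N => m n Nm Nn; apply: (@vnorm_half _ _ _ (s N)).
    by rewrite -(subnKC Nm); apply: le_trans (sd _ _) (hN _ _).
  by rewrite -(subnKC Nn); apply: le_trans (sd _ _) (hN _ _).
exists f; apply: eq_vnorm_small => e e0; have e3 : 0 < e / 3 by rewrite divr_gt0.
have [N1 h1] := hf _ e3; have [N2 h2] := small (rnorm g) _ e3.
pose n := maxn N1 N2; have k1 := h1 n (leq_maxl _ _); have k2 := h2 n (leq_maxr _ _).
have -> : f - T f - g = (f - s n) - T (f - s n) - t n.
  rewrite TD TN opprD opprK addrACA.
  have -> : - s n + T (s n) = - g + t n by rewrite addrC -opprB sT opprB addrC.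
  by rewrite addrA addrK.
have b1 : rnorm (T (f - s n)) <= e / 3.
  by apply: le_trans (bT _) _; rewrite -[leRHS]mul1r ler_pM ?rnorm_ge0// ltW.
have -> : e = e / 3 + e / 3 + e / 3 by field.
apply: le_trans (vnorm_le_sub _ _) _; apply: lerD; last exact: le_trans (tq n) k2.
by apply: le_trans (vnorm_le_sub _ _) _; exact: lerD.
Qed.

End HardyNorm.

(** * Monomials, point evaluations and reproducing kernels *)

Section HardyBasis.
Variable R : realType.
Implicit Types (f g h : hardy R) (c z w : R[i]).

Notation sq f := (fun n => rnorm (f n) ^+ 2).
Notation X := (@bshift R).
Notation S := (@fshift R).

Lemma iter_bshiftE k f n : iter k X f n = f (n + k)%N.
Proof. by elim: k n => [|k IH] n; rewrite ?addn0//= IH addSnnS. Qed.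

Lemma iter_fshiftE k f n : iter k S f n = if (k <= n)%N then f (n - k)%N else 0.
Proof. by elim: k n => [|k IH] [|n]; rewrite ?subn0//= IH. Qed.

Lemma hdot_iter_bshift k f g : hdot (iter k X f) g = hdot f (iter k S g).
Proof. by elim: k f => [//|k IH] f; rewrite iterSr IH hdot_bshift. Qed.

Lemma hnorm_iter_bshift k f : rnorm (iter k X f) <= rnorm f.
Proof. by elim: k => [//|k IH]; apply: le_trans (hnorm_bshift _) IH. Qed.

Lemma hnorm_iter_fshift k f : rnorm (iter k S f) = rnorm f.
Proof. by elim: k => [//|k IH]; rewrite /= hnorm_fshift. Qed.

(** The square of the norm of [X^n f] is a tail of a convergent series. This strong convergence to 0
    drives the arguments on and outside the unit circle. *)
Lemma iter_bshift_cvg0 f (e : R) : 0 < e ->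
  exists N, forall n, (N <= n)%N -> rnorm (iter n X f) <= e.
Proof.
move=> e0; have e2 : 0 < e ^+ 2 by rewrite exprn_gt0.
have /cvgrPdist_le/(_ _ e2)[N _ hN] := @hnorm_lim R f.
exists N => n /hN /= /(le_trans (ler_norm _)) h; apply: hnorm_le; first exact: ltW.
move=> K; apply: le_trans h; rewrite lerBrDr; apply: le_trans (@series_le_hnorm _ f (n + K)).
rewrite /series /= (@big_cat_nat _ _ _ n 0 (n + K))//= ?leq_addr// addrC lerD2r.
rewrite -{2}[n]add0n big_addn addKn; apply: ler_sum => k _.
by rewrite iter_bshiftE.
Qed.

Lemma hone_subproof : (fun n => (n == 0%N)%:R : R[i]) \in @ell2 R.
Proof.
apply: (@ell2_bounded _ _ 1) => -[|N]; first by rewrite /series /= big_geq.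
rewrite /series /= big_nat_recl//= rnorm1 expr1n big1 ?addr0// => i _.
by rewrite rnorm0 expr0n.
Qed.

Definition hone : hardy R := Hardy hone_subproof.

Definition trunc N f : hardy R := \sum_(k < N) f k *: iter k S hone.

Lemma coefD f g n : (f + g) n = f n + g n. Proof. by []. Qed.
Lemma coefZ c f n : (c *: f) n = c * f n. Proof. by []. Qed.
Lemma coefN f n : (- f) n = - f n. Proof. by []. Qed.
Lemma coef_sum N (F : nat -> hardy R) n : (\sum_(k < N) F k) n = \sum_(k < N) F k n.
Proof. by elim: N => [|N IH]; rewrite ?big_ord0// !big_ord_recr -IH. Qed.

Lemma monomialE k n : iter k S hone n = (n == k)%:R.
Proof.
rewrite iter_fshiftE; case: leqP => [kn|nk].
  by rewrite [hone _]/((_ == 0%N)%:R) subn_eq0 eqn_leq kn andbT.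
by rewrite ltn_eqF.
Qed.

Lemma truncE N f n : trunc N f n = if (n < N)%N then f n else 0.
Proof.
rewrite /trunc (coef_sum N (fun k => f k *: iter k S hone)).
under eq_bigr do rewrite coefZ monomialE.
case: ltnP => [nN|Nn].
  rewrite (bigD1 (Ordinal nN))//= eqxx mulr1 big1 ?addr0// => i iN.
  case: eqVneq => [e|_]; last by rewrite mulr0.
  by move: iN; rewrite -val_eqE /= -e eqxx.
rewrite big1// => i _; case: eqVneq => [e|_]; last by rewrite mulr0.
by have := ltn_ord i; rewrite -e ltnNge Nn.
Qed.

Lemma sub_trunc N f : f - trunc N f = iter N S (iter N X f).
Proof.
apply: hardyP => n; rewrite coefD coefN truncE iter_fshiftE ltnNge.
case: leqP => [Nn|_] /=; last by rewrite subrr.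
by rewrite iter_bshiftE subnK// subr0.
Qed.

Lemma hlim_trunc f : hlim (trunc ^~ f) f.
Proof.
move=> e e0; have [N hN] := iter_bshift_cvg0 f e0.
by exists N => n /hN h; rewrite sub_trunc hnorm_iter_fshift.
Qed.

Lemma hdot_hlim (s : nat -> hardy R) f g : hlim s f ->
  (fun n => hdot (s n) g) @ \oo --> hdot f g.
Proof.
move=> hf; apply/cvgCP => e e0; have g0 := rnorm_ge0 g.
have e1 : 0 < e / (2 * (rnorm g + 1)) by rewrite divr_gt0// mulr_gt0// ltr_wpDl.
have [N hN] := hf _ e1; exists N => // n /hN /= h.
rewrite -linearBl /=; apply: le_lt_trans (hdot_CS _ _) _.
apply: le_lt_trans (ler_wpM2r g0 h) _.
rewrite mulrAC ltr_pdivrMr ?mulr_gt0 ?ltr_wpDl//.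
rewrite ltr_pM2l//; lra.
Qed.

Lemma hdot_hlim0 (s : nat -> hardy R) f g : hlim s f -> (forall n, hdot (s n) g = 0) ->
  hdot f g = 0.
Proof.
move=> /hdot_hlim h h0; have := h g; under eq_fun do rewrite h0.
move=> /(cvg_lim (@norm_hausdorff _ R[i])) <-.
exact: lim_cst (@norm_hausdorff _ R[i]) _ _ _ _.
Qed.

Lemma geo_sum_le (q : R) N : 0 <= q -> q < 1 -> \sum_(0 <= k < N) q ^+ k <= (1 - q)^-1.
Proof.
move=> q0 q1; have d0 : 0 < 1 - q by rewrite subr_gt0.
rewrite -[leRHS]div1r ler_pdivlMr// mulrC.
suff -> : (1 - q) * \sum_(0 <= k < N) q ^+ k = 1 - q ^+ N by rewrite lerBlDr lerDl exprn_ge0.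
by rewrite big_mkord -[RHS]opprB subrX1 -mulNr opprB.
Qed.

(* The function [1 / (1 - w z)], the reproducing kernel at the conjugate of [w]. *)
Lemma geo_exists w : rnorm w < 1 ->
  exists2 k : hardy R, (forall n, k n = w ^+ n) & rnorm k <= (1 - rnorm w)^-1.
Proof.
move=> w1; have w0 := rnorm_ge0 w; have d0 : 0 < 1 - rnorm w by rewrite subr_gt0.
have B N : series (fun n => rnorm (w ^+ n) ^+ 2) N <= (1 - rnorm w)^-1.
  apply: le_trans (geo_sum_le N w0 w1); apply: ler_sum => k _.
  have h0 : 0 <= rnorm w ^+ k by rewrite exprn_ge0.
  have h1 : rnorm w ^+ k <= 1 by rewrite exprn_ile1// ltW.
  by rewrite rnormX expr2 -[leRHS]mulr1 ler_wpM2l.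
exists (Hardy (ell2_bounded B)) => //.
apply: hnorm_le => [|N]; first by rewrite invr_ge0 ltW.
apply: le_trans (B N) _; rewrite expr2 -[leLHS]mulr1 ler_wpM2l ?invr_ge0 ?(ltW d0)//.
by rewrite -[leLHS]invr1 lef_pV2 ?posrE//; lra.
Qed.

Lemma heval_hdot f w (k : hardy R) : (forall n, k n = w^* ^+ n) -> heval f w = hdot f k.
Proof.
move=> hk; rewrite /heval /hdot; congr (limn (series _)); apply/funext => n.
by rewrite hk rmorphXn /= conjCK.
Qed.

Lemma hevalD f g w : rnorm w < 1 -> heval (f + g) w = heval f w + heval g w.
Proof.
rewrite -(rnorm_conj w) => /geo_exists[k hk _].
by rewrite !(heval_hdot _ hk) linearDl.
Qed.

Lemma hevalZ c f w : rnorm w < 1 -> heval (c *: f) w = c * heval f w.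
Proof.
rewrite -(rnorm_conj w) => /geo_exists[k hk _].
by rewrite !(heval_hdot _ hk) linearZl_LR.
Qed.

Lemma heval_sum N (F : nat -> hardy R) w : rnorm w < 1 ->
  heval (\sum_(k < N) F k) w = \sum_(k < N) heval (F k) w.
Proof.
move=> w1; elim: N => [|N IH]; last by rewrite !big_ord_recr /= hevalD// IH.
by rewrite !big_ord0; have := hevalZ 0 0 w1; rewrite scale0r mul0r.
Qed.

Lemma heval_hlim (s : nat -> hardy R) f w : rnorm w < 1 -> hlim s f ->
  (fun n => heval (s n) w) @ \oo --> heval f w.
Proof.
rewrite -(rnorm_conj w) => /geo_exists[k hk _] /hdot_hlim h.
by rewrite (heval_hdot _ hk); under eq_fun do rewrite (heval_hdot _ hk); exact: h.
Qed.

Lemma heval_bound f w : rnorm w < 1 -> rnorm (heval f w) <= rnorm f / (1 - rnorm w).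
Proof.
rewrite -(rnorm_conj w) => /geo_exists[k hk hn]; rewrite (heval_hdot _ hk).
apply: le_trans (hdot_CS _ _) _; apply: ler_wpM2l hn; exact: rnorm_ge0.
Qed.

Lemma heval_iter_fshift k f w : rnorm w < 1 -> heval (iter k S f) w = w ^+ k * heval f w.
Proof.
move=> w1; elim: k => [|k IH]; first by rewrite mul1r.
by rewrite /= heval_fshift ?rnorm_lt1// IH exprS mulrA.
Qed.

Lemma heval_split f w : rnorm w < 1 -> heval f w = f 0%N + w * heval (X f) w.
Proof. by move=> w1; rewrite heval_bshift ?rnorm_lt1. Qed.

(** The origin is left out because [heval_eq0] gets the values of [X^(n+1) f] from those of [X^n f]
    by dividing by [w]; the coefficient is recovered as [w] tends to 0. *)
Lemma coef0_eq0 g : (forall w, rnorm w < 1 -> w != 0 -> heval g w = 0) -> g 0%N = 0.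
Proof.
move=> g0; apply: eq_vnorm_small => e e0; rewrite subr0.
have k0 : 0 < 2 * (rnorm (X g) + 1) by rewrite mulr_gt0// ltr_wpDl// rnorm_ge0.
(* For [|w| = d <= 1/2], the identity [g 0 = - w (X g)(w)] gives [|g 0| <= 2 d |X g|], and the
   second entry makes this at most [e]. *)
pose d := Num.min 2^-1 (e / (2 * (rnorm (X g) + 1))).
have d0 : 0 < d by rewrite lt_min divr_gt0// invr_gt0 ltr0n.
have [d1 d2] : d <= 2^-1 /\ d <= e / (2 * (rnorm (X g) + 1)).
  by rewrite !ge_min !lexx orbT.
have wd : rnorm (d%:C%C : R[i]) = d by rewrite rnormR ger0_norm// ltW.
have w1 : rnorm (d%:C%C : R[i]) < 1 by rewrite wd; lra.
have w0 : d%:C%C != 0 :> R[i] by rewrite -rnorm_eq0 wd gt_eqF.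
have /eqP := heval_split g w1; rewrite g0// eq_sym addr_eq0 => /eqP ->.
rewrite rnormN rnormM wd.
apply: le_trans (ler_wpM2l (ltW d0) (heval_bound _ w1)) _; rewrite wd.
have i2 : (1 - d)^-1 <= 2.
  by rewrite -[leRHS]invrK lef_pV2 ?posrE ?invr_gt0 ?ltr0n//; lra.
have n0 := rnorm_ge0 (X g).
apply: (@le_trans _ _ (d * (rnorm (X g) * 2))).
  by apply: ler_wpM2l; [exact: ltW|exact: ler_wpM2l].
rewrite ler_pdivlMr// in d2; apply: le_trans d2; apply: ler_wpM2l; [exact: ltW|lra].
Qed.

Lemma heval_eq0 f : (forall w, rnorm w < 1 -> heval f w = 0) -> f = 0.
Proof.
move=> f0; have h n : forall w, rnorm w < 1 -> w != 0 -> heval (iter n X f) w = 0.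
  elim: n => [|n IH] w w1 w0; first exact: f0.
  have := heval_split (iter n X f) w1; rewrite IH// (coef0_eq0 IH) add0r => /esym/eqP.
  by rewrite mulf_eq0 (negbTE w0) => /eqP.
by apply: hardyP => n; have := coef0_eq0 (h n); rewrite iter_bshiftE.
Qed.

End HardyBasis.

(** * Inner functions as elements of H^2 *)

Section InnerTaylor.
Variables (R : realType) (u : R[i] -> R[i]).
Hypothesis u_inner : inner_function u.
Implicit Types (z w : R[i]) (r t : R).
Notation mu := (@lebesgue_measure R).
Notation p2 := (((2 * pi)^-1)%:C%C).

Lemma inner_hol z : rnorm z < 1 -> hol u z.
Proof. by case: u_inner => h _ _ z1; apply: derivable_hol; apply: h; apply/diskP. Qed.

Lemma inner_bounded : exists M : R, forall z, rnorm z < 1 -> rnorm (u z) <= M.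
Proof. by case: u_inner => _ [M hM] _; exists M => z /diskP; exact: hM. Qed.

(** Radii tending to 1 that are at least 1/2, which keeps [r^-k] below [2^k] in [cvg_wmean]. *)
Definition rseq (m : nat) : R := 1 - 2^-1 / m.+1%:R.

Lemma rseq_bounds m : 2^-1 <= rseq m < 1.
Proof.
have h0 : 0 < 2^-1 / m.+1%:R :> R by rewrite divr_gt0.
have h1 : 2^-1 / m.+1%:R <= 2^-1 :> R by rewrite ler_pdivrMr// ler_peMr// ler1n.
rewrite /rseq; move: h0 h1; move: (2^-1 / m.+1%:R) => q h0 h1.
by apply/andP; split; lra.
Qed.

Lemma rseq01 m : 0 < rseq m < 1.
Proof. by have /andP[h1 h2] := rseq_bounds m; apply/andP; split; lra. Qed.

Lemma cvg_rseq : rseq @ \oo --> (1 : R).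
Proof.
have : 1 - 2^-1 / m.+1%:R @[m --> \oo] --> (1 - 0 : R).
  by apply: cvgB; [exact: cvg_cst|exact: cvg_harmonicZ].
by rewrite subr0.
Qed.

Lemma cvg_rseqX n : rseq m ^+ n @[m --> \oo] --> (1 : R).
Proof.
elim: n => [|n IH]; first by under eq_fun do rewrite expr0; exact: cvg_cst.
under eq_fun do rewrite exprS.
have : rseq m * rseq m ^+ n @[m --> \oo] --> (1 * 1 : R) by apply: cvgM; [exact: cvg_rseq|].
by rewrite mulr1.
Qed.

Lemma cvg_rseq_left : rseq @ \oo --> (1 : R)^'-.
Proof.
move=> A [e /= e0 hA]; have /cvgrPdist_lt/(_ _ e0) := cvg_rseq.
apply: filterS => m h; apply: hA => //; by have /andP[] := rseq_bounds m.
Qed.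

(** The [k]-th Fourier coefficient of [|u|^2] on the circle of radius [r], divided by [r^k]. *)
Definition wmean k r : R[i] := p2 * circ r (fun z => u z * (u z)^* * z ^- k).

(** Here the boundary values enter: [|u|^2] is bounded and tends to 1 almost everywhere, so the
    means tend to those of [z^-k] on the unit circle. *)
Lemma cvg_wmean k : (fun m => wmean k (rseq m)) @ \oo --> ((k == 0%N)%:R : R[i]).
Proof.
have [M uM] := inner_bounded.
have M0 : 0 <= M by apply: le_trans (rnorm_ge0 _) (uM 0 _); rewrite rnorm0.
have -> : (k == 0%N)%:R = p2 * circ 1 (fun z => z ^- k) :> R[i].
  rewrite circ_inv// mulrA -rmorphM /= mulVf ?mul1r//.
  by rewrite gt_eqF// pi2_gt0.
apply: cvgCM; first exact: cvg_cst.
have z0 z : 0 < rnorm z -> z != 0 by rewrite rnorm_gt0.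
apply: (@Cint_dominated _ _ _ _ _ (M ^+ 2 * 2 ^+ k)).
- move=> m; have /andP[r0 r1] := rseq01 m.
  apply: (@tends_contin_circ _ (fun z => u z * (u z)^* * z ^- k)) => // z zr.
  have hz : tends u z (u z) by apply: hol_tends; apply: inner_hol; rewrite zr.
  apply: tendsM; last by apply: tends_inv; apply: z0; rewrite zr.
  apply: (tendsM hz); split; apply: cvg_conj; exact: (tends_cvg hz).
- apply: (@tends_contin_circ _ (fun z => z ^- k)) => // z zr.
  by apply: tends_inv; apply: z0; rewrite zr.
- move=> m t _; have /andP[r0 r1] := rseq01 m; have /andP[r2 _] := rseq_bounds m.
  have zr := rnorm_cpt t (ltW r0); set z := cpt _ _ in zr *.
  have uz : rnorm (u z) <= M by apply: uM; rewrite zr.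
  rewrite !rnormM rnorm_conj rnormV rnormX zr -expr2; apply: ler_pM.
  + by rewrite exprn_ge0 ?rnorm_ge0.
  + by rewrite invr_ge0 exprn_ge0// ltW.
  + by rewrite ler_pXn2r ?nnegrE ?rnorm_ge0.
  + rewrite -exprVn lerXn2r ?nnegrE ?invr_ge0 ?(ltW r0)//.
    by rewrite -[leRHS]invrK lef_pV2 ?posrE ?invr_gt0.
have FA := @ae_filter_ringOfSetsType _ _ _ mu.
case: u_inner => _ _ hae; apply: filterS hae => t ht _.
have c1 : (fun m => rnorm (u (cpt (rseq m) t))) @ \oo --> (1 : R).
  exact: cvg_comp cvg_rseq_left ht.
have c2 : (fun m => ((rnorm (u (cpt (rseq m) t))) ^+ 2)%:C%C) @ \oo --> (1 : R[i]).
  have -> : (1 : R[i]) = (1 * 1 : R)%:C%C by rewrite mulr1.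
  by apply: cvg_real_complex; under eq_fun do rewrite expr2; exact: cvgM.
under eq_fun do rewrite -rnorm_sqr.
have -> : cpt 1 t ^- k = 1 * cpt 1 t ^- k by rewrite mul1r.
apply: cvgCM c2 _.
have hz : tends (fun z => z ^- k) (cpt 1 t) (cpt 1 t ^- k).
  by apply: tends_inv; exact: cpt_neq0.
apply: cvg_comp (tends_cvg hz); apply: cvgCM; last exact: cvg_cst.
by apply: cvg_real_complex; exact: cvg_rseq.
Qed.

Notation c := (taylor u).
Notation S := (series (fun n => rnorm (c n) ^+ 2)).
Notation Q r := (series (fun n => r ^+ (2 * n) * rnorm (c n) ^+ 2)).

Lemma cvg_wmean_partial k r : 0 < r < 1 ->
  series (fun n => (r ^+ (2 * n))%:C%C * ((c n)^* * c (n + k)%N)) @ \oo --> wmean k r.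
Proof.
have [M uM] := inner_bounded => r01.
have := @parseval R u M inner_hol uM r k r01.
by rewrite /series /= => h; under eq_fun do rewrite big_mkord; exact: h.
Qed.

Lemma cvg_Q r : 0 < r < 1 -> Q r @ \oo --> complex.Re (wmean 0 r).
Proof.
move=> r01; have /cvg_Re := @cvg_wmean_partial 0 r r01.
under eq_fun do rewrite Re_series.
have -> // : (fun n => complex.Re ((r ^+ (2 * n))%:C%C * ((c n)^* * c (n + 0)%N))) =
    (fun n => r ^+ (2 * n) * rnorm (c n) ^+ 2).
by apply/funext => n; rewrite addn0 [_ * c n]mulrC -rnorm_sqr -rmorphM.
Qed.

Lemma Q_le r N : 0 < r < 1 -> Q r N <= complex.Re (wmean 0 r).
Proof.
move=> r01; have h := @cvg_Q r r01; have /andP[r0 _] := r01.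
rewrite -(cvg_lim (@Rhausdorff R) h); apply: nondecreasing_cvgn_le.
  by apply: nondecreasing_series => k _ _; rewrite mulr_ge0 ?sqr_ge0// exprn_ge0// ltW.
by apply/cvg_ex; eexists; exact: h.
Qed.

Lemma cvg_Re_wmean : (fun m => complex.Re (wmean 0 (rseq m))) @ \oo --> (1 : R).
Proof. by have /cvg_Re := @cvg_wmean 0. Qed.

(** [r^(2N) S_N] is at most the mean of [|u|^2] over the circle of radius [r]; then [r] tends to
    1. *)
Lemma S_le1 N : S N <= 1.
Proof.
have h m : rseq m ^+ (2 * N) * S N <= complex.Re (wmean 0 (rseq m)).
  have r01 := rseq01 m; have /andP[r0 r1] := r01.
  apply: le_trans (Q_le N r01); rewrite /series /= mulr_sumr !big_mkord.
  apply: ler_sum => n _; rewrite ler_wpM2r ?sqr_ge0//.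
  by rewrite ler_wiXn2l ?(ltW r0) ?(ltW r1)// leq_mul2l ltnW.
have l : rseq m ^+ (2 * N) * S N @[m --> \oo] --> 1 * S N.
  by apply: cvgMr_tmp; exact: cvg_rseqX.
rewrite mul1r in l.
by apply: ler_cvg_to l cvg_Re_wmean _; exact: filterE.
Qed.

Lemma taylor_in_ell2 : c \in @ell2 R.
Proof. exact: ell2_bounded S_le1. Qed.

Definition inner_coef : hardy R := Hardy taylor_in_ell2.
Notation U := inner_coef.

Lemma heval_inner z : rnorm z < 1 -> heval U z = u z.
Proof.
move=> z1; have [M uM] := inner_bounded.
have [r zr r01] : exists2 r : R, rnorm z < r & 0 < r < 1.
  by exists ((1 + rnorm z) / 2); have := rnorm_ge0 z; [lra|move=> ?; apply/andP; split; lra].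
have /andP[r0 r1] := r01.
apply: (@cvg_lim _ (@norm_hausdorff _ R[i])).
apply: (@cvgC_squeeze _ _ _ _ (fun N => M * (r / (r - rnorm z)) * (rnorm z / r) ^+ N)).
  apply: filterE => N; rewrite rnormB /series /= big_mkord.
  rewrite (eq_bigr (fun n : 'I_N => z ^+ n * c n)) => [|n _]; last exact: mulrC.
  have := taylor_approx inner_hol uM N r01 zr => /le_trans; apply.
  by rewrite le_eqVlt; apply/orP; left; apply/eqP; move: (_ ^+ N) => q; ring.
have : M * (r / (r - rnorm z)) * (rnorm z / r) ^+ N @[N --> \oo] -->
    (M * (r / (r - rnorm z)) * 0 : R).
  apply: cvgMl_tmp; apply: cvg_expr; rewrite ger0_norm ?divr_ge0 ?(ltW r0) ?rnorm_ge0//.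
  by rewrite ltr_pdivrMr// mul1r.
by rewrite mulr0.
Qed.

(** The difference is the sum of [(1 - r^(2n)) c_(n+k) conj(c_n)]. By the inequality of arithmetic
    and geometric means it is at most the sum of [(1 - r^(2n)) |c_n|^2], where [S_le1] bounds the
    sum of the [|c_n|^2]. *)
Lemma inner_correlation k r : 0 < r < 1 ->
  rnorm (hdot (iter k (@bshift R) U) U - wmean k r) <= 1 - complex.Re (wmean 0 r).
Proof.
move=> r01; have /andP[r0 r1] := r01.
pose a n : R[i] := c (n + k)%N * (c n)^*.
have ha : series a @ \oo --> hdot (iter k (@bshift R) U) U.
  have := @hdot_cvg R (iter k (@bshift R) U) U; rewrite /hdot.
  by under eq_fun do rewrite iter_bshiftE.
pose b n : R[i] := (r ^+ (2 * n))%:C%C * ((c n)^* * c (n + k)%N).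
have hb : series b @ \oo --> wmean k r by exact: cvg_wmean_partial.
have hab : (fun N => rnorm (series a N - series b N)) @ \oo -->
    rnorm (hdot (iter k (@bshift R) U) U - wmean k r).
  by apply: cvg_rnorm; exact: (cvgCB ha hb).
have hQ : (fun N => 1 - Q r N) @ \oo --> 1 - complex.Re (wmean 0 r).
  by apply: cvgB; [exact: cvg_cst|exact: cvg_Q].
(* The right side is taken at [N + k], so that it covers the indices [n + k] occurring on the
   left. *)
apply: ler_cvg_to hab (_ : (fun N => 1 - Q r (N + k)%N) @ \oo --> _) _.
  by rewrite (cvg_shiftn k (fun N => 1 - Q r N)).
apply: filterE => N; apply: (@le_trans _ _ (S (N + k)%N - Q r (N + k)%N)); last first.
  by rewrite lerB// S_le1.
pose d n := rnorm (c n) ^+ 2 * (1 - r ^+ (2 * n)).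
have rn1 n : 0 <= 1 - r ^+ n by rewrite subr_ge0 exprn_ile1// ltW.
have d0 n : 0 <= d n by rewrite mulr_ge0 ?sqr_ge0.
have dE m : S m - Q r m = \sum_(n < m) d n.
  rewrite /series /= !big_mkord -sumrB; apply: eq_bigr => n _; rewrite /d.
  by rewrite mulrBr mulr1 [_ * r ^+ _]mulrC.
rewrite dE /series /= !big_mkord -sumrB; apply: le_trans (rnorm_sum _ _ _) _.
apply: (@le_trans _ _ (2^-1 * (\sum_(n < N) d n + \sum_(n < N) d (n + k)%N))).
  rewrite -big_split /= mulr_sumr; apply: ler_sum => n _; rewrite /a /b.
  have -> : c (n + k)%N * (c n)^* - (r ^+ (2 * n))%:C%C * ((c n)^* * c (n + k)%N) =
      (1 - r ^+ (2 * n))%:C%C * (c (n + k)%N * (c n)^*).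
    have alg (x y q : R[i]) : x * y - q * (y * x) = (1 - q) * (x * y) by ring.
    by rewrite rmorphB rmorph1; exact: alg.
  rewrite rnormM (rnormM (c (n + k)%N)) rnormR rnorm_conj ger0_norm// /d.
  have k1 : 1 - r ^+ (2 * n) <= 1 - r ^+ (2 * (n + k)).
    by rewrite lerB// ler_wiXn2l ?(ltW r0) ?(ltW r1)// leq_mul2l leq_addr.
  have k0 := rn1 (2 * n)%N.
  move: (rnorm (c n)) (rnorm (c (n + k)%N)) (1 - r ^+ (2 * n)) (1 - r ^+ (2 * (n + k))) k0 k1.
  move=> x y p q p0 pq.
  have h1 : y ^+ 2 * p <= y ^+ 2 * q by rewrite ler_wpM2l ?sqr_ge0.
  have h2 : 0 <= p * (x - y) ^+ 2 by rewrite mulr_ge0 ?sqr_ge0.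
  have : p * (x - y) ^+ 2 = x ^+ 2 * p + y ^+ 2 * p - 2 * (p * (y * x)) by ring.
  lra.
have l1 : \sum_(n < N) d n <= \sum_(n < N + k) d n.
  by rewrite big_split_ord /= lerDl sumr_ge0.
have l2 : \sum_(n < N) d (n + k)%N <= \sum_(n < N + k) d n.
  rewrite addnC big_split_ord /= -[leLHS]add0r lerD ?sumr_ge0//.
  by under eq_bigr do rewrite addnC.
have -> : \sum_(n < N + k) d n = 2^-1 * (\sum_(n < N + k) d n + \sum_(n < N + k) d n) by field.
by rewrite ler_wpM2l ?invr_ge0// lerD.
Qed.

(* That is, multiplication by an inner function is isometric. *)
Lemma inner_orthonormal k : hdot (iter k (@bshift R) U) U = (k == 0%N)%:R.
Proof.
have h : (fun m : nat => hdot (iter k (@bshift R) U) U) @ \oo --> ((k == 0%N)%:R : R[i]).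
  have h0 : (fun m => hdot (iter k (@bshift R) U) U - wmean k (rseq m)) @ \oo --> (0 : R[i]).
    apply: (@cvgC_squeeze _ _ _ _ (fun m => 1 - complex.Re (wmean 0 (rseq m)))).
      by apply: filterE => m; rewrite subr0; apply: inner_correlation; exact: rseq01.
    have : 1 - complex.Re (wmean 0 (rseq m)) @[m --> \oo] --> (1 - 1 : R).
      by apply: cvgB; [exact: cvg_cst|exact: cvg_Re_wmean].
    by rewrite subrr.
  have h1 : (fun m => hdot (iter k (@bshift R) U) U - wmean k (rseq m) + wmean k (rseq m))
      @ \oo --> (0 + (k == 0%N)%:R : R[i]) by exact: (cvgCD h0 (@cvg_wmean k)).
  by move: h1; rewrite add0r; under eq_fun do rewrite subrK.
rewrite -(cvg_lim (@norm_hausdorff _ R[i]) h).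
exact/esym/(lim_cst (@norm_hausdorff _ R[i])).
Qed.

End InnerTaylor.

(** * The model space and the resolvent of the backward shift *)

Section ModelTheory.
Variables (R : realType) (U : hardy R).
Implicit Types (f g h v : hardy R) (c z w m : R[i]).
Notation bX := (@bshift R).
Notation fS := (@fshift R).
Hypothesis orthoU : forall k : nat, hdot (iter k bX U) U = (k == 0%N)%:R.

Lemma hdot_conj f g : hdot f g = (hdot g f)^*.
Proof. by rewrite hdotC expr0 mul1r. Qed.

Lemma hnormU : rnorm U = 1.
Proof.
have := orthoU 0; rewrite /= hdotE => -[e].
by apply/eqP; rewrite -(@eqrXn2 _ 2)// ?rnorm_ge0// e expr1n.
Qed.

Lemma orthoS n j : hdot (iter n fS U) (iter j fS U) = (n == j)%:R.
Proof.
have K i f : iter i bX (iter i fS f) = f by elim: i => [//|i IH]; rewrite iterSr /= bshiftK.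
wlog nj : n j / (n <= j)%N.
  move=> h; have [|/ltnW jn] := leqP n j; first exact: h.
  by rewrite hdot_conj h// eq_sym; case: (n == j); rewrite ?rmorph1 ?rmorph0.
rewrite hdot_conj -{1}(subnK nj) addnC iterD -hdot_iter_bshift.
rewrite -[iter n bX _]/(iter n bX (iter n fS (iter (j - n) fS U))) K.
rewrite hdot_conj -hdot_iter_bshift orthoU subn_eq0 conjCK.
by congr (_%:R); rewrite eqn_leq nj.
Qed.

Lemma fshiftB f g : fS (f - g) = fS f - fS g.
Proof. by rewrite -[- g]scaleN1r fshiftD fshiftZ scaleN1r. Qed.

Lemma bshiftB f g : bX (f - g) = bX f - bX g. Proof. exact: hardyP. Qed.

(** Orthogonality to the products of [U] with monomials only; [inKP] identifies it with
    orthogonality to all of [u H^2]. *)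
Definition inK f := forall j : nat, hdot f (iter j fS U) = 0.

Lemma inK0 : inK 0. Proof. by move=> k; rewrite linear0l. Qed.

Lemma inKD f g : inK f -> inK g -> inK (f + g).
Proof. by move=> hf hg k; rewrite linearDl /= hf hg addr0. Qed.

Lemma inKZ c f : inK f -> inK (c *: f).
Proof. by move=> hf k; rewrite linearZl_LR /= hf mulr0. Qed.

Lemma inKB f g : inK f -> inK g -> inK (f - g).
Proof. by move=> hf hg; apply: inKD => //; rewrite -scaleN1r; exact: inKZ. Qed.

Lemma inK_sum N (F : nat -> hardy R) : (forall n, inK (F n)) -> inK (\sum_(n < N) F n).
Proof.
by move=> h; elim: N => [|N IH]; rewrite ?big_ord0 ?big_ord_recr; [exact: inK0|exact: inKD].
Qed.

Lemma inKX f : inK f -> inK (bX f).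
Proof. by move=> hf k; rewrite hdot_bshift; exact: (hf k.+1). Qed.

Lemma inK_hlim (s : nat -> hardy R) f : hlim s f -> (forall n, inK (s n)) -> inK f.
Proof. by move=> h hs k; apply: (hdot_hlim0 h) => n; exact: hs. Qed.

Lemma hone_coef0 f : hdot f (hone R) = f 0%N.
Proof.
have -> : hdot f (hone R) = hdot (trunc 1 f) (hone R).
  apply/eqP; rewrite -subr_eq0 -linearBl /= sub_trunc /=.
  rewrite hdot_conj -hdot_bshift.
  have -> : bX (hone R) = 0 by exact: hardyP.
  by rewrite linear0l rmorph0.
rewrite /trunc big_ord1 /= linearZl_LR /= hdotE.
have -> : rnorm (hone R) = 1; last by rewrite expr1n mulr1.
apply/le_anti/andP; split; last by have := coef_le_hnorm (hone R) 0; rewrite rnorm1.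
apply: hnorm_le => // N; rewrite expr1n; case: N => [|N]; first by rewrite /series /= big_geq.
rewrite /series /= big_nat_recl//= rnorm1 expr1n big1 ?addr0// => i _.
by rewrite rnorm0 expr0n.
Qed.

Lemma monomial_coef n f : hdot f (iter n fS (hone R)) = f n.
Proof. by rewrite -hdot_iter_bshift hone_coef0 iter_bshiftE. Qed.

(* The orthogonal projections of the monomials onto the model space. *)
Fixpoint proj_mono n : hardy R :=
  if n is m.+1 then fS (proj_mono m) - (U n)^* *: U else hone R - (U 0%N)^* *: U.

Lemma orthoUS k : hdot U (iter k.+1 fS U) = 0.
Proof. by have := orthoS 0 k.+1. Qed.

(** At [k = 0] this is the inner product with [U] of the shifted projection, which the recursion of
    [proj_mono] has to remove; larger [k] serve the induction. *)
Lemma proj_mono_shift n k : hdot (proj_mono n) (iter k.+1 bX U) = (U (n + k.+1)%N)^*.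
Proof.
have oX j : hdot U (iter j.+1 bX U) = 0.
  by rewrite hdot_conj hdot_iter_bshift orthoUS rmorph0.
elim: n k => [|n IH] k; rewrite /proj_mono -/proj_mono linearBl /= linearZl_LR /= oX mulr0 subr0.
  by rewrite hdot_conj hone_coef0 -[bX _]/(iter k.+1 bX U) iter_bshiftE.
by rewrite -hdot_bshiftr -[bX _]/(iter k.+2 bX U) IH addSnnS.
Qed.

Lemma proj_mono_inK n : inK (proj_mono n).
Proof.
have oUU : hdot U U = 1 by have := orthoS 0 0.
elim: n => [|n IH] [|k]; rewrite /proj_mono -/proj_mono linearBl /= linearZl_LR /=.
- by rewrite oUU mulr1 hdot_conj hone_coef0 subrr.
- rewrite -[fS _]/(iter k.+1 fS U) orthoUS mulr0 subr0 -[iter k.+1 fS U]/(fS (iter k fS U)).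
  by rewrite hdot_conj hone_coef0 rmorph0.
- rewrite oUU mulr1 -hdot_bshiftr -[bX U]/(iter 1 bX U) proj_mono_shift addn1.
  by rewrite subrr.
- rewrite -[fS (iter k fS U)]/(iter k.+1 fS U) orthoUS mulr0 subr0.
  by rewrite -[iter k.+1 fS U]/(fS (iter k fS U)) -hdot_bshift bshiftK.
Qed.

Definition perp f := forall g, inK g -> hdot g f = 0.

Lemma sub_proj_mono_perp n : perp (iter n fS (hone R) - proj_mono n).
Proof.
move=> g gK; elim: n g gK => [|n IH] g gK.
  by rewrite /proj_mono opprB addrC subrK linearZr_LR /= (gK 0%N) mulr0.
have -> : iter n.+1 fS (hone R) - proj_mono n.+1 =
    fS (iter n fS (hone R) - proj_mono n) + (U n.+1)^* *: U.
  by rewrite fshiftB /proj_mono -/proj_mono opprB addrA addrAC.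
rewrite linearDr /= linearZr_LR /= (gK 0%N) mulr0 addr0 -hdot_bshift.
by apply: IH; exact: inKX.
Qed.

Definition pproj N f : hardy R := \sum_(n < N) f n *: proj_mono n.

Lemma pproj_inK N f : inK (pproj N f).
Proof. by apply: (@inK_sum N (fun n => f n *: proj_mono n)) => n; exact/inKZ/proj_mono_inK. Qed.

Lemma pproj_perp N f : perp (trunc N f - pproj N f).
Proof.
move=> g gK; rewrite /trunc /pproj -sumrB linear_sumr /= big1// => n _.
by rewrite -scalerBr linearZr_LR /= (sub_proj_mono_perp n gK) mulr0.
Qed.

Lemma hnorm_pyth f g : hdot f g = 0 -> rnorm f <= rnorm (f - g).
Proof.
move=> fg; have gf : hdot g f = 0 by rewrite hdot_conj fg rmorph0.
rewrite -(@ler_pXn2r _ 2)// ?nnegrE ?rnorm_ge0// -lecR -!hdotE.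
rewrite linearBl /= !linearBr /= fg gf sub0r opprK subr0 lerDl hdotE lecR.
by rewrite exprn_ge0// rnorm_ge0.
Qed.

(** The projection of a truncation is at least as close to [f] as the truncation, because [f] is
    already in the model space. *)
Lemma hlim_pproj f : inK f -> hlim (pproj ^~ f) f.
Proof.
move=> fK e e0; have [N hN] := hlim_trunc f e0; exists N => n /hN h.
apply: le_trans h; have -> : f - trunc n f = (f - pproj n f) - (trunc n f - pproj n f).
  by rewrite opprB addrA subrK.
by apply: hnorm_pyth; apply: pproj_perp; apply: inKB => //; exact: pproj_inK.
Qed.

Lemma hnorm_pproj N f : rnorm (pproj N f) <= rnorm (trunc N f).
Proof.
have -> : trunc N f = pproj N f - (- (trunc N f - pproj N f)).
  by rewrite opprK addrC subrK.
apply: hnorm_pyth; rewrite -scaleN1r linearZr_LR /= (pproj_perp N f) ?mulr0//.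
exact: pproj_inK.
Qed.

Section Kernel.
Variables (m : R[i]) (k : hardy R).
Hypothesis kE : forall n, k n = m ^+ n.

Lemma geo_shift : bX k = m *: k.
Proof. by apply: hardyP => n; rewrite bshiftE_coef coefZ !kE exprS. Qed.

Lemma hdot_geo f : hdot k f = (heval f m^*)^*.
Proof.
by rewrite hdot_conj (@heval_hdot _ _ _ k)// => n; rewrite kE conjCK.
Qed.

Lemma geo_decomp : rnorm m < 1 -> k - m *: fS k = hone R.
Proof.
move=> m1; apply: hardyP => -[|n]; rewrite coefD coefN coefZ kE fshiftE ?kE.
  by rewrite mulr0 subr0 expr0.
by rewrite exprS subrr.
Qed.

End Kernel.

Lemma pow_small (q C : R) : 0 <= q -> q < 1 -> forall e, 0 < e -> exists n : nat, C * q ^+ n <= e.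
Proof.
move=> q0 q1 e e0; have c : C * q ^+ n @[n --> \oo] --> (C * 0 : R).
  by apply: cvgMl_tmp; apply: cvg_expr; rewrite ger0_norm.
rewrite mulr0 in c; have /cvgrPdist_lt/(_ _ e0)[n _ /(_ n (leqnn n))] := c.
by rewrite /= sub0r normrN => h; exists n; apply: ltW; exact: le_lt_trans (ler_norm _) h.
Qed.

Lemma eq0_small (a : R[i]) : (forall e : R, 0 < e -> rnorm a <= e) -> a = 0.
Proof. by move=> h; apply: eq_vnorm_small => e /h; rewrite subr0. Qed.

Lemma hdot_geo_mul m v j : rnorm m < 1 -> v - m *: fS v = U -> hdot v (iter j fS U) = m ^+ j.
Proof.
move=> m1 hv; have vE : v = U + m *: fS v by rewrite -hv subrK.
have oX n : hdot U (iter n.+1 bX U) = 0.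
  by rewrite hdot_conj hdot_iter_bshift orthoUS rmorph0.
elim: j => [|j IH]; last first.
  have /= o := orthoUS j.
  by rewrite {1}vE linearDl /= linearZl_LR /= o add0r -hdot_bshift bshiftK IH exprS.
(* [v = U + m z v] is substituted repeatedly, [U] being orthogonal to every [X^(n+1) U]; since
   [|m| < 1], the inner product must vanish. *)
have b n : hdot v (iter 1 bX U) = m ^+ n * hdot v (iter n.+1 bX U).
  elim: n => [|n IH]; first by rewrite expr0 mul1r.
  have /= o := oX n; rewrite IH {1}vE linearDl /= linearZl_LR /= o add0r -hdot_bshiftr.
  by rewrite exprSr mulrA.
have b0 : hdot v (iter 1 bX U) = 0.
  apply: eq0_small => e e0.
  have [n hn] := pow_small (rnorm v) (rnorm_ge0 m) m1 e0.
  apply: le_trans hn; rewrite (b n) rnormM rnormX mulrC ler_wpM2r ?exprn_ge0 ?rnorm_ge0//.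
  apply: le_trans (hdot_CS _ _) _; rewrite -[leRHS]mulr1 ler_wpM2l ?rnorm_ge0//.
  by rewrite -hnormU; exact: hnorm_iter_bshift.
rewrite /= {1}vE linearDl /= linearZl_LR /= -hdot_bshiftr b0 mulr0 addr0 expr0.
exact: (orthoS 0 0).
Qed.

(* [k - u(w)^- v], where [v] is the product of [U] and the kernel [k] at [w], is the
   reproducing kernel of the model space; it is almost an eigenvector where [u] is small. *)
Lemma geo_proj m (k : hardy R) v : (forall n, k n = m ^+ n) -> rnorm m < 1 -> v - m *: fS v = U ->
  let f := k - (heval U m^*)^* *: v in
  inK f /\ m *: f - bX f = (heval U m^*)^* *: bX U.
Proof.
move=> kE m1 hv; have w1 : rnorm m^* < 1 by rewrite rnorm_conj.
split=> [j|].
  rewrite linearBl /= linearZl_LR /= (hdot_geo kE) (hdot_geo_mul _ m1 hv).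
  by rewrite heval_iter_fshift// rmorphM rmorphXn /= conjCK mulrC subrr.
set c := (heval U m^*)^*.
have -> : bX (k - c *: v) = m *: k - c *: (bX U + m *: v).
  rewrite bshiftB !bshiftZ (geo_shift kE); congr (_ - _ *: _).
  by rewrite -hv bshiftB bshiftZ bshiftK subrK.
by rewrite scalerBr opprB addrC addrA subrK scalerDr !scalerA [c * m]mulrC addrK.
Qed.

Definition resolvent m f g := inK g /\ m *: g - bX g = f.

Lemma shift_eigen m g : m *: g - bX g = 0 -> forall n, g n = m ^+ n * g 0%N.
Proof.
move=> /eqP; rewrite subr_eq0 => /eqP e; elim=> [|n IH]; first by rewrite mul1r.
by rewrite -bshiftE_coef -e coefZ IH exprS mulrA.
Qed.

(** [X^N g] tends to 0, whereas its zeroth coefficient [m^N * g 0] does not decrease in modulus. *)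
Lemma shift_eigen_ge1 m g : 1 <= rnorm m -> m *: g - bX g = 0 -> g = 0.
Proof.
move=> m1 /shift_eigen h; have g0 : g 0%N = 0.
  apply: eq0_small => e e0; have [N hN] := iter_bshift_cvg0 g e0.
  apply: le_trans (hN N (leqnn N)).
  apply: le_trans (coef_le_hnorm (iter N bX g) 0); rewrite iter_bshiftE add0n (h N).
  by rewrite rnormM rnormX ler_peMl ?rnorm_ge0// exprn_ege1.
by apply: hardyP => n; rewrite h g0 mulr0.
Qed.

(** So, when the right-hand side of the resolvent equation is in the model space, a solution [g] is
    there as soon as [hdot g U = 0]. *)
Lemma shift_corr m g : inK (m *: g - bX g) -> forall j, hdot g (iter j fS U) = m ^+ j * hdot g U.
Proof.
move=> h; elim=> [|j IH]; first by rewrite mul1r.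
have := h j; rewrite linearBl /= linearZl_LR /= hdot_bshift => /eqP.
rewrite subr_eq0 => /eqP e; transitivity (m * hdot g (iter j fS U)); first exact: esym e.
by rewrite IH exprS mulrA.
Qed.

Lemma resolvent_outer m f : 1 < rnorm m -> inK f -> exists g, resolvent m f g.
Proof.
move=> m1 fK; have m0 : m != 0 by rewrite -rnorm_gt0 (lt_trans ltr01).
have i1 : rnorm m^-1 < 1 by rewrite rnormV invf_lt1// (lt_trans ltr01).
have [g hg] : exists g, g - m^-1 *: bX g = m^-1 *: f.
  apply: (@neumann R (fun g => m^-1 *: bX g) (rnorm m^-1)) => //; last first.
  - move=> g; rewrite vnormZ ler_wpM2l ?rnorm_ge0//; exact: hnorm_bshift.
  - exact: rnorm_ge0.
  - by move=> a x y; rewrite bshiftD bshiftZ scalerDr !scalerA mulrC.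
have e : m *: g - bX g = f.
  by rewrite -[RHS]scale1r -(mulfV m0) -scalerA -hg scalerBr scalerA mulfV// scale1r.
exists g; split=> // j; have hc := shift_corr (m := m) (g := g); rewrite e in hc.
(* [m^N <g, U> = <X^N g, U>] tends to 0 while [|m|^N >= 1]. *)
rewrite hc//; suff -> : hdot g U = 0 by rewrite mulr0.
apply: eq0_small => eps e0; have [N hN] := iter_bshift_cvg0 g e0.
apply: le_trans (hN N (leqnn N)).
have := hdot_CS (iter N bX g) U; rewrite hnormU mulr1 hdot_iter_bshift hc//.
by apply: le_trans; rewrite rnormM rnormX ler_peMl ?rnorm_ge0// exprn_ege1// ltW.
Qed.

Lemma resolvent_outer_bound m g : (rnorm m - 1) * rnorm g <= rnorm (m *: g - bX g).
Proof.
apply: le_trans (vnorm_sub_le _ _); rewrite vnormZ mulrBl mul1r lerB//.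
exact: hnorm_bshift.
Qed.

Lemma geo_mul_exists m f : rnorm m < 1 ->
  exists2 v, v - m *: fS v = f & rnorm v <= rnorm f / (1 - rnorm m).
Proof.
move=> m1; have [v hv] : exists v, v - m *: fS v = f.
  apply: (@neumann R (fun g => m *: fS g) (rnorm m)) => //; last first.
  - by move=> g; rewrite vnormZ hnorm_fshift.
  - exact: rnorm_ge0.
  - by move=> a x y; rewrite fshiftD fshiftZ scalerDr !scalerA mulrC.
exists v => //; rewrite ler_pdivlMr ?subr_gt0// mulrC mulrBl mul1r -hv.
by apply: le_trans (vnorm_sub_le _ _); rewrite vnormZ hnorm_fshift.
Qed.

(** With [v = f / (1 - m z)], the function [- z v] is a particular solution and [k = 1 / (1 - m z)]
    an eigenvector of [X] in H^2, so [c] is free. *)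
Lemma shift_solution m (k : hardy R) v f c : (forall n, k n = m ^+ n) -> v - m *: fS v = f ->
  m *: (c *: k - fS v) - bX (c *: k - fS v) = f.
Proof.
move=> kE <-; have -> : bX (c *: k - fS v) = c *: (m *: k) - v.
  by rewrite bshiftB !bshiftZ bshiftK (geo_shift kE).
by rewrite scalerBr !scalerA [c * m]mulrC opprB addrC addrA subrK.
Qed.

Lemma resolvent_inner_inK m (k : hardy R) v f c : (forall n, k n = m ^+ n) -> inK f ->
  v - m *: fS v = f -> c * hdot k U = hdot (fS v) U -> resolvent m f (c *: k - fS v).
Proof.
move=> kE fK hv hc; have e := shift_solution c kE hv; split=> // j.
have := shift_corr (m := m) (g := c *: k - fS v); rewrite e => /(_ fK j) ->.
by rewrite linearBl /= linearZl_LR /= hc subrr mulr0.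
Qed.

(** By [shift_corr] only the inner product with [U] has to be removed, and [c] can do so because
    [<k, U>] is the conjugate of [u(conj m)]. The norms of [v] and [k] give one factor
    [1 / (1 - |m|)] each. *)
Lemma resolvent_inner m f : rnorm m < 1 -> heval U m^* != 0 -> inK f ->
  exists2 g, resolvent m f g &
    rnorm g <= rnorm f * (1 + (rnorm (heval U m^*))^-1) / (1 - rnorm m) ^+ 2.
Proof.
move=> m1 u0 fK; have [k kE kn] := geo_exists m1.
have [v hv vn] := geo_mul_exists f m1.
have kU : hdot k U = (heval U m^*)^* by exact: hdot_geo.
have kU0 : hdot k U != 0 by rewrite kU -rnorm_eq0 rnorm_conj rnorm_eq0.
pose c := hdot (fS v) U / hdot k U.
exists (c *: k - fS v); first by apply: resolvent_inner_inK => //; rewrite divfK.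
set d := 1 - rnorm m in kn vn *; set b := rnorm (heval U m^*).
have d0 : 0 < d by rewrite subr_gt0.
have d1 : d <= 1 by rewrite lerBlDr lerDl rnorm_ge0.
have b0 : 0 < b by rewrite rnorm_gt0.
have cn : rnorm c <= rnorm f / d / b.
  rewrite rnormM rnormV kU rnorm_conj -/b ler_wpM2r ?invr_ge0 ?rnorm_ge0//.
  by apply: le_trans (hdot_CS _ _) _; rewrite hnormU mulr1 hnorm_fshift.
apply: le_trans (vnorm_le_sub _ _) _; rewrite vnormZ hnorm_fshift.
have f0 := rnorm_ge0 f.
apply: (@le_trans _ _ (rnorm f / d / b * d^-1 + rnorm f / d)).
  by apply: lerD => //; apply: ler_pM => //; exact: rnorm_ge0.
have fd : rnorm f / d <= rnorm f / d ^+ 2.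
  rewrite ler_wpM2l// lef_pV2 ?posrE ?exprn_gt0// expr2 -[leRHS]mulr1.
  by rewrite ler_wpM2l// ltW.
apply: (@le_trans _ _ (rnorm f / d / b * d^-1 + rnorm f / d ^+ 2)); first by rewrite lerD2l.
rewrite le_eqVlt; apply/orP; left; apply/eqP; move: (rnorm f) => t.
by field; rewrite !gt_eqF.
Qed.

(** The points where the resolvent equation is solved by a convergent series; on the circle
    [1 / (1 - m z)] is not in H^2. *)
Definition regular m := 1 < rnorm m \/ (rnorm m < 1 /\ heval U m^* != 0).

Lemma resolvent_exists m f : regular m -> inK f -> exists g, resolvent m f g.
Proof.
move=> [m1|[m1 u0]] fK; first exact: resolvent_outer.
by have [g hg _] := resolvent_inner m1 u0 fK; exists g.
Qed.

Lemma resolvent_inj m g : regular m -> inK g -> m *: g - bX g = 0 -> g = 0.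
Proof.
move=> [m1|[m1 u0]] gK e; first by apply: (shift_eigen_ge1 _ e); exact: ltW.
have [k kE _] := geo_exists m1; have h := shift_eigen e.
have gk : g = g 0%N *: k by apply: hardyP => n; rewrite coefZ kE h mulrC.
have := gK 0%N; rewrite {1}gk /= linearZl_LR /= (hdot_geo kE) => /eqP.
rewrite mulf_eq0 -[(_)^* == 0]rnorm_eq0 rnorm_conj rnorm_eq0 (negbTE u0) orbF => /eqP g0.
by rewrite gk g0 scale0r.
Qed.

Lemma resolvent_uniq m f g h : regular m -> resolvent m f g -> resolvent m f h -> g = h.
Proof.
move=> rm [gK eg] [hK eh]; apply/eqP; rewrite -subr_eq0; apply/eqP.
apply: (resolvent_inj rm); first exact: inKB.
have e : - (m *: h) + bX h = - f by rewrite -eh opprB addrC.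
by rewrite bshiftB scalerBr opprD opprK addrACA eg e subrr.
Qed.

End ModelTheory.

(** * The scalar resolvent function and its reflection formula *)

Section ResolventFunction.
Variables (R : realType) (U : hardy R).
Hypothesis orthoU : forall k : nat, hdot (iter k (@bshift R) U) U = (k == 0%N)%:R.
Implicit Types (f g : hardy R) (c m : R[i]).
Notation bX := (@bshift R).

(** The zeroth coefficient is enough: the one of index [k] is obtained by replacing [f] with
    [X^k f]. The default 0 is taken where the equation has no solution. *)
Definition resF f m : R[i] := (xget 0 [set g | resolvent U m f g] : hardy R) 0%N.

Lemma resFE f m g : regular U m -> resolvent U m f g -> resF f m = g 0%N.
Proof.
move=> rm hg; rewrite /resF; case: xgetP => [h _ hh|/(_ g)/(_ hg)//].
by rewrite (resolvent_uniq rm hh hg).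
Qed.

Lemma resolventD m f1 f2 g1 g2 : resolvent U m f1 g1 -> resolvent U m f2 g2 ->
  resolvent U m (f1 + f2) (g1 + g2).
Proof.
move=> [k1 <-] [k2 <-]; split; first exact: inKD.
by rewrite bshiftD scalerDr opprD addrACA.
Qed.

Lemma resolventZ m c f g : resolvent U m f g -> resolvent U m (c *: f) (c *: g).
Proof.
move=> [k <-]; split; first exact: inKZ.
by rewrite bshiftZ scalerBr !scalerA mulrC.
Qed.

Lemma resolventX m f g : resolvent U m f g -> resolvent U m (bX f) (bX g).
Proof. by move=> [k <-]; split; [exact: inKX|rewrite bshiftB bshiftZ]. Qed.

Lemma resF_D f1 f2 m : regular U m -> inK U f1 -> inK U f2 ->
  resF (f1 + f2) m = resF f1 m + resF f2 m.
Proof.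
move=> rm /(resolvent_exists orthoU rm)[g1 h1] /(resolvent_exists orthoU rm)[g2 h2].
by rewrite (resFE rm h1) (resFE rm h2) (resFE rm (resolventD h1 h2)).
Qed.

Lemma resF_Z c f m : regular U m -> inK U f -> resF (c *: f) m = c * resF f m.
Proof.
move=> rm /(resolvent_exists orthoU rm)[g h].
by rewrite (resFE rm h) (resFE rm (resolventZ c h)).
Qed.

Lemma resF_X f m : regular U m -> inK U f -> resF (bX f) m = m * resF f m - f 0%N.
Proof.
move=> rm /(resolvent_exists orthoU rm)[g h].
rewrite (resFE rm h) (resFE rm (resolventX h)); case: h => _ <-.
by rewrite coefD coefN coefZ opprB addrC subrK.
Qed.

(** The pseudocontinuation of [m |-> u(1/m)] into the disk: on the circle [1/m] is the conjugate of
    [m], and [1 / conj u = u] where [|u| = 1]. *)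
Definition inner_ext m : R[i] :=
  if rnorm m < 1 then (heval U m^*)^*^-1 else heval U m^-1.

Lemma inK_shiftU : inK U (bX U).
Proof. by move=> j; rewrite hdot_bshift -[fshift _]/(iter j.+1 (@fshift R) U) orthoUS. Qed.

Lemma resF_shiftU m : regular U m -> resF (bX U) m = inner_ext m - U 0%N.
Proof.
move=> rm; case: (rm) => [m1|[m1 u0]]; rewrite /inner_ext.
  have m0 : m != 0 by rewrite -rnorm_gt0 (lt_trans ltr01).
  have i1 : rnorm m^-1 < 1 by rewrite rnormV invf_lt1// (lt_trans ltr01).
  rewrite ltNge (ltW m1) /=.
  have [g hg] := resolvent_exists orthoU rm inK_shiftU; rewrite (resFE rm hg).
  (* At the point [1/m] the equation reads [m g(0) = (X U)(1/m)], and the right side is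
     [m (U(1/m) - U(0))]. *)
  case: hg => _ /(congr1 (fun f => heval f m^-1)).
  rewrite -scaleN1r hevalD// !hevalZ// (heval_split g)// (heval_split U)//.
  rewrite mulrDr mulrA mulfV// mul1r mulN1r addrK => /(congr1 (fun x => m^-1 * x)).
  by rewrite mulKf// => ->; rewrite addrC addKr.
have [k kE kn] := geo_exists m1.
have [v hv _] := geo_mul_exists (bX U) m1.
have [w hw _] := geo_mul_exists U m1.
have kU : hdot k U = (heval U m^*)^* by exact: hdot_geo.
have kU0 : hdot k U != 0 by rewrite kU -rnorm_eq0 rnorm_conj rnorm_eq0.
have wU : hdot w U = 1 by have := hdot_geo_mul orthoU 0 m1 hw.
(* This is [z X U = U - U(0)] divided by [1 - m z]: the difference [d] of the two sides satisfies
   [d = m z d] with [|m| < 1], so it is 0. *)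
have e : fshift v = w - U 0%N *: k.
  apply/eqP; rewrite -subr_eq0; apply/eqP; set d := _ - _.
  have hd : d - m *: fshift d = 0.
    rewrite /d 2!fshiftB fshiftZ !scalerBr.
    have -> : m *: fshift (fshift v) = fshift v - fshift (bX U).
      by rewrite -hv fshiftB fshiftZ opprB addrC subrK.
    have -> : m *: fshift w = w - U by rewrite -hw opprB addrC subrK.
    rewrite scalerA [m * _]mulrC -scalerA.
    have -> : m *: fshift k = k - hone R by rewrite -(geo_decomp kE m1) opprB addrC subrK.
    have -> : fshift (bX U) = U - U 0%N *: hone R.
      by rewrite -[LHS]/(iter 1 (@fshift R) (iter 1 bX U)) -sub_trunc /trunc big_ord1.
    rewrite scalerBr; have alg (a b q p h : R[i]) :
        a - (b - q) - (a - (p - h) - (b - p - (q - h))) = 0 by ring.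
    by apply: hardyP => n; exact: alg.
  have d1 : rnorm d * (1 - rnorm m) <= 0.
    rewrite mulrBr mulr1 subr_le0.
    move/eqP: hd; rewrite subr_eq0 => /eqP {1}->.
    by rewrite vnormZ hnorm_fshift mulrC.
  rewrite pmulr_lle0 ?subr_gt0// in d1.
  by apply/eqP; rewrite -vnorm_eq0 eq_le d1 rnorm_ge0.
pose c := hdot (fshift v) U / hdot k U.
have hg : resolvent U m (bX U) (c *: k - fshift v).
  by apply: resolvent_inner_inK => //; [exact: inK_shiftU|rewrite divfK].
rewrite m1 (resFE rm hg) coefD coefN coefZ kE /= expr0 mulr1 subr0 /c e.
by rewrite linearBl /= linearZl_LR /= wU mulrBl mulfK// kU div1r.
Qed.

(** * Functions whose boundary values match across an arc *)

Section Good.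
Variables (tau A M delta : R).
Hypotheses (A0 : 0 < A) (delta0 : 0 < delta).
Hypothesis UM : forall z, rnorm z < 1 -> rnorm (heval U z) <= M.
Hypothesis Uhol : forall z, rnorm z < 1 -> hol (heval U) z.
Hypothesis Udelta : forall x y, 0 < x < A -> `|y - tau| < A ->
  delta <= rnorm (heval U (cexp (pt (- x) y))).
Hypothesis Uae : {ae (@lebesgue_measure R), forall t : R,
  (fun r => rnorm (heval U (cpt r t))) @ (1 : R)^'- --> (1 : R)}.
Implicit Types (G H : R[i] -> R[i]) (z : R[i]).

(** Two half-boxes, on either side of [Re z = 0]; [Emap] sends the right one into the disk. *)
Definition Omega z :=
  [/\ complex.Re z != 0, `|complex.Re z| < A & `|complex.Im z - tau| < A].

(* The conjugate of [Emap (x + i y)] is [exp (- x + i y)], so that the line [Re z = 0]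
   is mapped to the unit circle. *)
Definition Emap z : R[i] := cexp (- z).

(** What [Rint_crossing] asks of an integrand, apart from continuity on the horizontal edges, which
    the weight supplies later. Boundedness is what makes the class stable under products. *)
Record good G : Prop := Good {
  good_bound : exists K, forall z, Omega z -> rnorm (G z) <= K;
  good_hol : forall z, Omega z -> hol G z;
  good_ae : {ae (@lebesgue_measure R), forall y : R, `|y - tau| < A ->
    (fun e : R => G (pt e y) - G (pt (- e) y)) @ (0 : R)^'+ --> (0 : R[i])} }.

Lemma Omega_near z : Omega z -> \forall w \near z, Omega w.
Proof.
move=> [z0 zA zt]; apply/near_atP.
exists (Num.min `|complex.Re z| (Num.min (A - `|complex.Re z|) (A - `|complex.Im z - tau|))).
  by rewrite !lt_min normr_gt0 z0 !subr_gt0 zA.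
move=> w; rewrite !lt_min => /and3P[h1 h2 h3].
have r1 : `|complex.Re z - complex.Re w| <= rnorm (z - w).
  by rewrite -raddfB; exact: Re_le_rnorm.
have r2 : `|complex.Im z - complex.Im w| <= rnorm (z - w).
  by rewrite -raddfB; exact: Im_le_rnorm.
split.
- apply: contraTneq h1 => w0; rewrite -leNgt; apply: le_trans r1.
  by rewrite w0 subr0.
- have := ler_normB (complex.Re z) (complex.Re z - complex.Re w).
  rewrite opprB addrC subrK; lra.
- have := ler_normB (complex.Im z - tau) (complex.Im z - complex.Im w).
  have -> : complex.Im z - tau - (complex.Im z - complex.Im w) = complex.Im w - tau by ring.
  lra.
Qed.

Lemma Omega_e y (e : R) : 0 < e < A -> `|y - tau| < A -> Omega (pt e y) /\ Omega (pt (- e) y).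
Proof.
move=> /andP[e0 eA] yt; split; split=> //=; rewrite ?oppr_eq0 ?gt_eqF// ?normrN;
  by rewrite ger0_norm// ltW.
Qed.

Lemma near_e : \forall e \near (0 : R)^'+, 0 < e < A.
Proof.
near=> e; apply/andP; split.
  by near: e; exact: nbhs_right_gt.
by near: e; exact: nbhs_right_lt.
Unshelve. all: by end_near. Qed.

Let aeF : Filter (almost_everywhere (@lebesgue_measure R)) := ae_filter_ringOfSetsType _.

Lemma good_ext G H : (forall z, Omega z -> G z = H z) -> good H -> good G.
Proof.
have FA := aeF; move=> GH [[K bH] hH aH]; split.
- by exists K => z zO; rewrite GH// bH.
- move=> z zO; apply: (@hol_near _ _ H); last exact: hH.
  by apply: filterS (Omega_near zO) => w /GH.
- apply: filterS aH => y h yt; have /cvgCP k := h yt; apply/cvgCP => e e0.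
  apply: filterS2 near_e (k e e0) => s s1.
  by have [om1 om2] := Omega_e s1 yt; rewrite !GH.
Qed.

Lemma good_cst (k : R[i]) : good (fun=> k).
Proof.
have FA := aeF; split; [by exists (rnorm k)|by move=> *; exact: hol_cst|].
by apply: filterE => y _; under eq_fun do rewrite subrr; exact: cvg_cst.
Qed.

Lemma goodD G H : good G -> good H -> good (fun z => G z + H z).
Proof.
have FA := aeF; move=> [[K bG] hG aG] [[L bH] hH aH]; split.
- exists (K + L) => z zO; apply: le_trans (rnormD _ _) _.
  by apply: lerD; [exact: bG|exact: bH].
- by move=> z zO; apply: holD; [exact: hG|exact: hH].
- apply: filterS2 aG aH => y h k yt.
  have -> : (fun e : R => G (pt e y) + H (pt e y) - (G (pt (- e) y) + H (pt (- e) y))) =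
      (fun e => (G (pt e y) - G (pt (- e) y)) + (H (pt e y) - H (pt (- e) y))).
    by apply/funext => e; ring.
  by rewrite -(addr0 (0 : R[i])); exact: (cvgCD (h yt) (k yt)).
Qed.

Lemma goodM G H : good G -> good H -> good (fun z => G z * H z).
Proof.
have FA := aeF; move=> [[K bG] hG aG] [[L bH] hH aH]; split.
- exists (K * L) => z zO; rewrite rnormM; apply: ler_pM; rewrite ?rnorm_ge0//.
    exact: bG.
  exact: bH.
- by move=> z zO; apply: holM; [exact: hG|exact: hH].
- apply: filterS2 aG aH => y h k yt.
  apply: (@cvgC_squeeze _ _ _ _ (fun e : R => K * rnorm (H (pt e y) - H (pt (- e) y)) +
      L * rnorm (G (pt e y) - G (pt (- e) y)))).
    apply: filterS near_e => e e1; have [om1 om2] := Omega_e e1 yt; rewrite subr0.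
    have -> : G (pt e y) * H (pt e y) - G (pt (- e) y) * H (pt (- e) y) =
        G (pt e y) * (H (pt e y) - H (pt (- e) y)) +
        H (pt (- e) y) * (G (pt e y) - G (pt (- e) y)) by ring.
    apply: le_trans (rnormD _ _) _; rewrite !rnormM.
    by apply: lerD; apply: ler_wpM2r; rewrite ?rnorm_ge0//; [exact: bG|exact: bH].
  have c1 := cvg_rnorm (h yt); have c2 := cvg_rnorm (k yt).
  rewrite rnorm0 in c1 c2.
  have : K * rnorm (H (pt e y) - H (pt (- e) y)) + L * rnorm (G (pt e y) - G (pt (- e) y))
      @[e --> (0 : R)^'+] --> (K * 0 + L * 0 : R).
    by apply: cvgD; apply: cvgMl_tmp; [exact: c2|exact: c1].
  by rewrite !mulr0 addr0.
Qed.

Lemma good_sum N (F : nat -> R[i] -> R[i]) : (forall n, good (F n)) ->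
  good (fun z => \sum_(n < N) F n z).
Proof.
move=> h; elim: N => [|N IH].
  by apply: good_ext (good_cst 0) => z _; rewrite big_ord0.
by apply: good_ext (goodD IH (h N)) => z _; rewrite big_ord_recr.
Qed.

Lemma goodZ c G : good G -> good (fun z => c * G z).
Proof. by move=> h; apply: goodM h; exact: good_cst. Qed.

(** The height [tau], a null set, is exempt for the sake of [Qmap], a difference quotient at
    [pt 0 tau]. *)
Lemma good_continuous G K : (forall z, Omega z -> rnorm (G z) <= K) ->
  (forall z, Omega z -> hol G z) ->
  (forall y, `|y - tau| < A -> y != tau -> tends G (pt 0 y) (G (pt 0 y))) -> good G.
Proof.
have FA := aeF; move=> bG hG tG; split=> //; first by exists K.
have : {ae (@lebesgue_measure R), forall y : R, y != tau}.
  exists [set tau]; split; [exact: measurable_set1|exact: lebesgue_measure_set1|].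
  by move=> y /= /negP; rewrite negbK => /eqP.
apply: filterS => y yt yA; have := cross_tends (tG y yA yt).
by under eq_fun do rewrite add0r sub0r.
Qed.

Lemma Emap_bound z : A <= 1 -> Omega z -> rnorm (Emap z) <= expR 1 /\ rnorm (cexp z) <= expR 1.
Proof.
move=> A1 [_ zA _]; rewrite !rnorm_cexp !ler_expR raddfN /=.
have := ler_norm (complex.Re z); have := ler_norm (- complex.Re z); rewrite normrN.
by move=> h1 h2; split; lra.
Qed.

Lemma hol_Emap z : hol Emap z.
Proof.
by apply: (@hol_comp _ (@cexp R) (fun z => - z)); [apply: holN; exact: hol_id|exact: hol_cexp].
Qed.

Lemma good_Emap : A <= 1 -> good Emap /\ good (@cexp R).
Proof.
move=> A1; split; apply: (@good_continuous _ (expR 1)) => [z /(Emap_bound A1)[]//|z _|y _ _].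
- exact: hol_Emap.
- exact: hol_tends (hol_Emap _).
- exact: hol_cexp.
- exact: hol_tends (hol_cexp _).
Qed.

Lemma Emap_pt x y : Emap (pt x y) = cexp (pt (- x) (- y)). Proof. by []. Qed.

Lemma Emap_conj x y : (Emap (pt x y))^* = cexp (pt (- x) y).
Proof.
rewrite Emap_pt /cexp /= rmorphM /= expiN conjCK; congr (_ * _).
by rewrite -[LHS]/((expR (- x) +i* - 0)%C) oppr0.
Qed.

Lemma Emap_inv z : (Emap z)^-1 = cexp z.
Proof.
apply: (mulfI (cexp_neq0 (- z))); rewrite mulfV ?cexp_neq0//.
by rewrite -cexpD addNr cexp0.
Qed.

Lemma Emap_case z : Omega z ->
  (complex.Re z < 0 /\ 1 < rnorm (Emap z)) \/
  [/\ 0 < complex.Re z, rnorm (Emap z) < 1 & delta <= rnorm (heval U (Emap z)^*)].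
Proof.
case: z => x y [/= x0 xA yA]; rewrite -[(x +i* y)%C]/(pt x y) rnorm_cexp /=.
case: (ltP x 0) => [xn|xp]; [left|right].
  by split=> //; rewrite -expR0 ltr_expR oppr_gt0.
have xp' : 0 < x by rewrite lt_neqAle eq_sym x0.
split=> //; first by rewrite -expR0 ltr_expR oppr_lt0.
rewrite Emap_conj; apply: Udelta => //; rewrite xp' /=.
by rewrite ger0_norm in xA.
Qed.

Lemma regular_Emap z : Omega z -> regular U (Emap z).
Proof.
move=> /Emap_case[[_ h]|[_ h k]]; [by left|right; split=> //].
by rewrite -rnorm_gt0; exact: lt_le_trans delta0 k.
Qed.

Lemma hol_conj H z : hol H z^* -> hol (fun w => (H w^*)^*) z.
Proof.
move=> [p /tendsP pz /near_atP[d d0 ep]]; apply: (@Hol _ _ _ (fun w => (p w^*)^*)).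
  apply/tendsP => e e0; have [d' d'0 h] := pz e e0; exists d' => // w wz.
  by rewrite -rmorphB rnorm_conj; apply: h; rewrite -rmorphB rnorm_conj.
apply/near_atP; exists d => // w wz; rewrite ep; last by rewrite -rmorphB rnorm_conj.
by rewrite rmorphD rmorphM rmorphB /= !conjCK.
Qed.

Lemma good_inner_ext : good (fun z => inner_ext (Emap z)).
Proof.
have M0 : 0 <= M by apply: le_trans (rnorm_ge0 _) (UM (z := 0) _); rewrite rnorm0.
have d1 : 0 <= delta^-1 by rewrite invr_ge0 ltW.
have FA := aeF.
split.
- exists (M + delta^-1) => z /Emap_case[[_ h]|[_ h k]]; rewrite /inner_ext.
    rewrite ltNge (ltW h) /=; apply: le_trans (UM _) _; last by rewrite lerDl.
    by rewrite rnormV invf_lt1// (lt_trans ltr01).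
  rewrite h rnormV rnorm_conj; apply: (@le_trans _ _ delta^-1); last by rewrite lerDr.
  by rewrite lef_pV2 ?posrE// (lt_le_trans delta0).
- move=> z zO; have tE := tends_cvg (hol_tends (hol_Emap z)).
  case: (Emap_case zO) => [[_ h]|[_ h k]].
    have h' : rnorm (Emap z)^-1 < 1 by rewrite rnormV invf_lt1// (lt_trans ltr01).
    apply: (@hol_near _ _ (fun w => heval U (cexp w))); last first.
      by apply: hol_comp; [exact: hol_cexp|apply: Uhol; rewrite -Emap_inv].
    have /tendsP/(_ (rnorm (Emap z) - 1))[|r r0 hr] := hol_tends (hol_Emap z).
      by rewrite subr_gt0.
    apply/near_atP; exists r => // w /hr hw; rewrite /inner_ext -Emap_inv ltNge.
    suff -> : 1 <= rnorm (Emap w) by [].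
    have := rnorm_sub_le (Emap z) (Emap w); move: hw; lra.
  apply: (@hol_near _ _ (fun w => (heval U (Emap w)^*)^*^-1)); last first.
    apply: (@holV _ (fun w => (heval U (Emap w)^*)^*)); last first.
      by rewrite -rnorm_eq0 rnorm_conj gt_eqF// (lt_le_trans delta0).
    apply: (@hol_comp _ (fun m => (heval U m^*)^*)); first exact: hol_Emap.
    by apply: hol_conj; apply: Uhol; rewrite rnorm_conj.
  have /tendsP/(_ (1 - rnorm (Emap z)))[|r r0 hr] := hol_tends (hol_Emap z).
    by rewrite subr_gt0.
  apply/near_atP; exists r => // w /hr; rewrite rnormB => hw; rewrite /inner_ext.
  suff -> : rnorm (Emap w) < 1 by [].
  have := rnorm_sub_le (Emap w) (Emap z); move: hw; lra.
- apply: filterS Uae => y hy yA.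
  have hlim : (fun e : R => rnorm (heval U (cpt (expR (- e)) y))) @ (0 : R)^'+ --> (1 : R).
    apply: cvg_comp hy => B [r /= r0 hB].
    have c : expR (- e) @[e --> (0 : R)] --> expR (- 0 : R).
      have cN : - e @[e --> (0 : R)] --> (- 0 : R) by apply: cvgN; exact: cvg_id.
      exact: (cvg_comp _ _ cN (@continuous_expR R (- 0))).
    rewrite oppr0 expR0 in c; have /cvgrPdist_lt/(_ _ r0)[s /= s0 hs] := c.
    exists s => //= e es e0; apply: hB; first exact: hs.
    by rewrite -expR0 ltr_expR oppr_lt0.
  (* The jump is [(1 - |a|^2) / conj a], where [a] is the value of [U] on the inner side; [|a|]
     tends to 1 and is at least [delta]. *)
  apply: (@cvgC_squeeze _ _ _ _
      (fun e : R => `|rnorm (heval U (cpt (expR (- e)) y)) ^+ 2 - 1| / delta)).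
    apply: filterS near_e => e e1; have [om1 om2] := Omega_e e1 yA.
    have /andP[e0 eA] := e1.
    have wE : cexp (pt (- e) y) = cpt (expR (- e)) y by [].
    have k1 : delta <= rnorm (heval U (cpt (expR (- e)) y)) by rewrite -wE; exact: Udelta.
    have u0 : (heval U (cpt (expR (- e)) y))^* != 0.
      by rewrite -rnorm_eq0 rnorm_conj gt_eqF// (lt_le_trans delta0).
    have -> : inner_ext (Emap (pt e y)) = (heval U (cpt (expR (- e)) y))^*^-1.
      rewrite /inner_ext Emap_conj wE rnorm_cexp /= ifT// -expR0 ltr_expR.
      by rewrite oppr_lt0.
    have -> : inner_ext (Emap (pt (- e) y)) = heval U (cpt (expR (- e)) y).
      rewrite /inner_ext Emap_inv wE rnorm_cexp /= opprK ifF//.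
      by apply/negbTE; rewrite -leNgt -expR0 ler_expR ltW.
    set a := heval U _ in k1 u0 *; rewrite subr0.
    have -> : a^*^-1 - a = (1 - a * a^*) / a^* by rewrite mulrBl mul1r mulfK.
    rewrite -rnorm_sqr -(rmorph1 (real_complex R)) -rmorphB /= rnormM rnormR rnormV rnorm_conj.
    rewrite distrC ler_wpM2l// lef_pV2 ?posrE//; exact: lt_le_trans delta0 k1.
  have c2 : rnorm (heval U (cpt (expR (- e)) y)) ^+ 2 - 1 @[e --> (0 : R)^'+] --> (1 * 1 - 1 : R).
    apply: cvgB; last exact: cvg_cst.
    by under eq_fun do rewrite expr2; exact: cvgM.
  have c3 : `|rnorm (heval U (cpt (expR (- e)) y)) ^+ 2 - 1| / delta
      @[e --> (0 : R)^'+] --> (`|1 * 1 - 1| / delta : R).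
    by apply: cvgMr_tmp; apply: cvg_norm.
  by rewrite mulr1 subrr normr0 mul0r in c3.
Qed.

Definition good_resF f := inK U f /\ good (fun z => resF f (Emap z)).

Lemma good_resFD f g : good_resF f -> good_resF g -> good_resF (f + g).
Proof.
move=> [k1 h1] [k2 h2]; split; first exact: inKD.
by apply: good_ext (goodD h1 h2) => z zO; apply: resF_D => //; exact: regular_Emap.
Qed.

Lemma good_resFZ c f : good_resF f -> good_resF (c *: f).
Proof.
move=> [k1 h1]; split; first exact: inKZ.
by apply: good_ext (goodZ c h1) => z zO; apply: resF_Z => //; exact: regular_Emap.
Qed.

Hypothesis A1 : A <= 1.

(** [F_(X f)(m) = m F_f(m) - f(0)] is solved for [F_f]; the factor [1/m] is [cexp z], which is
    good. *)
Lemma good_resF_unshift f : inK U f -> good_resF (bX f) -> good_resF f.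
Proof.
move=> fK [_ h]; split=> //; have [_ gE] := good_Emap A1.
apply: good_ext (goodM gE (goodD h (good_cst (f 0%N)))) => z zO.
rewrite (resF_X (regular_Emap zO) fK) subrK -Emap_inv mulKf//; exact: cexp_neq0.
Qed.

Lemma good_resFX f : good_resF f -> good_resF (bX f).
Proof.
move=> [fK h]; split; first exact: inKX.
have [gE _] := good_Emap A1.
apply: good_ext (goodD (goodM gE h) (good_cst (- f 0%N))) => z zO.
exact: resF_X (regular_Emap zO) fK.
Qed.

Lemma good_resF_shiftU : good_resF (bX U).
Proof.
split; first exact: inK_shiftU.
apply: good_ext (goodD good_inner_ext (good_cst (- U 0%N))) => z zO.
exact: resF_shiftU (regular_Emap zO).
Qed.

(** [X] sends the projection of 1 to a multiple of [X U], and that of [z^(n+1)] to that of [z^n]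
    plus a multiple of [X U]; undoing [X] gives the induction. *)
Lemma good_proj_mono n : good_resF (proj_mono U n).
Proof.
elim: n => [|n IH]; (apply: good_resF_unshift; first exact: proj_mono_inK);
  rewrite /proj_mono -/proj_mono bshiftB bshiftZ.
  have -> : bX (hone R) = 0 by exact: hardyP.
  by rewrite sub0r -scaleNr; exact: (good_resFZ (- (U 0%N)^*) good_resF_shiftU).
have h := good_resFZ (- (U n.+1)^*) good_resF_shiftU.
by rewrite bshiftK -[- (_ *: bX U)]scaleNr; exact: (good_resFD IH h).
Qed.

Lemma good_pproj N f : good_resF (pproj U N f).
Proof.
rewrite /pproj; elim: N => [|N IH].
  by rewrite big_ord0 -(scale0r (proj_mono U 0)); exact: (good_resFZ 0 (good_proj_mono 0)).
by rewrite big_ord_recr; exact: (good_resFD IH (good_resFZ (f N) (good_proj_mono N))).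
Qed.

Lemma good_resF_iter n f : good_resF f -> good_resF (iter n bX f).
Proof. by move=> h; elim: n => [//|n IH]; exact: good_resFX. Qed.

End Good.
End ResolventFunction.

(** * The weight and its contour integral *)

Section RegularPoint.
Variable R : realType.
Implicit Types (a b c d t : R) (F : R -> R[i]).

Lemma Re_Cint_ge a b F c : a <= b -> contin_on a b F ->
  (forall t, a <= t <= b -> c <= complex.Re (F t)) -> (b - a) * c <= complex.Re (Cint a b F).
Proof.
move=> ab cF h.
have -> : (b - a) * c = complex.Re (Cint a b (fun=> c%:C%C)) by rewrite Cint_cst//; simpc.
rewrite !Rint_ReE//; last exact: contin_on_cst.
by apply: (le_Rintegral _ (contin_on_intRe (contin_on_cst a b c%:C%C)) (contin_on_intRe cF)) => //.
Qed.

(** Joining opposite edges turns the integral into [i] times two integrals of [2 a / (t^2 + a^2)],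
    which is at least [1 / a] on a segment of length [2 a]; each is thus at least 2. *)
Lemma Rint_inv_neq0 a tau : 0 < a ->
  Rint (fun z => (z - pt 0 tau)^-1) (- a) a (tau - a) (tau + a) != 0.
Proof.
move=> a0; have aa : - a <= a by lra.
have tt : tau - a <= tau + a by lra.
have a20 : 0 < a ^+ 2 by rewrite exprn_gt0.
pose P (t : R) : R[i] := ((2 * a) / (t ^+ 2 + a ^+ 2))%:C%C.
have cinv (z : R[i]) : z - pt 0 tau != 0 ->
    tends (fun z => (z - pt 0 tau)^-1) z (z - pt 0 tau)^-1.
  move=> z0; apply: (@hol_tends _ (fun z => (z - pt 0 tau)^-1)); apply: holV => //.
  by apply: holB; [exact: hol_id|exact: hol_cst].
have n1 (x y : R) : x != 0 -> pt x y != 0.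
  by apply: contraNneq => -[->].
have n2 (x y : R) : y != 0 -> pt x y != 0.
  by apply: contraNneq => -[_ ->].
have aN0 : - a != 0 by rewrite oppr_eq0 gt_eqF.
have ch y : y != tau -> contin_on (- a) a (fun x => (pt x y - pt 0 tau)^-1).
  move=> yt; apply: (@contin_h _ (fun z => (z - pt 0 tau)^-1)) => x _; apply: cinv.
  by rewrite ptB n2// subr_eq0.
have cv x : x != 0 -> contin_on (tau - a) (tau + a) (fun y => (pt x y - pt 0 tau)^-1).
  move=> x0; apply: (@contin_v _ (fun z => (z - pt 0 tau)^-1)) => y _; apply: cinv.
  by rewrite ptB subr0 n1.
have inv_pt (x y : R) : (pt x y)^-1 = pt (x / (x ^+ 2 + y ^+ 2)) (- y / (x ^+ 2 + y ^+ 2)).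
  by rewrite /pt mulNr.
have sq0 (x y : R) : x != 0 -> x ^+ 2 + y ^+ 2 != 0.
  by move=> x0; rewrite gt_eqF// ltr_pwDl ?sqr_ge0// exprn_even_gt0.
have P_ge t : - a <= t <= a -> a^-1 <= complex.Re (P t).
  move=> /andP[t1 t2]; rewrite /P /= ler_pdivlMr ?ltr_wpDl ?sqr_ge0//.
  rewrite mulrC ler_pdivrMr//.
  have : 0 <= (a - t) * (a + t) by apply: mulr_ge0; lra.
  have -> : (a - t) * (a + t) = a * a - t ^+ 2 by ring.
  have -> : a ^+ 2 = a * a by ring.
  lra.
have cP : contin_on (- a) a P.
  apply: (@contin_on_real _ _ _ (fun t => 2 * a / (t ^+ 2 + a ^+ 2))) => t.
  apply: cvgM; first exact: cvg_cst.
  apply: cvgV; first by rewrite gt_eqF// ltr_wpDl ?sqr_ge0.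
  by apply: cvgD; [exact: exprn_continuous|exact: cvg_cst].
have cP' : contin_on (tau - a) (tau + a) (fun y => P (y - tau)).
  apply: (@contin_on_real _ _ _ (fun y => 2 * a / ((y - tau) ^+ 2 + a ^+ 2))) => t.
  apply: cvgM; first exact: cvg_cst.
  apply: cvgV; first by rewrite gt_eqF// ltr_wpDl ?sqr_ge0.
  apply: cvgD; last exact: cvg_cst.
  have cB : s - tau @[s --> t] --> (t - tau : R).
    by apply: cvgB; [exact: cvg_id|exact: cvg_cst].
  exact: (cvg_comp _ _ cB (@exprn_continuous R 2 (t - tau))).
have t1 : tau - a != tau by rewrite lt_eqF//; lra.
have t2 : tau + a != tau by rewrite gt_eqF//; lra.
have a0' : a != 0 by rewrite gt_eqF.
rewrite /Rint -CintB; [|exact: ch|exact: ch].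
rewrite -CintB; [|exact: cv|exact: cv].
rewrite (@eq_Cint _ _ _ _ (fun x => 'i%C * P x)); last first.
  move=> x _; rewrite (ptB x (tau - a)) (ptB x (tau + a)) subr0.
  have -> : tau - a - tau = - a by ring.
  have -> : tau + a - tau = a by ring.
  rewrite (inv_pt x (- a)) (inv_pt x a) sqrrN /P; apply/eqP; rewrite eq_complex /=.
  by apply/andP; split; apply/eqP; field; rewrite addrC sq0.
rewrite (@eq_Cint _ (tau - a) _ _ (fun y => P (y - tau))); last first.
  move=> y _; rewrite (ptB a y) (ptB (- a) y) !subr0 (inv_pt a) (inv_pt (- a)) sqrrN /P.
  move: (y - tau) => t; have d1 := sq0 a t a0'.
  have d2 : t ^+ 2 + a ^+ 2 != 0 by rewrite addrC.
  apply/eqP; rewrite eq_complex /=.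
  by apply/andP; split; apply/eqP; field; rewrite ?d1 ?d2.
rewrite CintZ// -mulrDr mulf_neq0 -?rnorm_eq0 ?rnorm_i ?oner_eq0//.
have g1 := Re_Cint_ge aa cP P_ge.
have g2 : (tau + a - (tau - a)) * a^-1 <= complex.Re (Cint (tau - a) (tau + a) (fun y => P (y - tau))).
  by apply: Re_Cint_ge => // t /andP[h1 h2]; apply: P_ge; apply/andP; split; lra.
rewrite gt_eqF//; apply: lt_le_trans (le_trans (ler_norm _) (Re_le_rnorm _)).
rewrite cReD.
have k1 : (a - - a) * a^-1 = 2 by field.
have k2 : (tau + a - (tau - a)) * a^-1 = 2 by field.
rewrite k1 in g1; rewrite k2 in g2; lra.
Qed.

(** The inner factor vanishes where the contour crosses [Re z = 0], at the heights [tau - a] and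
    [tau + a]. The outer square makes these zeros double, to absorb the [1 / x^2] of
    [resolvent_bound]. *)
Definition weight (a tau : R) (z : R[i]) : R[i] :=
  ((z - pt 0 tau) ^+ 2 + (a ^+ 2)%:C%C) ^+ 2.

Lemma hol_weight a tau z : hol (weight a tau) z.
Proof.
apply: (@holX _ (fun z => (z - pt 0 tau) ^+ 2 + (a ^+ 2)%:C%C)).
apply: holD; last exact: hol_cst.
by apply: (@holX _ (fun z => z - pt 0 tau)); apply: holB; [exact: hol_id|exact: hol_cst].
Qed.

Definition edge a tau (x y : R) :=
  [/\ - a <= x <= a, tau - a <= y <= tau + a
    & [|| x == - a, x == a, y == tau - a | y == tau + a]].

Lemma edge_neq0 a tau x y : 0 < a -> edge a tau x y -> a <= rnorm (pt x y - pt 0 tau).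
Proof.
move=> a0 [_ _ h]; rewrite ptB subr0.
have r1 := Re_le_rnorm (pt x (y - tau)); have r2 := Im_le_rnorm (pt x (y - tau)).
rewrite /= in r1 r2; have an := ler_norm a.
case/or4P: h => /eqP e.
- by apply: le_trans r1; rewrite e normrN.
- by apply: le_trans r1; rewrite e.
- by apply: le_trans r2; rewrite e addrAC subrr add0r normrN.
- by apply: le_trans r2; rewrite e addrAC subrr add0r.
Qed.

(** With [t = y - tau] the inner factor is [(x^2 - t^2 + a^2) + 2 i x t]. Its real part is at most
    [2 a |x|] in modulus: on the vertical edges because [|x| = a], on the horizontal ones because it
    equals [x^2]. *)
Lemma weight_edge a tau x y : 0 < a -> edge a tau x y ->
  rnorm (weight a tau (pt x y)) <= 16 * a ^+ 2 * x ^+ 2.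
Proof.
move=> a0 [/andP[x1 x2] /andP[y1 y2] h]; rewrite /weight ptB subr0; set t := y - tau.
have ta : `|t| <= a by rewrite ler_norml /t; apply/andP; split; lra.
have xa : `|x| <= a by rewrite ler_norml x1.
have -> : pt x t ^+ 2 + (a ^+ 2)%:C%C = pt (x ^+ 2 - t ^+ 2 + a ^+ 2) (2 * (x * t)).
  by rewrite expr2; apply/eqP; rewrite eq_complex /=; apply/andP; split; apply/eqP; ring.
have k : rnorm (pt (x ^+ 2 - t ^+ 2 + a ^+ 2) (2 * (x * t))) <= 4 * a * `|x|.
  apply: le_trans (rnorm_pt _ _) _.
  have b1 : `|2 * (x * t)| <= 2 * (`|x| * a).
    by rewrite !normrM ger0_norm// ler_pM2l// ler_wpM2l.
  suff b2 : `|x ^+ 2 - t ^+ 2 + a ^+ 2| <= 2 * a * `|x| by lra.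
  have xx : `|x| ^+ 2 = x ^+ 2 by rewrite real_normK ?num_real.
  have tt : `|t| ^+ 2 = t ^+ 2 by rewrite real_normK ?num_real.
  have ta2 : t ^+ 2 <= a ^+ 2 by rewrite -tt lerXn2r ?nnegrE ?(ltW a0).
  have t0 := sqr_ge0 t.
  have side : `|x| = a -> `|x ^+ 2 - t ^+ 2 + a ^+ 2| <= 2 * a * `|x|.
    by move=> xe; rewrite ler_norml -xx xe -mulrA -expr2; apply/andP; split; lra.
  have bottom : `|t| = a -> `|x ^+ 2 - t ^+ 2 + a ^+ 2| <= 2 * a * `|x|.
    move=> te; rewrite -tt te subrK -xx ger0_norm ?sqr_ge0// expr2 ler_wpM2r//; lra.
  case/or4P: h => /eqP e.
  - by apply: side; rewrite e normrN ger0_norm// ltW.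
  - by apply: side; rewrite e ger0_norm// ltW.
  - by apply: bottom; rewrite /t e addrAC subrr add0r normrN ger0_norm// ltW.
  - by apply: bottom; rewrite /t e addrAC subrr add0r ger0_norm// ltW.
rewrite rnormX; apply: (@le_trans _ _ ((4 * a * `|x|) ^+ 2)).
  by apply: lerXn2r; rewrite ?nnegrE ?rnorm_ge0//; apply: le_trans (rnorm_ge0 _) k.
by rewrite !exprMn real_normK ?num_real// -natrX.
Qed.

(** With [s = z - pt 0 tau] the integrand is [s^3 + 2 a^2 s + a^4 / s], whose polynomial part
    integrates to 0. *)
Lemma Rint_weight_neq0 a tau : 0 < a ->
  Rint (fun z => weight a tau z / (z - pt 0 tau)) (- a) a (tau - a) (tau + a) != 0.
Proof.
move=> a0; have aa : - a <= a by lra.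
have tt : tau - a <= tau + a by lra.
pose p z : R[i] := (z - pt 0 tau) ^+ 3 + (2 * a ^+ 2)%:C%C * (z - pt 0 tau).
have hz z : hol (fun z : R[i] => z - pt 0 tau) z.
  by apply: holB; [exact: hol_id|exact: hol_cst].
have hp z : hol p z.
  apply: holD; first by apply: (@holX _ (fun z => z - pt 0 tau)); exact: hz.
  by apply: holM; [exact: hol_cst|exact: hz].
pose q z : R[i] := (z - pt 0 tau)^-1.
have hrp : hol_rect p (- a) a (tau - a) (tau + a) by move=> x y _ _; exact: hp.
have tq x y : edge a tau x y -> tends q (pt x y) (q (pt x y)).
  move=> e; apply: (@hol_tends _ q); apply: holV; first exact: hz.
  by rewrite -rnorm_gt0; exact: lt_le_trans a0 (edge_neq0 a0 e).
have eq : contin_edges q (- a) a (tau - a) (tau + a).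
  split.
  - by apply: contin_h => x hx; apply: tq; split; rewrite ?lexx ?eqxx ?orbT.
  - by apply: contin_h => x hx; apply: tq; split; rewrite ?lexx ?eqxx ?orbT ?tt.
  - by apply: contin_v => x hx; apply: tq; split; rewrite ?lexx ?eqxx ?orbT.
  - by apply: contin_v => x hx; apply: tq; split; rewrite ?lexx ?eqxx ?orbT ?aa.
pose k := (a ^+ 4)%:C%C : R[i].
have eqk : contin_edges (fun z => k * q z) (- a) a (tau - a) (tau + a).
  by case: eq => *; split; (apply: contin_onM; first exact: contin_on_cst).
have -> : Rint (fun z => weight a tau z / (z - pt 0 tau)) (- a) a (tau - a) (tau + a) =
    Rint (fun z => p z + k * q z) (- a) a (tau - a) (tau + a).
  have pw x y : edge a tau x y -> weight a tau (pt x y) / (pt x y - pt 0 tau) =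
      p (pt x y) + k * q (pt x y).
    move=> e; have z0 : pt x y - pt 0 tau != 0.
      by rewrite -rnorm_gt0; exact: lt_le_trans a0 (edge_neq0 a0 e).
    have e2 : (a ^+ 2)%:C%C = a%:C%C ^+ 2 :> R[i] by rewrite rmorphXn.
    have e4 : (a ^+ 4)%:C%C = a%:C%C ^+ 4 :> R[i] by rewrite rmorphXn.
    have e3 : (2 * a ^+ 2)%:C%C = 2 * a%:C%C ^+ 2 :> R[i].
      by rewrite rmorphM rmorphXn rmorph_nat.
    rewrite /weight /p /k /q e2 e3 e4.
    by move: z0; move: (pt x y - pt 0 tau) a%:C%C => s b z0; field.
  rewrite /Rint; congr (_ - _ + _ * (_ - _)); apply: eq_Cint => t h; apply: pw;
    by split; rewrite ?lexx ?eqxx ?orbT ?aa ?tt.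
rewrite RintD//; last exact: hol_edges.
rewrite (Goursat aa tt hrp) add0r RintZ// mulf_neq0 ?Rint_inv_neq0//.
by rewrite -rnorm_eq0 rnormR normr_eq0 expf_neq0// gt_eqF.
Qed.

End RegularPoint.

(** * The lower bound for [m - X] at a regular point of the circle *)

Section Estimate.
Variable R : realType.
Implicit Types (a b c d t : R).
Variable U : hardy R.
Hypothesis orthoU : forall k : nat, hdot (iter k (@bshift R) U) U = (k == 0%N)%:R.
Variables (tau A M delta : R).
Hypotheses (A0 : 0 < A) (A1 : A <= 1) (delta0 : 0 < delta).
Hypothesis UM : forall z, rnorm z < 1 -> rnorm (heval U z) <= M.
Hypothesis Uhol : forall z, rnorm z < 1 -> hol (heval U) z.
Hypothesis Udelta : forall x y, 0 < x < A -> `|y - tau| < A ->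
  delta <= rnorm (heval U (cexp (pt (- x) y))).
Hypothesis Uae : {ae (@lebesgue_measure R), forall t : R,
  (fun r => rnorm (heval U (cpt r t))) @ (1 : R)^'- --> (1 : R)}.
Implicit Types (f g p : hardy R) (z : R[i]).
Notation bX := (@bshift R).
Notation z0 := (pt 0 tau : R[i]).
Notation m0 := (Emap z0).
Notation Aop f := (m0 *: f - bX f).
Notation Om := (Omega tau A).
Let C1 : R := 4 * (1 + delta^-1).

Lemma C1_ge1 : 1 <= C1.
Proof. by have : 0 <= delta^-1; [rewrite invr_ge0 ltW|rewrite /C1; lra]. Qed.

(** Outside the disk [|m| - 1 >= |x| >= x^2]; inside, [1 - e^(-x) >= x / 2] for [x <= 1], whose
    square gives the 4 in [C1]. *)
Lemma resolvent_bound z f g : Om z -> inK U f -> resolvent U (Emap z) f g ->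
  rnorm g <= C1 / complex.Re z ^+ 2 * rnorm f.
Proof.
move=> zO fK hg; case: (zO) => x0 xA _; set x := complex.Re z in x0 xA *.
have x20 : 0 < x ^+ 2 by rewrite exprn_even_gt0.
have rm := regular_Emap delta0 Udelta zO.
have x1 : `|x| <= 1 by exact: ltW (lt_le_trans xA A1).
have f0 := rnorm_ge0 f; have C1g := C1_ge1.
have [[xn m1]|[xp m1 du]] := Emap_case Udelta zO.
  have := resolvent_outer_bound (Emap z) g; case: hg => _ -> h.
  rewrite ltr0_norm // in x1.
  have e1 : x ^+ 2 <= rnorm (Emap z) - 1.
    have := expR_ge1Dx (- x); rewrite rnorm_cexp raddfN /= -/x.
    have : x ^+ 2 <= - x by rewrite -sqrrN expr2 ler_piMl// oppr_ge0 ltW.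
    by lra.
  rewrite mulrAC ler_pdivlMr//; apply: le_trans (_ : rnorm f <= _); last first.
    by rewrite -[leLHS]mul1r ler_wpM2r.
  by apply: le_trans h; rewrite mulrC ler_wpM2r ?rnorm_ge0.
have u0 : heval U (Emap z)^* != 0 by rewrite -rnorm_gt0; exact: lt_le_trans delta0 du.
have [g' hg' bg'] := resolvent_inner orthoU m1 u0 fK.
rewrite (resolvent_uniq rm hg hg'); apply: le_trans bg' _.
rewrite [leRHS]mulrC -mulrA; apply: ler_wpM2l => //.
rewrite gtr0_norm // in x1.
have y2 : x / 2 <= 1 - rnorm (Emap z).
  rewrite rnorm_cexp raddfN /= -/x expRN.
  have e1 := expR_ge1Dx x; have e2 : (expR x)^-1 <= (1 + x)^-1.
    by rewrite lef_pV2 ?posrE ?expR_gt0//; lra.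
  have e3 : (1 + x)^-1 <= 1 - x / 2.
    rewrite -[leLHS]mul1r ler_pdivrMr; last by lra.
    have : 0 <= x * (1 - x) by apply: mulr_ge0; lra.
    have -> : (1 - x / 2) * (1 + x) = 1 + x * (1 - x) / 2 by field.
    by lra.
  by lra.
have d0 : 0 < 1 - rnorm (Emap z) by rewrite subr_gt0.
have q1 : (rnorm (heval U (Emap z)^*))^-1 <= delta^-1.
  by rewrite lef_pV2 ?posrE// (lt_le_trans delta0 du).
have q2 : x ^+ 2 <= 4 * (1 - rnorm (Emap z)) ^+ 2.
  have -> : x ^+ 2 = 4 * (x / 2) ^+ 2 by field.
  by rewrite ler_pM2l// lerXn2r ?nnegrE ?(ltW d0)// divr_ge0// ltW.
have q3 : 0 <= (rnorm (heval U (Emap z)^*))^-1 by rewrite invr_ge0 rnorm_ge0.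
move: q1 q2 q3 d0; move: (_^-1) (1 - rnorm _) (x ^+ 2) x20 => q d X X0 q1 q2 q3 d0.
rewrite ler_pdivrMr ?exprn_gt0// mulrAC ler_pdivlMr// /C1.
apply: (@le_trans _ _ ((1 + delta^-1) * (4 * d ^+ 2))); last by rewrite mulrA [_ * 4]mulrC.
by apply: ler_pM => //; [exact: addr_ge0|exact: ltW|by rewrite lerD2l].
Qed.

(** The resolvent identity between [m0] and [Emap z], written without an inverse at [m0], whose
    existence is the question. *)
Lemma resolvent_shifted z f g : resolvent U (Emap z) f g -> inK U f ->
  resolvent U (Emap z) (Aop f) (f - (Emap z - m0) *: g).
Proof.
move=> [gK e] fK; split; first by apply: inKB => //; exact: inKZ.
rewrite bshiftB bshiftZ.
have alg (E m F F' G G' : R[i]) : E * G - G' = F ->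
  E * (F - (E - m) * G) - (F' - (E - m) * G') = m * F - F' by move=> <-; ring.
by apply: hardyP => n; apply: alg; exact: (congr1 (fun h : hardy R => h n) e).
Qed.

(** The inner product of the resolvent applied to [f] with [trunc N p], as a finite sum of scalar
    resolvent functions, so that the matching of boundary values applies to it. *)
Definition Tsum N f p z : R[i] := \sum_(k < N) (p k)^* * resF U (iter k bX f) (Emap z).

Lemma TsumE N f p g z : Om z -> resolvent U (Emap z) f g ->
  Tsum N f p z = hdot g (trunc N p).
Proof.
move=> zO hg; have rm := regular_Emap delta0 Udelta zO.
rewrite /trunc linear_sumr; apply: eq_bigr => k _; rewrite linearZr_LR /= monomial_coef.
have hk : forall j, resolvent U (Emap z) (iter j bX f) (iter j bX g).
  by elim=> [//|j IH]; exact: resolventX IH.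
by rewrite (resFE rm (hk k)) iter_bshiftE.
Qed.

Lemma good_Tsum N f p : good_resF U tau A f -> good tau A (Tsum N f p).
Proof.
move=> fg; apply: (@good_sum _ tau A A0 N (fun k z => (p k)^* * resF U (iter k bX f) (Emap z))) => k.
apply: goodZ; first exact: A0.
by have [] := good_resF_iter orthoU A0 delta0 Udelta A1 k fg.
Qed.

(** The factor [E - m0] of the resolvent identity, divided by [z - z0], leaves no pole at [z0]. *)
Definition Qmap z : R[i] := (Emap z - m0) / (z - z0).

Lemma pt_z0 z : Om z -> z - z0 != 0.
Proof.
move=> [x0 _ _]; rewrite subr_eq0; apply: contraNneq x0 => ->.
by rewrite /= eqxx.
Qed.

Lemma good_Qmap : good tau A Qmap.
Proof.
have hQ z : z != z0 -> hol Qmap z.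
  move=> zz; apply: holM; first by apply: holB; [exact: hol_Emap|exact: hol_cst].
  by apply: holV; [apply: holB; [exact: hol_id|exact: hol_cst]|rewrite subr_eq0].
have [p pz ep] := hol_Emap z0.
have /tendsP/(_ _ ltr01)[d1 d10 h1] := pz; have /near_atP[d2 d20 h2] := ep.
pose d := Num.min d1 d2; have d0 : 0 < d by rewrite lt_min d10.
have e1 : 0 < expR 1 :> R by exact: expR_gt0.
have mb : rnorm m0 <= expR 1.
  by rewrite rnorm_cexp raddfN /= oppr0 ler_expR.
apply: (@good_continuous _ _ _ _ (rnorm (p z0) + 1 + (expR 1 + expR 1) / d)) => [z zO|z zO|y _ yt].
- have k0 : 0 <= (expR 1 + expR 1) / d by rewrite divr_ge0// ?addr_ge0 ?(ltW e1) ?(ltW d0).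
  have zz := pt_z0 zO; have [dz|dz] := ltP (rnorm (z0 - z)) d.
    have [dz1 dz2] : rnorm (z0 - z) < d1 /\ rnorm (z0 - z) < d2.
      by move: dz; rewrite lt_min => /andP[].
    rewrite /Qmap (h2 _ dz2) addrC addKr mulfK//.
    have := rnorm_sub_le (p z) (p z0); have := h1 _ dz1; rewrite rnormB.
    by move: k0; lra.
  rewrite rnormB in dz; have pn := rnorm_ge0 (p z0).
  apply: (@le_trans _ _ ((expR 1 + expR 1) / d)); last by lra.
  rewrite /Qmap rnormM rnormV; apply: ler_pM; rewrite ?invr_ge0 ?rnorm_ge0//.
    have [eb _] := Emap_bound A1 zO.
    by apply: le_trans (rnorm_le_sub _ _) _; exact: lerD.
  by rewrite lef_pV2 ?posrE ?rnorm_gt0.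
- by apply: hQ; rewrite -subr_eq0; exact: pt_z0.
- by apply: hol_tends; apply: hQ; apply: contraNneq yt => -[->].
Qed.

(** Smaller than [A], so that the closed contour stays within the box of half-width [A]. *)
Let a := A / 2.
Notation w := (weight a tau).

Lemma a_bounds : 0 < a < A. Proof. by have h := A0; rewrite /a; apply/andP; split; lra. Qed.

Lemma Omega_rect x y : x != 0 -> - a <= x <= a -> tau - a <= y <= tau + a -> Om (pt x y).
Proof.
have /andP[a0 aA] := a_bounds => x0 /andP[x1 x2] /andP[y1 y2]; split=> //=.
  by apply: le_lt_trans aA; rewrite ler_norml x1.
by apply: le_lt_trans aA; rewrite ler_norml; apply/andP; split; lra.
Qed.

Lemma good_weight : good tau A w.
Proof.
have /andP[a0 aA] := a_bounds; have hA1 := A1.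
(* [|z - z0| <= 2] and [a <= 1], so the inner factor is at most 5. *)
apply: (@good_continuous _ _ _ _ 25) => [z [_ zA yA]|z _|y _ _].
- rewrite rnormX; apply: (@le_trans _ _ (5 ^+ 2)); last by rewrite -natrX.
  apply: lerXn2r; rewrite ?nnegrE ?rnorm_ge0//.
  apply: le_trans (rnormD _ _) _; rewrite rnormX rnormR ger0_norm ?sqr_ge0//.
  have zn : rnorm (z - z0) <= 2.
    case: z zA yA => x y /= xA yA; rewrite -[(x +i* y)%C]/(pt x y) ptB subr0.
    apply: le_trans (rnorm_pt _ _) _; rewrite -[2]/(1 + 1 : R).
    by apply: lerD; apply: ltW; apply: lt_le_trans A1.
  have h1 : rnorm (z - z0) ^+ 2 <= 2 ^+ 2 by apply: lerXn2r; rewrite ?nnegrE ?rnorm_ge0.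
  have h2 : a ^+ 2 <= 1 by rewrite exprn_ile1//; lra.
  have e4 : 2 ^+ 2 = 4 :> R by rewrite -natrX.
  by rewrite e4 in h1; lra.
- exact: hol_weight.
- exact: hol_tends (hol_weight _ _ _).
Qed.

Lemma weight_corner (s : R) : s ^+ 2 = a ^+ 2 -> w (pt 0 (tau + s)) = 0.
Proof.
move=> sa; rewrite /weight ptB subr0 [tau + s]addrC addrK.
have -> : pt 0 s ^+ 2 = - (a ^+ 2)%:C%C.
  by rewrite -sa expr2; apply/eqP; rewrite eq_complex /=; apply/andP; split; apply/eqP; ring.
by rewrite addNr expr0n.
Qed.

(** The value 0 on the line keeps the integrand bounded and is its limit at the two crossing points,
    which makes it continuous along the horizontal edges. *)
Definition Hint N f p z : R[i] :=
  if complex.Re z == 0 then 0 else w z * (Qmap z * Tsum N f p z).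

Lemma Hint_contour N f p : good_resF U tau A f ->
  contin_edges (Hint N f p) (- a) a (tau - a) (tau + a) /\
  Rint (Hint N f p) (- a) a (tau - a) (tau + a) = 0.
Proof.
move=> fg; have /andP[a0 aA] := a_bounds.
have gT := goodM A0 good_Qmap (good_Tsum N p fg).
have [[K bK] hK aK] := goodM A0 good_weight gT; have [[K' bK'] _ _] := gT.
have K0 : 0 <= K.
  by apply: le_trans (rnorm_ge0 _) (bK (pt a tau) _); apply: Omega_rect;
    rewrite ?gt_eqF//; apply/andP; split; lra.
have K'0 : 0 <= K'.
  by apply: le_trans (rnorm_ge0 _) (bK' (pt a tau) _); apply: Omega_rect;
    rewrite ?gt_eqF//; apply/andP; split; lra.
have HE z : Om z -> Hint N f p z = w z * (Qmap z * Tsum N f p z).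
  by case=> x0 _ _; rewrite /Hint (negbTE x0).
have hH z : Om z -> hol (Hint N f p) z.
  move=> zO; apply: (@hol_near _ _ (fun z => w z * (Qmap z * Tsum N f p z))); last exact: hK.
  by apply: filterS (Omega_near zO) => z' /HE.
(* Here the weight tends to 0 and the other factor is bounded by [K']. *)
have corner s : s ^+ 2 = a ^+ 2 -> tends (Hint N f p) (pt 0 (tau + s)) (Hint N f p (pt 0 (tau + s))).
  move=> sa; have -> : Hint N f p (pt 0 (tau + s)) = 0 by rewrite /Hint eqxx.
  have sA : `|s| < A.
    by rewrite -(@ltr_pXn2r _ 2) ?nnegrE ?(ltW A0)// real_normK ?num_real// sa ltr_pXn2r ?nnegrE ?ltW.
  have tw := hol_tends (hol_weight a tau (pt 0 (tau + s))); rewrite weight_corner// in tw.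
  apply/tendsP => e e0; have e1 : 0 < e / (K' + 1) by rewrite divr_gt0// ltr_wpDl.
  have /tendsP/(_ _ e1)[d d0 hd] := tw.
  exists (Num.min d (A - `|s|)); first by rewrite lt_min d0 subr_gt0.
  move=> z; rewrite lt_min => /andP[/hd zd zA]; rewrite !sub0r !rnormN in zd *.
  have [z00|z00] := eqVneq (complex.Re z) 0; first by rewrite /Hint z00 eqxx rnorm0.
  have zO : Om z.
    case: z z00 zA {zd} => x y /= x0; rewrite -[(x +i* y)%C]/(pt x y) ptB sub0r => zA.
    have r1 := Re_le_rnorm (pt (- x) (tau + s - y)).
    have r2 := Im_le_rnorm (pt (- x) (tau + s - y)); rewrite /= normrN in r1 r2.
    split=> //=; first by have := normr_ge0 s; lra.
    have := ler_normB s (tau + s - y).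
    have -> : s - (tau + s - y) = y - tau by ring.
    lra.
  rewrite HE// rnormM; apply: (@le_lt_trans _ _ (rnorm (w z) * K')).
    by rewrite ler_wpM2l ?rnorm_ge0// bK'.
  rewrite ltr_pdivlMr ?ltr_wpDl// in zd; apply: le_lt_trans zd.
  by rewrite ler_wpM2l ?rnorm_ge0//; lra.
have horiz s : s ^+ 2 = a ^+ 2 -> - a <= s <= a -> contin_on (- a) a (fun x => Hint N f p (pt x (tau + s))).
  move=> sa /andP[s1 s2]; apply: contin_h => x hx; have [->|x0] := eqVneq x 0.
    exact: corner.
  by apply: hol_tends; apply: hH; apply: Omega_rect => //; apply/andP; split; lra.
have vert x : x != 0 -> - a <= x <= a -> contin_on (tau - a) (tau + a) (fun y => Hint N f p (pt x y)).
  by move=> x0 hx; apply: contin_v => y hy; apply: hol_tends; apply: hH; exact: Omega_rect.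
have h1 : contin_on (- a) a (fun x => Hint N f p (pt x (tau - a))).
  by apply: horiz; rewrite ?sqrrN//; apply/andP; split; lra.
have h2 : contin_on (- a) a (fun x => Hint N f p (pt x (tau + a))).
  by apply: horiz => //; apply/andP; split; lra.
split; first split=> //.
- by apply: vert; [rewrite oppr_eq0 gt_eqF|apply/andP; split; lra].
- by apply: vert; [rewrite gt_eqF|apply/andP; split; lra].
apply: (@Rint_crossing _ _ _ _ _ _ 0 K) => //; [by apply/andP; split; lra|by lra|..].
- move=> x y hx hy; have [->|x0] := eqVneq x 0; first by rewrite /Hint eqxx rnorm0.
  by have zO := Omega_rect x0 hx hy; rewrite HE//; exact: bK.
- by move=> x y hx x0 hy; apply: hH; apply: Omega_rect => //.
- have FA := @ae_filter_ringOfSetsType _ _ _ (@lebesgue_measure R).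
  apply: filterS aK => y h /andP[y1 y2].
  have yA : `|y - tau| < A by rewrite ltr_norml; apply/andP; split; lra.
  have /cvgCP k := h yA; apply/cvgCP => e e0.
  apply: filterS2 (near_e A0) (k e e0) => s s1.
  by have [om1 om2] := Omega_e s1 yA; rewrite (add0r s) (sub0r s) !HE.
Qed.

Lemma hnorm_trunc N f : rnorm (trunc N f) <= rnorm f.
Proof.
apply: hnorm_le => [|K]; first exact: rnorm_ge0.
apply: le_trans (series_le_hnorm f K); rewrite /series /=; apply: ler_sum => k _.
by rewrite truncE; case: ifP => // _; rewrite rnorm0 expr0n sqr_ge0.
Qed.

Let kappa : R := rnorm (Rint (fun z => w z / (z - z0)) (- a) a (tau - a) (tau + a)).
(** The perimeter of the contour times the bound of the integrand, over the modulus of the integral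
    of [w z / (z - z0)]; neither [f] nor [N] occurs. *)
Let C2 : R := 2 * (a - - a + (tau + a - (tau - a))) * (16 * a * C1) / kappa.

Lemma kappa_gt0 : 0 < kappa.
Proof. by have /andP[a0 _] := a_bounds; rewrite /kappa rnorm_gt0 Rint_weight_neq0. Qed.

(** [Hint] integrates to 0, so the integral of [c W - Hint] is [c] times a nonzero number. Off the
    line this integrand is [W <(E - X)^-1 (m0 - X) f, q>], where the [x^2] of the weight cancels the
    [1 / x^2] of the resolvent. *)
Lemma hdot_trunc_bound N f p : good_resF U tau A f ->
  rnorm (hdot f (trunc N p)) <= C2 * (rnorm (Aop f) * rnorm (trunc N p)).
Proof.
move=> fg; have fK := fg.1; have /andP[a0 aA] := a_bounds.
have aa : - a <= a by lra. have tt : tau - a <= tau + a by lra.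
set q := trunc N p; pose c := hdot f q; pose B := rnorm (Aop f) * rnorm q.
have B0 : 0 <= B by rewrite mulr_ge0 ?rnorm_ge0.
have [cH eH] := Hint_contour N p fg.
pose W z := w z / (z - z0).
have tW x y : edge a tau x y -> tends W (pt x y) (W (pt x y)).
  move=> e; apply: (@hol_tends _ W); apply: holM; first exact: hol_weight.
  apply: holV; first by apply: holB; [exact: hol_id|exact: hol_cst].
  by rewrite -rnorm_gt0; exact: lt_le_trans a0 (edge_neq0 a0 e).
have cW : contin_edges W (- a) a (tau - a) (tau + a).
  split.
  - by apply: contin_h => x hx; apply: tW; split; rewrite ?lexx ?eqxx ?orbT.
  - by apply: contin_h => x hx; apply: tW; split; rewrite ?lexx ?eqxx ?orbT ?tt.
  - by apply: contin_v => x hx; apply: tW; split; rewrite ?lexx ?eqxx ?orbT.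
  - by apply: contin_v => x hx; apply: tW; split; rewrite ?lexx ?eqxx ?orbT ?aa.
have cZ (k : R[i]) G : contin_edges G (- a) a (tau - a) (tau + a) ->
    contin_edges (fun z => k * G z) (- a) a (tau - a) (tau + a).
  by case=> *; split; (apply: contin_onM; first exact: contin_on_cst).
have cD : contin_edges (fun z => c * W z + (-1) * Hint N f p z) (- a) a (tau - a) (tau + a).
  by have [g1 g2 g3 g4] := cZ c _ cW; have [k1 k2 k3 k4] := cZ (-1) _ cH;
    split; exact: contin_onD.
have eD : Rint (fun z => c * W z + (-1) * Hint N f p z) (- a) a (tau - a) (tau + a) =
    c * Rint W (- a) a (tau - a) (tau + a).
  by rewrite (RintD (cZ c _ cW) (cZ (-1) _ cH)) !RintZ// eH mulr0 addr0.
have bD : rnorm (Rint (fun z => c * W z + (-1) * Hint N f p z) (- a) a (tau - a) (tau + a)) <=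
    2 * (a - - a + (tau + a - (tau - a))) * (16 * a * C1 * B).
  apply: le_rnorm_Rint => // x y hx hy he; have e : edge a tau x y by [].
  have C1p : 0 <= 16 * a * C1.
    apply: mulr_ge0 (le_trans ler01 C1_ge1); apply: mulr_ge0 => //; exact: ltW.
  (* At a crossing point the weight vanishes, and [Hint] is 0 by definition. *)
  have [x0|x0] := eqVneq x 0.
    have w0 : w (pt x y) = 0.
      apply/eqP; rewrite -rnorm_eq0; apply/eqP/le_anti; rewrite rnorm_ge0 andbT.
      by apply: le_trans (weight_edge a0 e) _; rewrite x0 expr0n mulr0.
    by rewrite /W w0 /Hint /= x0 eqxx mul0r !mulr0 addr0 rnorm0 mulr_ge0.
  have zO := Omega_rect x0 hx hy.
  have [g hg] := resolvent_exists orthoU (regular_Emap delta0 Udelta zO) fK.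
  have hs := resolvent_shifted hg fK.
  have ss : pt x y - z0 != 0 := pt_z0 zO.
  have -> : c * W (pt x y) + -1 * Hint N f p (pt x y) =
      W (pt x y) * hdot (f - (Emap (pt x y) - m0) *: g) q.
    rewrite /Hint /= (negbTE x0) (TsumE N p zO hg) linearBl /= linearZl_LR /= /W /Qmap -/q -/c.
    by move: ss; move: (pt x y - z0) (hdot g q) (w _) (Emap _ - _) => s h v t s0; field.
  have gb := resolvent_bound zO (inKB (inKZ m0 fK) (inKX fK)) hs.
  have x20 : 0 < x ^+ 2 by rewrite exprn_even_gt0.
  have wb : rnorm (W (pt x y)) <= 16 * a * x ^+ 2.
    rewrite rnormM rnormV ler_pdivrMr ?rnorm_gt0//.
    apply: le_trans (weight_edge a0 e) _.
    apply: (@le_trans _ _ (16 * a * x ^+ 2 * a)).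
      by rewrite le_eqVlt; apply/orP; left; apply/eqP; ring.
    apply: ler_wpM2l (edge_neq0 a0 e); apply: mulr_ge0 (ltW x20).
    by apply: mulr_ge0 => //; exact: ltW.
  rewrite rnormM.
  have hb : rnorm (hdot (f - (Emap (pt x y) - m0) *: g) q) <= C1 / x ^+ 2 * B.
    apply: le_trans (hdot_CS _ _) _; rewrite /B mulrA; apply: ler_wpM2r gb.
    exact: rnorm_ge0.
  apply: le_trans (ler_pM (rnorm_ge0 _) (rnorm_ge0 _) wb hb) _.
  rewrite le_eqVlt; apply/orP; left; apply/eqP.
  by move: (x ^+ 2) x20 => X X0; field; rewrite gt_eqF.
rewrite eD rnormM in bD; rewrite /C2 -/c -/q -/B mulrAC ler_pdivlMr ?kappa_gt0//.
by apply: le_trans bD _; rewrite mulrA.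
Qed.

Lemma C2_ge0 : 0 <= C2.
Proof.
have /andP[a0 _] := a_bounds; have k0 := kappa_gt0.
apply: divr_ge0; last exact: ltW.
apply: mulr_ge0; first by lra.
apply: mulr_ge0 (le_trans ler01 C1_ge1); apply: mulr_ge0 => //; exact: ltW.
Qed.

Lemma bounded_below_good f : good_resF U tau A f -> rnorm f <= C2 * rnorm (Aop f).
Proof.
move=> fg; have [/eqP f0|f0] := eqVneq (rnorm f) 0.
  by rewrite (eqP f0) mulr_ge0 ?C2_ge0 ?rnorm_ge0.
have fp : 0 < rnorm f by rewrite lt_neqAle eq_sym f0 rnorm_ge0.
have h : rnorm (hdot f f) <= C2 * (rnorm (Aop f) * rnorm f).
  have c : (fun N => rnorm (hdot (trunc N f) f)) @ \oo --> rnorm (hdot f f).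
    by apply: cvg_rnorm; apply: (@hdot_hlim R (fun N => trunc N f)); exact: hlim_trunc.
  apply: cvgr_to_le c _; apply: filterE => N.
  rewrite hdotC expr0 mul1r rnorm_conj; apply: le_trans (hdot_trunc_bound N f fg) _.
  by rewrite ler_wpM2l ?C2_ge0// ler_wpM2l ?rnorm_ge0// hnorm_trunc.
by rewrite hdotE rnormR ger0_norm ?sqr_ge0// expr2 mulrA ler_pM2r in h.
Qed.

Lemma Aop_bound f : rnorm (Aop f) <= 2 * rnorm f.
Proof.
apply: le_trans (vnorm_le_sub _ _) _; rewrite vnormZ rnorm_cexp raddfN /= oppr0 expR0 mul1r.
by rewrite -[2]/(1 + 1) mulrDl mul1r lerD2l hnorm_bshift.
Qed.

(** [C2] is the same for all good [f] and [m0 - X] is bounded, so the estimate passes from the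
    projections [pproj U N f] to their limit. *)
Lemma bounded_below_regular : exists C, forall f, inK U f -> rnorm f <= C * rnorm (Aop f).
Proof.
exists C2 => f fK; apply/ler_addgt0Pr => e e0; have C0 := C2_ge0.
have e1 : 0 < e / (1 + C2 * 2) by rewrite divr_gt0// ltr_pwDl// mulr_ge0.
have [N hN] := hlim_pproj orthoU fK e1; have {hN} := hN N (leqnn N).
set g := pproj U N f => hfg.
have gg : good_resF U tau A g := good_pproj orthoU A0 delta0 UM Uhol Udelta Uae A1 N f.
have hg := bounded_below_good gg.
have h1 : rnorm f <= rnorm g + rnorm (f - g).
  by rewrite addrC; have := vnormD (f - g) g; rewrite subrK.
have h2 : rnorm (Aop g) <= rnorm (Aop f) + 2 * rnorm (f - g).
  have -> : Aop g = Aop f - Aop (f - g).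
    rewrite bshiftB scalerBr; apply: hardyP => n.
    by rewrite !(coefD, coefN, coefZ); ring.
  by apply: le_trans (vnorm_le_sub _ _) _; rewrite lerD2l; exact: Aop_bound.
move: h1 h2 hg hfg; move: (rnorm f) (rnorm g) (rnorm (f - g)) (rnorm (Aop f)) (rnorm (Aop g)).
move=> x y d X Y h1 h2 hg hd.
have h3 : C2 * Y <= C2 * (X + 2 * d) by rewrite ler_wpM2l.
have h4 : (1 + C2 * 2) * d <= e.
  by rewrite mulrC -ler_pdivlMr// ltr_pwDl// mulr_ge0.
have h5 : C2 * (X + 2 * d) = C2 * X + C2 * 2 * d by ring.
have h6 : (1 + C2 * 2) * d = d + C2 * 2 * d by ring.
lra.
Qed.

End Estimate.

(** * Points of the circle: dense range, and onto against bounded below *)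

Section UnitCircle.
Variables (R : realType) (U : hardy R).
Hypothesis orthoU : forall k : nat, hdot (iter k (@bshift R) U) U = (k == 0%N)%:R.
Variable m : R[i].
Hypothesis m1 : rnorm m = 1.
Implicit Types (f g h : hardy R) (r : R).
Notation bX := (@bshift R).
Notation A f := (m *: f - bX f).
Notation Ar r f := (m *: f - (r%:C%C) *: bX f).

Lemma ArB r f g : Ar r (f - g) = Ar r f - Ar r g.
Proof.
by rewrite bshiftB !scalerBr !opprD !opprK addrACA.
Qed.

Lemma Ar_bound r g : 0 <= r -> (1 - r) * rnorm g <= rnorm (Ar r g).
Proof.
move=> r0; apply: le_trans (vnorm_sub_le _ _).
rewrite !vnormZ m1 rnormR ger0_norm// mul1r mulrBl mul1r lerD2l lerN2.
by apply: ler_wpM2l => //; exact: hnorm_bshift.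
Qed.

Lemma Ar_solve r f : 0 < r < 1 -> inK U f -> exists2 g, inK U g & Ar r g = f.
Proof.
move=> /andP[r0 r1] fK; have c0 : r%:C%C != 0 :> R[i].
  by rewrite -rnorm_eq0 rnormR normr_eq0 gt_eqF.
have h : 1 < rnorm (m / r%:C%C).
  by rewrite rnormM rnormV m1 rnormR mul1r ger0_norm ?(ltW r0)// invf_gt1.
have [g [gK e]] := resolvent_outer orthoU h (inKZ (r%:C%C)^-1 fK).
exists g => //; have := congr1 (fun x => r%:C%C *: x) e.
by rewrite scalerBr !scalerA mulfV// scale1r mulrC divfK.
Qed.

Lemma Ar_iter n r g : Ar r (iter n bX g) = iter n bX (Ar r g).
Proof. by elim: n => [//|n IH]; rewrite [RHS]/= -IH bshiftB !bshiftZ. Qed.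

(** [|h| <= |(m - r X) h| + |X h|], used [N] times along the orbit of [g], with [m - r X] commuting
    with [X]. *)
Lemma Ar_abel N r g : 0 <= r <= 1 -> rnorm g <= N%:R * rnorm (Ar r g) + rnorm (iter N bX g).
Proof.
move=> /andP[r0 r1].
have step h : rnorm h <= rnorm (Ar r h) + rnorm (bX h).
  have -> : rnorm h = rnorm (Ar r h + r%:C%C *: bX h).
    by rewrite subrK vnormZ m1 mul1r.
  apply: le_trans (vnormD _ _) _; rewrite lerD2l vnormZ rnormR ger0_norm//.
  by rewrite ler_piMl ?rnorm_ge0.
elim: N => [|N IH]; first by rewrite mul0r add0r.
apply: le_trans IH _; rewrite -natr1 mulrDl mul1r -addrA lerD2l.
apply: le_trans (step _) _; rewrite lerD2r Ar_iter; exact: hnorm_iter_bshift.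
Qed.

(** An Abel form of the mean ergodic theorem. For fixed [N], [Ar_abel] bounds [(1 - r) |g|] by
    [(1 - r) N |f|], small for [r] near 1, plus [|X^N f|]. *)
Lemma abel_small f (e : R) : 0 < e -> exists2 r0 : R, 0 < r0 < 1 &
  forall r g, r0 <= r < 1 -> Ar r g = f -> (1 - r) * rnorm g <= e.
Proof.
move=> e0; have e2 : 0 < e / 2 by rewrite divr_gt0.
have [N /(_ N (leqnn N)) hN] := iter_bshift_cvg0 f e2.
pose d := e / 2 / (N%:R * rnorm f + 1 + e).
have f0 : 0 <= N%:R * rnorm f by rewrite mulr_ge0 ?rnorm_ge0.
have D0 : 0 < N%:R * rnorm f + 1 + e by lra.
have d0 : 0 < d by rewrite divr_gt0.
have d1 : d < 1 by rewrite ltr_pdivrMr// mul1r; lra.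
exists (1 - d); first by apply/andP; split; lra.
move=> r g /andP[r0 r1] eg; have rp : 0 <= r by lra.
have h1 := @Ar_abel N r g; rewrite eg rp (ltW r1) in h1.
have h2 : (1 - r) * rnorm (iter N bX g) <= e / 2.
  by apply: le_trans hN; apply: le_trans (Ar_bound _ rp) _; rewrite Ar_iter eg.
have r10 : 0 <= 1 - r by lra.
apply: le_trans (ler_wpM2l r10 (h1 isT)) _; rewrite mulrDr.
suff k : (1 - r) * (N%:R * rnorm f) <= e / 2 by rewrite [leRHS]splitr; exact: lerD k h2.
apply: (@le_trans _ _ (d * (N%:R * rnorm f + 1 + e))); last by rewrite /d divfK// gt_eqF.
by apply: ler_pM => //; lra.
Qed.

Lemma A_Ar r g : A g = Ar r g - (1 - r)%:C%C *: bX g.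
Proof.
by rewrite rmorphB rmorph1 scalerBl scale1r opprB addrA subrK.
Qed.

(** For [g] the solution of [(m - r X) g = f], the error [f - A g] is [(1 - r) X g]. *)
Lemma dense_range f (e : R) : inK U f -> 0 < e -> exists2 g, inK U g & rnorm (f - A g) <= e.
Proof.
move=> fK e0; have [r r01 h] := abel_small f e0; have /andP[r0 r1] := r01.
have [g gK eg] := Ar_solve r01 fK; exists g => //.
have := h r g; rewrite lexx r1 => /(_ isT eg); apply: le_trans.
rewrite (A_Ar r) eg opprB addrC subrK vnormZ rnormR ger0_norm ?subr_ge0 ?(ltW r1)//.
by apply: ler_wpM2l; [rewrite subr_ge0 ltW|exact: hnorm_bshift].
Qed.

Lemma A_bound f : rnorm (A f) <= 2 * rnorm f.
Proof.
apply: le_trans (vnorm_le_sub _ _) _; rewrite vnormZ m1 mul1r.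
by rewrite -[2]/(1 + 1 : R) mulrDl mul1r lerD2l hnorm_bshift.
Qed.

Lemma AB f g : A (f - g) = A f - A g.
Proof. by have := @ArB 1 f g; rewrite !scale1r. Qed.

(** Approximate preimages exist by density, and the lower bound makes them a Cauchy sequence. *)
Lemma surjective_of_bounded_below C : (forall f, inK U f -> rnorm f <= C * rnorm (A f)) ->
  forall f, inK U f -> exists2 g, inK U g & A g = f.
Proof.
move=> hC f fK.
have /choice[s hs] : forall n : nat, exists g, inK U g /\ rnorm (f - A g) <= n.+1%:R^-1.
  by move=> n; have [|g] := @dense_range f n.+1%:R^-1 fK; [rewrite invr_gt0|exists g].
have C0 : 0 <= `|C| + 1 by rewrite addr_ge0.
have hC' g : inK U g -> rnorm g <= (`|C| + 1) * rnorm (A g).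
  move=> /hC h; apply: le_trans h _; rewrite ler_wpM2r ?rnorm_ge0//.
  by apply: le_trans (ler_norm _) _; rewrite lerDl.
have small (e : R) : 0 < e -> exists N, forall n, (N <= n)%N -> n.+1%:R^-1 <= e.
  move=> e0; have /cvgrPdist_le/(_ _ e0)[N _ hN] := @cvg_harmonic R.
  by exists N => n /hN /=; rewrite sub0r normrN ger0_norm// invr_ge0.
have [g hg] : exists g, hlim s g.
  apply: hardy_complete => e e0.
  have e1 : 0 < e / (2 * (`|C| + 1)) by rewrite divr_gt0// mulr_gt0// ltr_wpDl.
  have [N hN] := small _ e1; exists N => p q Np Nq.
  apply: le_trans (hC' _ (inKB (hs p).1 (hs q).1)) _; rewrite AB.
  have k n : (N <= n)%N -> rnorm (A (s n) - f) <= e / (2 * (`|C| + 1)).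
    by move=> /hN h; rewrite vnormB; exact: le_trans (hs n).2 h.
  have : rnorm (A (s p) - A (s q)) <= e / (2 * (`|C| + 1)) + e / (2 * (`|C| + 1)).
    apply: le_trans (vnorm_tri _ f _) _; apply: lerD; first exact: k.
    by rewrite vnormB; exact: k.
  move=> h; apply: le_trans (ler_wpM2l C0 h) _.
  rewrite le_eqVlt; apply/orP; left; apply/eqP; field.
  by rewrite gt_eqF// ltr_wpDl.
have gK : inK U g by apply: inK_hlim hg _ => n; exact: (hs n).1.
exists g => //; apply: eq_vnorm_small => e e0.
have e4 : 0 < e / 4 by rewrite divr_gt0.
have [N1 h1] := hg _ e4; have [N2 h2] := small _ e4; pose n := maxn N1 N2.
apply: (@vnorm_half _ _ _ (A (s n))).
  rewrite -AB; apply: le_trans (A_bound _) _.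
  apply: le_trans (ler_wpM2l _ (h1 n (leq_maxl _ _))) _ => //; lra.
by apply: le_trans (hs n).2 _; apply: le_trans (h2 n (leq_maxr _ _)) _; lra.
Qed.

(* A gliding hump: if [A] were onto but not bounded below, the operators
   [(m - r X)^-1], which are bounded by [1 / (1 - r)] and satisfy
   [|(m - r X)^-1 A g| <= 2 |g|], would be unbounded at some point of the range. *)
Lemma bounded_below_of_surjective :
  (forall f, inK U f -> exists2 g, inK U g & A g = f) ->
  exists C, forall g, inK U g -> rnorm g <= C * rnorm (A g).
Proof.
move=> surj; apply: contrapT => nb.
have unb C : exists g, inK U g /\ C * rnorm (A g) < rnorm g.
  apply: contrapT => h; apply: nb; exists C => g gK; rewrite leNgt; apply/negP => k.
  by apply: h; exists g.
(* A state is a center and a radius. The next center has a resolvent value of norm at least [n] for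
   some [r], and its radius is at most [(1 - r) / 2]: later displacements, in total at most twice
   the radius, change that value by at most 1. *)
pose inv (p : hardy R * R) := inK U p.1 /\ 0 < p.2.
pose good n (p q : hardy R * R) := [/\ rnorm (q.1 - p.1) <= p.2, q.2 <= p.2 / 2 &
  exists r g, [/\ 0 < r < 1, q.2 <= (1 - r) / 2, Ar r g = q.1 & n%:R <= rnorm g]].
have step (np : nat * (hardy R * R)) : exists q, inv np.2 -> inv q /\ good np.1 np.2 q.
  case: np => n [x s] /=; have [[/= xK s0]|ni] := pselect (inv (x, s)); last by exists (x, s).
  (* This constant makes [t |h|] at least [n + 1] below, where [t = s / |y|] and
     [|h| >= |g0| / 2]. *)
  have [g0 [g0K hg0]] := unb (2 * n.+1%:R / s).
  set y := A g0 in hg0; have yK : inK U y by apply: inKB; [exact: inKZ|exact: inKX].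
  have g0n : 0 < rnorm g0.
    by apply: le_lt_trans hg0; rewrite mulr_ge0 ?rnorm_ge0// divr_ge0 ?mulr_ge0// ltW.
  have y0 : 0 < rnorm y.
    rewrite lt_neqAle eq_sym rnorm_ge0 andbT; apply: contraTneq g0n => /eqP; rewrite vnorm_eq0 => /eqP yz.
    by rewrite (@shift_eigen_ge1 _ m g0) ?vnorm0 ?ltxx// m1.
  have g2 : 0 < rnorm g0 / 2 by rewrite divr_gt0.
  have [r r01 hr] := abel_small (bX g0) g2; have /andP[r0 r1] := r01.
  have [k kK ek] := Ar_solve r01 (inKX g0K).
  have kb : (1 - r) * rnorm k <= rnorm g0 / 2 by apply: hr ek; rewrite lexx r1.
  (* The solution of [(m - r X) h = A g0], as [k] solves the equation for [X g0]; by the choice of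
     [r] the correction is at most half of [g0] in norm. *)
  pose h := g0 - (1 - r)%:C%C *: k.
  have eh : Ar r h = y.
    rewrite /h ArB bshiftZ !scalerA mulrC [r%:C%C * _]mulrC -!scalerA -scalerBr ek /y (A_Ar r).
    by [].
  have hb : rnorm g0 / 2 <= rnorm h.
    have := vnorm_sub_le g0 ((1 - r)%:C%C *: k); rewrite vnormZ rnormR ger0_norm ?subr_ge0 ?(ltW r1)//.
    by move: kb; rewrite -/h; move: (_ * _) (rnorm h) (rnorm g0) => a b c; lra.
  pose t : R := s / rnorm y; have t0 : 0 < t by rewrite divr_gt0.
  have [w wK ew] := Ar_solve r01 xK.
  have hn : n.+1%:R <= rnorm (t%:C%C *: h).
    rewrite vnormZ rnormR ger0_norm ?(ltW t0)//; apply: le_trans (ler_wpM2l (ltW t0) hb).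
    rewrite /t mulrA ler_pdivlMr// mulrAC ler_pdivlMr//.
    by move: hg0; rewrite mulrAC ltr_pdivrMr// => /ltW; rewrite [2 * _]mulrC [_ * s]mulrC.
  have hE c : Ar r (w + c *: h) = x + c *: y.
    have -> : w + c *: h = w - (- c) *: h by rewrite scaleNr opprK.
    rewrite ArB ew bshiftZ !scalerA mulrC [r%:C%C * _]mulrC -!scalerA -scalerBr eh.
    by rewrite scaleNr opprK.
  (* [w + t h] and [w - t h] differ by [2 t h], so one of them has norm at least [t |h|]. *)
  have [c cn cw] : exists2 c : R[i], rnorm c = t & n.+1%:R <= rnorm (w + c *: h).
    have tn : rnorm (t%:C%C : R[i]) = t by rewrite rnormR ger0_norm// ltW.
    have /orP[hw|hw] := le_total n.+1%:R (rnorm (w + t%:C%C *: h)).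
      by exists t%:C%C; [exact: tn|exact: hw].
    exists (- t%:C%C); first by rewrite rnormN; exact: tn.
    have e2 : 2%:C%C *: (t%:C%C *: h) = (w + t%:C%C *: h) - (w + (- t%:C%C) *: h).
      by rewrite rmorph_nat scaler_nat mulr2n scaleNr opprD opprK addrACA subrr add0r.
    have := congr1 (@rnorm R _) e2; rewrite vnormZ rnormR normr_nat => e3.
    have := vnorm_le_sub (w + t%:C%C *: h) (w + (- t%:C%C) *: h); rewrite -e3.
    move: hn hw; move: (rnorm (w + t%:C%C *: h)) (rnorm (w + (- t%:C%C) *: h)) (rnorm (t%:C%C *: h)) => a b d.
    by lra.
  exists (x + c *: y, Num.min (s / 2) ((1 - r) / 2)) => _; split.
    split=> /=; first by apply: inKD => //; exact: inKZ.
    by rewrite lt_min !divr_gt0// subr_gt0.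
  split=> /=.
  - by rewrite addrC addKr vnormZ cn /t divfK// gt_eqF.
  - by rewrite ge_min lexx.
  - exists r, (w + c *: h); split=> //; first by rewrite ge_min lexx orbT.
    by apply: le_trans cw; rewrite ler_nat.
have [F hF] := choice step.
pose p := fix p n := if n is k.+1 then F (k, p k) else (0 : hardy R, 1 : R).
have pinv n : inv (p n).
  elim: n => [|n IH]; first by split; [exact: inK0|exact: ltr01].
  by have [] := hF (n, p n) IH.
have pgood n : good n (p n) (p n.+1) by have [] := hF (n, p n) (pinv n).
have s0 n : 0 < (p n).2 by have [] := pinv n.
have tail n k : rnorm ((p (n + k)%N).1 - (p n).1) <= 2 * (p n).2 - 2 * (p (n + k)%N).2.
  elim: k => [|k IH]; first by rewrite addn0 !subrr vnorm0.
  have [h1 h2 _] := pgood (n + k)%N; rewrite addnS.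
  apply: le_trans (vnorm_tri _ (p (n + k)%N).1 _) _.
  move: h1 h2 IH; move: (rnorm _) (rnorm _) (_.2) (_.2) (_.2) => a b c d e; lra.
have tail' n k : rnorm ((p (n + k)%N).1 - (p n).1) <= 2 * (p n).2.
  by apply: le_trans (tail n k) _; rewrite lerBlDr lerDl mulr_ge0// ltW.
have sN n : (p n).2 <= half 1 n.
  elim: n => [|n IH]; first by rewrite /half expr0 divr1.
  have [_ h _] := pgood n; apply: le_trans h _; rewrite /half exprSr invfM mulrA.
  by rewrite ler_wpM2r// invr_ge0.
have [x hx] : exists x, hlim (fun n => (p n).1) x.
  apply: hardy_complete => e e0; have e4 : 0 < e / 4 by rewrite divr_gt0.
  have [N hN] := half_small ler01 e4; exists N => a b Na Nb.
  have k c : (N <= c)%N -> rnorm ((p c).1 - (p N).1) <= e / 2.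
    move=> Nc; rewrite -(subnKC Nc); apply: le_trans (tail' _ _) _.
    by have := sN N; move: hN; move: (half 1 N) (p N).2 => u v; lra.
  by apply: vnorm_half (k _ Na) (k _ Nb).
have xK : inK U x by apply: inK_hlim hx _ => n; have [] := pinv n.
have [g gK eg] := surj x xK.
have close n : rnorm (x - (p n).1) <= 2 * (p n).2.
  apply/ler_addgt0Pr => e e0; have [N hN] := hx _ e0.
  have := hN (n + N)%N (leq_addl _ _) => h.
  apply: le_trans (vnorm_tri _ (p (n + N)%N).1 _) _; rewrite addrC.
  by apply: lerD; [exact: tail'|exact: h].
(* The contradiction will be [n <= |k| <= |h| + 1 <= 2 |g| + 1], where [h] is the resolvent value at
   the limit point [x]. *)
pose n := (Num.truncn (2 * rnorm g + 1)).+1.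
have nb' : 2 * rnorm g + 1 < n%:R by rewrite truncnS_gt.
have [_ _ [r [k [r01 h2 ek kn]]]] := pgood n; have /andP[r0 r1] := r01.
have [h hK eh] := Ar_solve r01 xK.
have d0 : 0 < 1 - r by rewrite subr_gt0.
have hb : rnorm h <= 2 * rnorm g.
  have [q qK eq] := Ar_solve r01 (inKX gK).
  have e : Ar r (h - (g - (1 - r)%:C%C *: q)) = 0.
    rewrite ArB eh ArB bshiftZ !scalerA mulrC [r%:C%C * _]mulrC -!scalerA -scalerBr eq.
    by rewrite -A_Ar eg subrr.
  have := Ar_bound (h - (g - (1 - r)%:C%C *: q)) (ltW r0); rewrite e vnorm0 pmulr_rle0//.
  move=> e'; have {e'} : rnorm (h - (g - (1 - r)%:C%C *: q)) == 0 by rewrite eq_le e' rnorm_ge0.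
  rewrite vnorm_eq0 subr_eq0 => /eqP ->; apply: le_trans (vnorm_le_sub _ _) _.
  rewrite -[2]/(1 + 1 : R) mulrDl mul1r lerD2l vnormZ rnormR ger0_norm ?(ltW d0)//.
  apply: le_trans (Ar_bound q (ltW r0)) _; rewrite eq; exact: hnorm_bshift.
have hk : rnorm (h - k) <= 1.
  have := Ar_bound (h - k) (ltW r0); rewrite ArB eh ek => e.
  rewrite -(ler_pM2l d0) mulr1; apply: le_trans e _; apply: le_trans (close n.+1) _.
  by rewrite mulrC -ler_pdivlMr.
have := vnorm_sub_le k h; rewrite vnormB.
move: kn nb' hb hk; move: (rnorm k) (rnorm h) (rnorm g) (rnorm _) (n%:R) => a b c d e.
by lra.
Qed.

End UnitCircle.

(** * Bounded operators on a normed space *)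

Section NormedOperators.
Variables (R : realType) (V : normedModType R[i]).
Implicit Types (x y : V) (A B : V -> V).

Lemma vnbhsP x (P : set V) :
  nbhs x P <-> exists2 d : R, 0 < d & forall w, rnorm (x - w) < d -> P w.
Proof.
split=> [/nbhs_ballP[[a b]]|[d d0 h]].
  rewrite /= ltcE /= => /andP[/eqP -> a0] h; exists a => // w zw; apply: h.
  by rewrite -ball_normE /ball_ /= normr_rnorm ltcR.
apply/nbhs_ballP; exists d%:C%C; first by rewrite /= ltcR.
by move=> w; rewrite -ball_normE /ball_ /= normr_rnorm ltcR => /h.
Qed.

Lemma linear_opB A x y : linear A -> A (x - y) = A x - A y.
Proof. by move=> lA; have e := lA (-1) y x; rewrite !scaleN1r in e; rewrite addrC e addrC. Qed.

Lemma linear_op0 A : linear A -> A 0 = 0.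
Proof. by move=> lA; have := linear_opB 0 0 lA; rewrite !subrr. Qed.

Lemma linear_opZ A c x : linear A -> A (c *: x) = c *: A x.
Proof.
move=> lA; have e := lA c x 0; rewrite (linear_op0 lA) in e.
by rewrite -[c *: x]addr0 e; exact: addr0.
Qed.

Lemma bounded_opP A : bounded_op A <->
  linear A /\ exists2 C : R, 0 <= C & forall x, rnorm (A x) <= C * rnorm x.
Proof.
split=> [[lA cA]|[lA [C C0 hC]]]; split=> //; last first.
  move=> x P /vnbhsP[d d0 hd]; apply/vnbhsP.
  have C1 : 0 < C + 1 by rewrite ltr_wpDl.
  exists (d / (C + 1)); first by rewrite divr_gt0.
  move=> w; rewrite ltr_pdivlMr// => h; apply: hd; rewrite -linear_opB//.
  apply: le_lt_trans (hC _) _; apply: le_lt_trans h; rewrite mulrC.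
  by apply: ler_wpM2l; rewrite ?rnorm_ge0// lerDl.
have : nbhs (A 0) [set y | rnorm y < 1].
  apply/vnbhsP; exists 1 => // w; rewrite linear_op0// sub0r vnormN.
  by [].
move=> /(cA 0)/vnbhsP[d d0 hd]; exists (2 / d); first by rewrite divr_ge0// ltW.
move=> x; have [/eqP|x0] := eqVneq (rnorm x) 0.
  by rewrite vnorm_eq0 => /eqP ->; rewrite linear_op0// vnorm0 mulr0.
have xp : 0 < rnorm x by rewrite lt_neqAle eq_sym x0 rnorm_ge0.
pose t : R := d / 2 / rnorm x; have t0 : 0 < t by rewrite !divr_gt0.
have := hd (t%:C%C *: x); rewrite sub0r vnormN vnormZ rnormR ger0_norm ?(ltW t0)//.
rewrite {1}/t divfK// ltr_pdivrMr// ltr_pMr// ltr1n => /(_ isT) /=.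
rewrite linear_opZ// vnormZ rnormR ger0_norm ?(ltW t0)// /t => h.
have -> : 2 / d * rnorm x = (d / 2 / rnorm x)^-1 by field; rewrite x0 gt_eqF.
by rewrite -[leRHS]mul1r ler_pdivlMr ?divr_gt0// mulrC ltW.
Qed.

Lemma closed_seqP (P : set V) : closed P <->
  forall x, (forall e : R, 0 < e -> exists2 y, P y & rnorm (x - y) <= e) -> P x.
Proof.
split=> [cP x h|h x cx].
  apply: cP => B /vnbhsP[d d0 hd]; have d2 : 0 < d / 2 by rewrite divr_gt0.
  have [y Py xy] := h _ d2; exists y; split=> //; apply: hd.
  by apply: le_lt_trans xy _; rewrite ltr_pdivrMr// ltr_pMr// ltr1n.
apply: h => e e0; have : nbhs x [set y | rnorm (x - y) <= e].
  by apply/vnbhsP; exists e => // w /= /ltW.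
by move=> /cx[y [Py xy]]; exists y.
Qed.

Lemma bounded_op_comp A B : bounded_op A -> bounded_op B -> bounded_op (fun x => A (B x)).
Proof.
move=> /bounded_opP[lA [C C0 hC]] /bounded_opP[lB [D D0 hD]]; apply/bounded_opP; split.
  by move=> c x y; rewrite lB lA.
exists (C * D); first by rewrite mulr_ge0.
by move=> x; apply: le_trans (hC _) _; rewrite -mulrA ler_wpM2l.
Qed.

Lemma bounded_op_lin A (a b : R[i]) : bounded_op A -> bounded_op (fun x => a *: x + b *: A x).
Proof.
move=> /bounded_opP[lA [C C0 hC]]; apply/bounded_opP; split.
  move=> c x y; rewrite lA !scalerDr !scalerA addrACA [c * a]mulrC [c * b]mulrC.
  by rewrite [b * c]mulrC [a * c]mulrC.
exists (rnorm a + rnorm b * C); first by rewrite addr_ge0 ?mulr_ge0 ?rnorm_ge0.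
move=> x; apply: le_trans (vnormD _ _) _; rewrite !vnormZ mulrDl lerD2l -mulrA.
by apply: ler_wpM2l; rewrite ?rnorm_ge0.
Qed.

Lemma inverse_op_inj A B : inverse_op A B -> injective A.
Proof. by move=> [_ h _]; exact: can_inj h. Qed.

Lemma inverse_op_uniq A B B' : inverse_op A B -> inverse_op A B' -> B = B'.
Proof.
move=> h [_ k1 k2]; have iA := inverse_op_inj h; case: h => _ h1 h2.
by apply/funext => x; apply: iA; rewrite h2 k2.
Qed.

Lemma opinvP A B : inverse_op A B -> opinv A = B.
Proof.
move=> h; rewrite /opinv; case: xgetP => [C _ /= hC|/(_ B)/(_ h)//].
exact: inverse_op_uniq hC h.
Qed.

Lemma inverse_op_exists A C : bounded_op A ->
  (forall x, rnorm x <= C * rnorm (A x)) -> (forall y, exists x, A x = y) ->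
  exists B, inverse_op A B.
Proof.
move=> [lA _] hC sA; have [B hB] := choice sA.
have iA : injective A.
  move=> x y e; apply/eqP; rewrite -subr_eq0 -vnorm_eq0; apply/eqP/le_anti.
  rewrite rnorm_ge0 andbT; apply: le_trans (hC _) _.
  by rewrite linear_opB// e subrr vnorm0 mulr0.
exists B; split=> //; last by move=> x; apply: iA; rewrite hB.
apply/bounded_opP; split; first by move=> c x y; apply: iA; rewrite lA !hB.
exists `|C| => // x; apply: le_trans (hC _) _; rewrite hB.
by rewrite ler_wpM2r ?rnorm_ge0// ler_norm.
Qed.

Lemma inverse_op_below A B : inverse_op A B -> exists C, forall x, rnorm x <= C * rnorm (A x).
Proof.
move=> [/bounded_opP[_ [C _ hC]] h _]; exists C => x.
by rewrite -{1}(h x); exact: hC.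
Qed.

(** The constant [C] guarantees that the set in [opnorm] is bounded, so that its [sup] is an upper
    bound. *)
Lemma opnorm_ge A (C : R) x : (forall x, rnorm (A x) <= C * rnorm x) ->
  rnorm x <= 1 -> rnorm (A x) <= opnorm A.
Proof.
move=> hC x1; apply: ub_le_sup; last by exists x => //=; rewrite normr_rnorm lecR.
exists `|C| => _ [y /= y1 <-]; rewrite normr_rnorm lecR in y1.
apply: le_trans (hC _) _; apply: le_trans (_ : `|C| * rnorm y <= _).
  by rewrite ler_wpM2r ?rnorm_ge0// ler_norm.
by rewrite -[leRHS]mulr1 ler_wpM2l.
Qed.

End NormedOperators.

(** * The model space of an inner function *)

Section ModelSpaceElements.
Variables (R : realType) (u : R[i] -> R[i]).
Hypothesis u_inner : inner_function u.
Notation U := (inner_coef u_inner).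
Notation orthoU := (inner_orthonormal u_inner).
Notation fS := (@fshift R).
Implicit Types (f g h : hardy R).

Lemma hdot_suml N (F : nat -> hardy R) g :
  hdot (\sum_(k < N) F k) g = \sum_(k < N) hdot (F k) g.
Proof.
by elim: N => [|N IH]; rewrite ?big_ord0 ?linear0l// !big_ord_recr linearDl /= IH.
Qed.

Lemma hone_ortho k : hdot (iter k (@bshift R) (hone R)) (hone R) = (k == 0%N)%:R.
Proof. by rewrite hone_coef0 iter_bshiftE. Qed.

Lemma heval_hone z : rnorm z < 1 -> heval (hone R) z = 1.
Proof.
move=> z1; rewrite heval_split//.
have -> : bshift (hone R) = 0 by exact: hardyP.
by have := hevalZ 0 0 z1; rewrite scale0r mul0r => ->; rewrite mulr0 addr0.
Qed.

(** The shifts of [U] and those of the constant 1 are both orthonormal: multiplication by [U] is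
    isometric on polynomials. *)
Lemma shift_comb_norm (a : nat -> R[i]) N :
  rnorm (\sum_(k < N) a k *: iter k fS U) = rnorm (\sum_(k < N) a k *: iter k fS (hone R)).
Proof.
suff E V : (forall k, hdot (iter k (@bshift R) V) V = (k == 0%N)%:R) ->
    hdot (\sum_(k < N) a k *: iter k fS V) (\sum_(k < N) a k *: iter k fS V) =
    \sum_(k < N) a k * (a k)^*.
  have := etrans (E U orthoU) (esym (E (hone R) hone_ortho)); rewrite !hdotE => -[e].
  by apply/eqP; rewrite -(@eqrXn2 _ 2) ?rnorm_ge0//; apply/eqP.
move=> oV; rewrite (hdot_suml N (fun k => a k *: iter k fS V)); apply: eq_bigr => k _ /=.
rewrite linear_sumr (bigD1 k)//= big1 => [|j jk].
  by rewrite addr0 linearZl_LR linearZr_LR /= (orthoS oV) eqxx mulr1.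
by rewrite linearZl_LR linearZr_LR /= (orthoS oV) (inj_eq val_inj) eq_sym (negbTE jk) !mulr0.
Qed.

(** The partial sums of [h], multiplied by [U], form a Cauchy sequence by isometry. Their limit
    takes the values [u h], so it is [g], and each of them is orthogonal to [f]. *)
Lemma inner_multiple_perp f g : inK U f -> inner_multiples u g -> hdot f g = 0.
Proof.
move=> fK [h hg]; pose s V N := \sum_(k < N) h k *: iter k fS V.
have sub V M N : (M <= N)%N -> s V N - s V M =
    \sum_(k < N) (if (k < M)%N then 0 else h k) *: iter k fS V.
  move=> MN; rewrite /s -(subnKC MN) !big_split_ord /= addrAC.
  rewrite subrr add0r [in RHS]big1 ?add0r => [|i _]; last by rewrite ltn_ord scale0r.
  by apply: eq_bigr => i _; rewrite ltnNge leq_addr.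
have sn M N : (M <= N)%N -> rnorm (s U N - s U M) = rnorm (s (hone R) N - s (hone R) M).
  by move=> MN; rewrite !sub// (shift_comb_norm (fun k => if (k < M)%N then 0 else h k)).
have [G hG] : exists G, hlim (s U) G.
  apply: hardy_complete => e e0; have e2 : 0 < e / 2 by rewrite divr_gt0.
  have [N hN] := hlim_trunc h e2.
  exists N.
  move=> p q Np Nq; wlog pq : p q Np Nq / (p <= q)%N.
    by move=> H; have /orP[pq|qp] := leq_total p q; [exact: H|rewrite vnormB; exact: H].
  rewrite vnormB sn// vnormB; apply: (@vnorm_half _ _ _ h); rewrite vnormB; exact: hN.
have eG : g = G.
  apply/eqP; rewrite -subr_eq0; apply/eqP/heval_eq0 => z z1.
  rewrite -scaleN1r hevalD// hevalZ// mulN1r; apply/eqP; rewrite subr_eq0; apply/eqP.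
  rewrite hg; last by apply/diskP.
  have c1 : (fun N => heval (s U N) z) @ \oo --> heval G z by exact: heval_hlim.
  have c2 : (fun N => heval (s U N) z) @ \oo --> u z * heval h z.
    have e N : heval (s U N) z = u z * heval (trunc N h) z.
      rewrite /s /trunc (heval_sum N (fun k => h k *: iter k fS U))//.
      rewrite (heval_sum N (fun k => h k *: iter k fS (hone R)))// mulr_sumr.
      apply: eq_bigr => k _; rewrite !hevalZ// !heval_iter_fshift// heval_inner// heval_hone//.
      by ring.
    under eq_fun do rewrite e.
    apply: cvgCM; first exact: cvg_cst.
    by apply: heval_hlim => //; exact: hlim_trunc.
  rewrite -(cvg_lim (@norm_hausdorff _ R[i]) c1).
  exact/esym/(cvg_lim (@norm_hausdorff _ R[i]) c2).
rewrite eG hdot_conj (hdot_hlim0 hG) ?rmorph0// => N.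
rewrite /s (hdot_suml N (fun k => h k *: iter k fS U)) big1// => k _; rewrite linearZl_LR /= hdot_conj fK rmorph0 mulr0.
by [].
Qed.

Lemma inKP f : f \in orth_inner_multiples u <-> inK U f.
Proof.
split=> [/asboolP h k|fK]; last by apply/asboolP => g; exact: inner_multiple_perp.
apply: h; exists (iter k fS (hone R)) => z /diskP z1.
by rewrite !heval_iter_fshift// heval_inner// heval_hone// mulr1 mulrC.
Qed.

Definition Kof f (fK : inK U f) : model_space u := ModelSpace (proj2 (inKP f) fK).

Lemma mval_inK (x : model_space u) : inK U (mval x).
Proof. exact/inKP/mvalP. Qed.

Lemma model_rnorm (x : model_space u) : rnorm x = rnorm (mval x). Proof. by []. Qed.

End ModelSpaceElements.

(** * Invertibility, kernel and range of [m - X] on K_u *)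

Section ModelShift.
Variables (R : realType) (u : R[i] -> R[i]).
Hypothesis u_inner : inner_function u.
Notation U := (inner_coef u_inner).
Notation orthoU := (inner_orthonormal u_inner).
Notation K := (model_space u).
Implicit Types (x y : K) (f g : hardy R) (e m z : R[i]).

(** One [d] serves for the distance and for the value, since decreasing it strengthens both
    conditions. *)
Lemma inner_spectrumP l : inner_spectrum u l <-> rnorm l <= 1 /\
  forall d : R, 0 < d -> exists z, [/\ rnorm z < 1, rnorm (l - z) < d & rnorm (u z) < d].
Proof.
rewrite /inner_spectrum /= normr_rnorm lecR limf_einfE; split=> -[l1 h]; split=> //.
  move=> d d0; apply: contrapT => hz.
  have hd z : rnorm z < 1 -> rnorm (l - z) < d -> d <= rnorm (u z).
    by move=> z1 zd; rewrite leNgt; apply/negP => uz; apply: hz; exists z.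
  have : (d%:E <= limf_einf (fun z => (rnorm (u z))%:E) (within (@disk R) (nbhs l)))%E.
    rewrite limf_einfE; apply: le_ereal_sup_tmp.
    exists (ereal_inf [set (rnorm (u z))%:E | z in [set z | rnorm z < 1 /\ rnorm (l - z) < d]]).
      exists [set z | rnorm z < 1 /\ rnorm (l - z) < d] => //.
      by apply/nbhsCP; exists d => // z zd /diskP.
    by apply: le_ereal_inf_tmp => _ [z [z1 zd] <-]; rewrite lee_fin; exact: hd.
  by rewrite limf_einfE h lee_fin leNgt d0.
apply/le_anti/andP; split; last first.
  apply: le_ereal_sup_tmp; exists (ereal_inf [set (rnorm (u z))%:E | z in setT]).
    by exists setT => //; exact: filterT.
  by apply: le_ereal_inf_tmp => _ [z _ <-]; rewrite lee_fin rnorm_ge0.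
apply: ge_ereal_sup => _ [P hP <-].
have /nbhsCP[d d0 hd] := hP.
apply/lee_addgt0Pr => e e0; rewrite add0e.
have de : 0 < Num.min d e by rewrite lt_min d0.
have [z [z1]] := h _ de; rewrite !lt_min => /andP[zd _] /andP[_ ze].
apply: (@le_trans _ _ (rnorm (u z))%:E); last by rewrite lee_fin ltW.
by apply: ereal_inf_lbound; exists z => //; apply: hd zd _; apply/diskP.
Qed.

Lemma inner_spectrum_disk l : rnorm l < 1 -> inner_spectrum u l <-> u l = 0.
Proof.
move=> l1; rewrite inner_spectrumP; have ul := hol_tends (inner_hol u_inner l1).
split=> [[_ h]|ul0]; last first.
  by split=> [|d d0]; [exact: ltW|exists l; rewrite subrr ul0 rnorm0].
apply: eq0_small => e e0; have e2 : 0 < e / 2 by rewrite divr_gt0.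
have /tendsP/(_ _ e2)[d d0 hd] := ul.
have m0 : 0 < Num.min d (e / 2) by rewrite lt_min d0.
have [z [z1]] := h _ m0; rewrite !lt_min => /andP[zd _] /andP[_ ze].
have := rnorm_sub_le (u l) (u z); have := hd z zd; lra.
Qed.

Lemma circle_expi z : rnorm z = 1 -> exists t : R, z = expi t.
Proof.
case: z => x y z1; have xy : x ^+ 2 + y ^+ 2 = 1.
  by have := congr1 (fun r => r ^+ 2) z1; rewrite /rnorm /= sqr_sqrtr ?expr1n// addr_ge0 ?sqr_ge0.
have x1 : -1 <= x <= 1.
  rewrite -ler_norml -(@ler_pXn2r _ 2)// ?nnegrE// expr1n real_normK ?num_real//.
  by rewrite -xy lerDl sqr_ge0.
have sE : Num.sqrt (1 - x ^+ 2) = `|y| by rewrite -xy addrC addKr sqrtr_sqr.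
have [y0|y0] := leP 0 y.
  by exists (acos x); rewrite /expi acosK ?in_itv// sin_acos// sE ger0_norm.
exists (- acos x); rewrite expiN /expi acosK ?in_itv// sin_acos// sE ltr0_norm//.
by rewrite -[RHS]/((x +i* - - y)%C) opprK.
Qed.

Definition M m x : K := m *: x - model_shift x.

Lemma mval_M m x : mval (M m x) = m *: mval x - bshift (mval x). Proof. by []. Qed.

Lemma M_linear m : linear (M m).
Proof.
move=> c x y; apply: val_inj.
have -> : val (M m (c *: x + y)) = m *: (c *: mval x + mval y) - bshift (c *: mval x + mval y).
  by [].
have -> : val (c *: M m x + M m y) = c *: mval (M m x) + mval (M m y) by [].
rewrite !mval_M bshiftD bshiftZ !scalerDr opprD addrACA scalerN; congr (_ - _ + _).
by rewrite !scalerA mulrC.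
Qed.

Lemma model_shift_bounded : bounded_op (@model_shift R u).
Proof.
apply/bounded_opP; split.
  by move=> c x y; apply: val_inj; exact: hardyP.
by exists 1 => // x; rewrite mul1r; exact: hnorm_bshift.
Qed.

Lemma M_bounded m : bounded_op (M m).
Proof.
have := bounded_op_lin m (-1) model_shift_bounded.
by rewrite (_ : (fun x => _) = M m)//; apply/funext => x; rewrite scaleN1r.
Qed.

Lemma M_inverse m : (exists C, forall f, inK U f -> rnorm f <= C * rnorm (m *: f - bshift f)) ->
  (forall f, inK U f -> exists2 g, inK U g & m *: g - bshift g = f) ->
  exists B, inverse_op (M m) B.
Proof.
move=> [C hC] hs; apply: (inverse_op_exists (C := C)); first exact: M_bounded.
  by move=> x; exact: (hC _ (mval_inK u_inner x)).
move=> y; have [g gK e] := hs _ (mval_inK u_inner y).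
by exists (Kof gK); apply: val_inj.
Qed.

Lemma M_regular_circle m : rnorm m = 1 -> ~ inner_spectrum u m^* ->
  exists C, forall f, inK U f -> rnorm f <= C * rnorm (m *: f - bshift f).
Proof.
move=> m1 ns; have n1 : rnorm m^* = 1 by rewrite rnorm_conj.
have [tau mt] := circle_expi n1.
have [d d0 hd] : exists2 d : R, 0 < d &
    forall z, rnorm z < 1 -> rnorm (m^* - z) < d -> d <= rnorm (u z).
  apply: contrapT => hn; apply: ns; apply/inner_spectrumP; rewrite n1; split=> // d d0.
  apply: contrapT => hz; apply: hn; exists d => // z z1 zd; rewrite leNgt; apply/negP => uz.
  by apply: hz; exists z.
have E0 : cexp (pt 0 tau) = m^* by rewrite cexp_pt expR0 mul1r mt.
have /tendsP/(_ _ d0)[r r0 hr] := hol_tends (hol_cexp (pt 0 tau)).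
(* On the box of half-width [A] one has [|x| + |y - tau| < r], which keeps its image under [cexp]
   within [d] of the conjugate of [m]. *)
pose A := Num.min (r / 2) 1.
have A0 : 0 < A by rewrite lt_min divr_gt0//=.
have [Ar A1] : A <= r / 2 /\ A <= 1 by rewrite !ge_min !lexx orbT.
have m0 : Emap (pt 0 tau) = m by rewrite -[LHS]conjCK Emap_conj oppr0 E0 conjCK.
have [B hB] := inner_bounded u_inner.
have hU z : rnorm z < 1 -> heval U z = u z by exact: heval_inner.
have := @bounded_below_regular R U orthoU tau A B d A0 A1 d0; rewrite m0; apply.
- by move=> z z1; rewrite hU// hB.
- move=> z z1; apply: (@hol_near _ _ u); last exact: inner_hol.
  apply/near_atP; exists (1 - rnorm z); first by rewrite subr_gt0.
  by move=> w zw; apply: hU; have := rnorm_sub_le w z; rewrite rnormB; lra.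
- move=> x y /andP[x0 xA] yA.
  have w1 : rnorm (cexp (pt (- x) y)) < 1 by rewrite rnorm_cexp /= -expR0 ltr_expR oppr_lt0.
  rewrite hU//; apply: hd => //; rewrite -E0; apply: hr.
  rewrite ptB sub0r opprK; apply: le_lt_trans (rnorm_pt _ _) _.
  by rewrite ger0_norm ?(ltW x0)// distrC; lra.
- have FA := @ae_filter_ringOfSetsType _ _ _ (@lebesgue_measure R).
  have [_ _ hae] := u_inner; apply: filterS hae => t; apply: cvg_trans.
  apply: near_eq_cvg; near=> r'; rewrite hU// rnormM rnorm_expi mulr1 rnormR ger0_norm.
    by near: r'; exact: nbhs_left_lt.
  by apply: ltW; near: r'; exact: nbhs_left_gt.
Unshelve. all: by end_near. Qed.

Lemma M_regular m : ~ inner_spectrum u m^* -> exists B, inverse_op (M m) B.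
Proof.
move=> ns; have [m1|m1|m1] := ltgtP (rnorm m) 1.
- have m1' : rnorm m^* < 1 by rewrite rnorm_conj.
  have u0 : heval U m^* != 0.
    by rewrite heval_inner//; apply/eqP => /(inner_spectrum_disk m1').
  have rm : regular U m by right.
  have sol f : inK U f -> exists2 g, inK U g & m *: g - bshift g = f.
    by move=> /(resolvent_exists orthoU rm)[g [gK e]]; exists g.
  apply: M_inverse sol; eexists => f fK.
  have hf : inK U (m *: f - bshift f) by apply: inKB; [exact: inKZ|exact: inKX].
  have [g hg bg] := resolvent_inner orthoU m1 u0 hf.
  have -> : rnorm f = rnorm g.
    by congr rnorm; apply: (resolvent_uniq rm _ hg).
  by apply: le_trans bg _; rewrite -mulrA mulrC.
- apply: M_inverse => [|f /(resolvent_outer orthoU m1)[g [gK e]]]; last by exists g.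
  exists (rnorm m - 1)^-1 => f _; rewrite mulrC ler_pdivlMr ?subr_gt0// mulrC.
  exact: resolvent_outer_bound.
- have hb := M_regular_circle m1 ns; have [C hC] := hb; apply: M_inverse hb _ => f fK.
  exact: (surjective_of_bounded_below orthoU m1 hC fK).
Qed.

Lemma M_eigenvector m : rnorm m < 1 -> u m^* = 0 -> exists2 x : K, x != 0 & M m x = 0.
Proof.
move=> m1 u0; have [k kE _] := geo_exists m1.
have kK : inK U k.
  move=> j; rewrite (hdot_geo kE) heval_iter_fshift ?heval_inner ?rnorm_conj//.
  by rewrite u0 mulr0 rmorph0.
exists (Kof kK); last by apply: val_inj; rewrite -[LHS]/(m *: k - bshift k) (geo_shift kE) subrr.
apply: contraTneq (oner_neq0 R[i]) => /(congr1 (fun x : K => mval x 0%N)) /=.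
by rewrite kE expr0 => ->; rewrite eqxx.
Qed.

Lemma M_approx_eigen m (e : R) : inner_spectrum u m^* -> 0 < e ->
  exists2 x : K, 0 < rnorm x & rnorm (M m x) <= e * rnorm x.
Proof.
move=> /inner_spectrumP[_ h] e0.
(* The error is [(m - conj z) f + c X U]: the first term costs [d |f|] and the second [d], which is
   at most [2 d |f|] because [|f| >= 1/2]. *)
have [d [d0 de d2]] : exists d : R, [/\ 0 < d, 3 * d <= e & d <= 2^-1].
  exists (Num.min (e / 3) 2^-1); split; first by rewrite lt_min divr_gt0// invr_gt0 ltr0n.
    by rewrite mulrC -ler_pdivlMr// ge_min lexx.
  by rewrite ge_min lexx orbT.
have [z [z1 zd uz]] := h _ d0; have n1 : rnorm z^* < 1 by rewrite rnorm_conj.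
have [k kE _] := geo_exists n1; have [v hv _] := geo_mul_exists U n1.
have [fK ef] := geo_proj orthoU kE n1 hv.
set f := k - _ in fK ef; set c := (heval U _)^* in f fK ef.
have cd : rnorm c < d by rewrite rnorm_conj conjCK heval_inner.
have v0 : v 0%N = U 0%N by rewrite -hv coefD coefN coefZ fshiftE mulr0 subr0.
have U0 : rnorm (U 0%N) <= 1 by rewrite -(hnormU orthoU); exact: coef_le_hnorm.
(* The zeroth coefficient of [f] is [1 - c U(0)], of modulus at least [1 - d]. *)
have f2 : 2^-1 <= rnorm f.
  apply: le_trans (coef_le_hnorm f 0); rewrite /f coefD coefN coefZ kE v0 expr0.
  have := rnorm_sub_le 1 (c * U 0%N); rewrite rnorm1 rnormM.
  have : rnorm c * rnorm (U 0%N) <= d * 1 by apply: ler_pM; rewrite ?rnorm_ge0// ltW.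
  lra.
exists (Kof fK); first by apply: lt_le_trans f2; rewrite invr_gt0 ltr0n.
rewrite model_rnorm mval_M /= -/f.
have -> : rnorm (Kof fK) = rnorm f by [].
have -> : m *: f - bshift f = (m - z^*) *: f + c *: bshift U.
  by rewrite -ef scalerBl addrA subrK.
have mz : rnorm (m - z^*) < d by rewrite -rnorm_conj rmorphB /= conjCK.
have b1 : rnorm ((m - z^*) *: f) <= d * rnorm f.
  by rewrite vnormZ; apply: ler_wpM2r; rewrite ?rnorm_ge0// ltW.
have b2 : rnorm (c *: bshift U) <= d.
  rewrite vnormZ -[leRHS]mulr1; apply: ler_pM; rewrite ?rnorm_ge0 ?(ltW cd)//.
  by rewrite -(hnormU orthoU); exact: hnorm_bshift.
have b3 : d <= 2 * d * rnorm f.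
  have : 2 * d * 2^-1 <= 2 * d * rnorm f.
    by apply: ler_wpM2l; [rewrite mulr_ge0// ltW|exact: f2].
  by rewrite mulrAC mulfV ?pnatr_eq0// mul1r.
have b4 : 3 * d * rnorm f <= e * rnorm f by apply: ler_wpM2r; [exact: rnorm_ge0|exact: de].
apply: le_trans (vnormD _ _) _; move: b1 b2 b3 b4.
move: (rnorm (_ *: f)) (rnorm (_ *: bshift U)) (rnorm f) => a b t; lra.
Qed.

Lemma M_not_below m C : inner_spectrum u m^* -> ~ (forall x : K, rnorm x <= C * rnorm (M m x)).
Proof.
move=> hs h; have C1 : 0 < `|C| + 1 by rewrite ltr_wpDl.
have e0 : 0 < (2 * (`|C| + 1))^-1 by rewrite invr_gt0 mulr_gt0.
have [x x0 hx] := M_approx_eigen hs e0.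
have := h x; apply/negP; rewrite -ltNge.
apply: (@le_lt_trans _ _ ((`|C| + 1) * ((2 * (`|C| + 1))^-1 * rnorm x))).
  apply: (@le_trans _ _ ((`|C| + 1) * rnorm (M m x))).
    by apply: ler_wpM2r; [exact: rnorm_ge0|apply: le_trans (ler_norm _) _; rewrite lerDl].
  by apply: ler_wpM2l => //; exact: ltW.
have -> : (`|C| + 1) * ((2 * (`|C| + 1))^-1 * rnorm x) = rnorm x / 2.
  by field; rewrite gt_eqF.
lra.
Qed.

Lemma M_spectrum m : inner_spectrum u m^* -> ~ exists B, inverse_op (M m) B.
Proof. by move=> hs [B /inverse_op_below[C]]; exact: M_not_below. Qed.

Lemma M_injective m : rnorm m = 1 -> injective (M m).
Proof.
move=> m1 x y e; apply/eqP; rewrite -subr_eq0; apply/eqP/val_inj.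
have := linear_opB x y (M_linear m); rewrite e subrr => /(congr1 (@mval R u)) e'.
by apply: (@shift_eigen_ge1 _ m (mval (x - y))); [rewrite m1|exact: e'].
Qed.

(** By [dense_range] a closed range would be everything; [M m] would then be bounded below, against
    the approximate eigenvectors. *)
Lemma M_not_closed m : rnorm m = 1 -> inner_spectrum u m^* -> ~ closed (range (M m)).
Proof.
move=> m1 hs /closed_seqP cl.
have surj f : inK U f -> exists2 g, inK U g & m *: g - bshift g = f.
  move=> fK; have [y _ hy] : range (M m) (Kof fK).
    apply: cl => e e0; have [g gK hg] := dense_range orthoU m1 fK e0.
    by exists (M m (Kof gK)); [exists (Kof gK)|exact: hg].
  by exists (mval y); [exact: mval_inK|rewrite -mval_M hy].
have [C hC] := bounded_below_of_surjective orthoU m1 surj.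
by apply: (@M_not_below m C hs) => x; exact: (hC _ (mval_inK u_inner x)).
Qed.

Lemma finite_dim_line (P : set K) x0 : (forall x, P x -> exists c, x = c *: x0) -> finite_dim P.
Proof.
move=> h; exists 1%N, (fun=> x0) => x /h[c ->].
by exists (fun=> c); rewrite big_ord1.
Qed.

(** An eigenvector of the backward shift is determined by its zeroth coefficient. *)
Lemma M_kernel_finite_dim m : finite_dim (kernel_op (M m)).
Proof.
have eig x : M m x = 0 -> forall n, mval x n = m ^+ n * mval x 0%N.
  by move=> /(congr1 (@mval R u)); exact: shift_eigen.
have [[x0 hx0 n0]|h] := pselect (exists2 x0, M m x0 = 0 & mval x0 0%N != 0).
  apply: (@finite_dim_line _ x0) => x hx; exists (mval x 0%N / mval x0 0%N).
  apply: val_inj; apply: hardyP => n; rewrite -[LHS]/(mval x n).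
  rewrite -[RHS]/(mval x 0%N / mval x0 0%N * mval x0 n) (eig x hx) (eig x0 hx0 n).
  by rewrite [RHS]mulrCA divfK.
apply: (@finite_dim_line _ 0) => x hx; exists 0; rewrite scaler0; apply: val_inj.
apply: hardyP => n; rewrite -[LHS]/(mval x n) (eig x hx).
have [->|x0] := eqVneq (mval x 0%N) 0; first by rewrite mulr0.
by case: h; exists x.
Qed.

(** With [v = f / (1 - m z)], the range consists of the [f] with [<z v, U> = 0]: as [<k, U> = 0],
    adding multiples of [k] cannot repair a nonzero value. This condition is continuous in [f]. *)
Lemma M_closed_range m : rnorm m < 1 -> u m^* = 0 -> closed (range (M m)).
Proof.
move=> m1 u0; have [k kE _] := geo_exists m1.
have kU : hdot k U = 0 by rewrite (hdot_geo kE) heval_inner ?rnorm_conj// u0 rmorph0.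
have rangeP f v : inK U f -> v - m *: fshift v = f ->
    (exists2 g, inK U g & m *: g - bshift g = f) <-> hdot (fshift v) U = 0.
  move=> fK hv; split=> [[g gK e]|hvU]; last first.
    have [gK e] : resolvent U m f (0 *: k - fshift v).
      by apply: resolvent_inner_inK => //; rewrite hvU mul0r.
    by exists (0 *: k - fshift v).
  have hd : m *: (g + fshift v) - bshift (g + fshift v) = 0.
    rewrite bshiftD bshiftK scalerDr opprD addrACA e -hv.
    by rewrite -[X in _ + X]opprB subrr.
  have gk : g + fshift v = (g + fshift v) 0%N *: k.
    by apply: hardyP => n; rewrite (shift_eigen hd) coefZ kE mulrC.
  have := congr1 (fun h => hdot h U) gk.
  by rewrite linearDl /= linearZl_LR /= kU mulr0 (gK 0%N) add0r.
apply/closed_seqP => x hx; have xK := mval_inK u_inner x.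
have [v hv _] := geo_mul_exists (mval x) m1.
have [|g gK e] := (rangeP _ v xK hv).2; last by exists (Kof gK) => //; exact: val_inj.
apply: eq0_small => e e0; have d0 : 0 < 1 - rnorm m by rewrite subr_gt0.
(* The factor [1 - |m|] offsets the norm of the division by [1 - m z]. *)
have [|_ [y _ <-] hy] := hx (e * (1 - rnorm m)); first by rewrite mulr_gt0.
have yK := mval_inK u_inner (M m y).
have [w hw wn] := geo_mul_exists (mval (x - M m y)) m1.
have hvw : (v - w) - m *: fshift (v - w) = mval (M m y).
  rewrite fshiftB scalerBr opprB [m *: fshift w - _]addrC addrACA hv.
  rewrite [- w + _]addrC -[X in _ + X]opprB hw.
  by rewrite -[mval (x - M m y)]/(mval x - mval (M m y)) subKr.
have /(rangeP _ _ yK hvw).1 : exists2 g, inK U g & m *: g - bshift g = mval (M m y).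
  by exists (mval y) => //; exact: mval_inK.
rewrite fshiftB linearBl /= => /eqP; rewrite subr_eq0 => /eqP ->.
apply: le_trans (hdot_CS _ _) _; rewrite (hnormU orthoU) mulr1 hnorm_fshift.
by apply: le_trans wn _; rewrite ler_pdivrMr.
Qed.

End ModelShift.

(** * Riesz representation, adjoints and Fredholm operators on K_u *)

Section Adjoints.
Variables (R : realType) (u : R[i] -> R[i]).
Hypothesis u_inner : inner_function u.
Notation U := (inner_coef u_inner).
Notation orthoU := (inner_orthonormal u_inner).
Notation K := (model_space u).
Notation S := (@fshift R).
Implicit Types (x y : K) (f g : hardy R).

Definition Kmono n : K := Kof (@proj_mono_inK R U orthoU n).
Definition Kproj N g : K := Kof (@pproj_inK R U orthoU N g).

Lemma hdot_trunc N g f : hdot (trunc N g) f = \sum_(n < N) g n * (f n)^*.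
Proof.
rewrite /trunc (hdot_suml N (fun n => g n *: iter n S (hone R))); apply: eq_bigr => n _.
by rewrite linearZl_LR /= hdot_conj monomial_coef.
Qed.

Lemma perp_pproj N g : perp U g -> rnorm (pproj U N g) <= rnorm (g - trunc N g).
Proof.
move=> gp; have pK := pproj_inK orthoU N g.
have -> : g - trunc N g = - (pproj U N g - (g - (trunc N g - pproj U N g))).
  by rewrite opprB -[RHS]addrA -opprD subrK.
rewrite vnormN; apply: hnorm_pyth.
by rewrite linearBr /= gp// (pproj_perp N g pK) subrr.
Qed.

Lemma perp_shiftU j : perp U (iter j S U).
Proof. by move=> f fK; exact: fK. Qed.

Lemma eq_small_mul (a b : R[i]) (D : R) : 0 <= D ->
  (forall e : R, 0 < e -> rnorm (a - b) <= D * e) -> a = b.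
Proof.
move=> D0 h; apply: eq_vnorm_small => e e0; have D1 : 0 < D + 1 by rewrite ltr_wpDl.
apply: le_trans (h (e / (D + 1)) _) _; first by rewrite divr_gt0.
by rewrite mulrCA ger_pMr// ler_pdivrMr// mul1r lerDl.
Qed.

(** The representing vector is built from its coefficients, the conjugates of [L] on the projected
    monomials. They are square summable because testing [L] on the projection of the polynomial [G]
    with these coefficients gives [|G|^2 <= C |G|]. *)
Lemma riesz (L : K -> R[i]) (C : R) : 0 <= C ->
  (forall c x y, L (c *: x + y) = c * L x + L y) ->
  (forall x, rnorm (L x) <= C * rnorm x) ->
  exists2 b : K, forall x, L x = mdot x b & rnorm b <= C.
Proof.
move=> C0 lL hL; have L0 : L 0 = 0.
  by have := lL (-1) 0 0; rewrite scaler0 add0r mulN1r addNr.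
have LB x y : L (x - y) = L x - L y.
  by rewrite [x - y]addrC -scaleN1r lL mulN1r addrC.
have LP N g : L (Kproj N g) = \sum_(n < N) g n * L (Kmono n).
  elim: N => [|N IH].
    rewrite big_ord0 -L0; congr L; apply: val_inj; rewrite /= /pproj big_ord0.
    by [].
  have -> : Kproj N.+1 g = g N *: Kmono N + Kproj N g.
    apply: val_inj; rewrite -[LHS]/(pproj U N.+1 g).
    by rewrite -[RHS]/(g N *: proj_mono U N + pproj U N g) /pproj big_ord_recr addrC.
  by rewrite lL IH big_ord_recr addrC.
pose a n := (L (Kmono n))^*.
have ha N : series (fun n => rnorm (a n) ^+ 2) N <= C ^+ 2.
  pose G : hardy R := \sum_(n < N) a n *: iter n S (hone R).
  have Ga n : (n < N)%N -> G n = a n.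
    move=> nN; rewrite /G (coef_sum N (fun n => a n *: iter n S (hone R))).
    under eq_bigr do rewrite coefZ monomialE.
    rewrite (bigD1 (Ordinal nN))//= eqxx mulr1 big1 ?addr0// => i iN.
    case: eqVneq => [e|_]; last by rewrite mulr0.
    by move: iN; rewrite -val_eqE /= -e eqxx.
  have tG : trunc N G = G by rewrite /trunc; apply: eq_bigr => n _; rewrite Ga.
  have GG : L (Kproj N G) = hdot G G.
    rewrite LP; transitivity (hdot (trunc N G) G); last by rewrite tG.
    rewrite hdot_trunc; apply: eq_bigr => n _.
    by rewrite (Ga n (ltn_ord n)) /a conjCK.
  have Gs : rnorm G ^+ 2 = series (fun n => rnorm (a n) ^+ 2) N.
    apply: complexI; rewrite -hdotE; transitivity (hdot (trunc N G) G); first by rewrite tG.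
    rewrite hdot_trunc /series /= big_mkord rmorph_sum.
    apply: eq_bigr => n _; rewrite (Ga n (ltn_ord n)) rmorphXn /= -normr_rnorm normCK.
    by [].
  have GC : rnorm G * rnorm G <= C * rnorm G.
    have := hL (Kproj N G); rewrite GG hdotE rnormR ger0_norm ?sqr_ge0// expr2 => h.
    apply: le_trans h _; apply: ler_wpM2l => //; apply: le_trans (hnorm_pproj orthoU N G) _.
    by rewrite tG.
  rewrite -Gs ler_pXn2r// ?nnegrE ?rnorm_ge0//.
  have [->//|G0] := eqVneq (rnorm G) 0.
  by rewrite -(@ler_pM2r _ (rnorm G))// lt_neqAle eq_sym G0 rnorm_ge0.
pose b := Hardy (ell2_bounded ha); have bC : rnorm b <= C by apply: hnorm_le.
have Lb N g : L (Kproj N g) = hdot (trunc N g) b.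
  by rewrite LP hdot_trunc; apply: eq_bigr => n _; rewrite /= /a conjCK.
have tb g N : rnorm (hdot g b - hdot (trunc N g) b) <= C * rnorm (g - trunc N g).
  rewrite -linearBl /=; apply: le_trans (hdot_CS _ _) _; rewrite mulrC.
  by apply: ler_wpM2r; rewrite ?rnorm_ge0.
(* [L] on the projected truncations of [z^j U] tends to 0, since [z^j U] is orthogonal to the model
   space; by [Lb] the same numbers tend to [<z^j U, b>]. *)
have bK : inK U b.
  move=> j; rewrite hdot_conj.
  have -> : hdot (iter j S U) b = 0; last by rewrite rmorph0.
  apply: (@eq_small_mul _ _ (C + C)); first by rewrite addr_ge0.
  move=> e e0; have [N hN] := hlim_trunc (iter j S U) e0; rewrite subr0 mulrDl.
  have {}hN := hN N (leqnn N).
  rewrite -[hdot _ b](subrK (hdot (trunc N (iter j S U)) b)).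
  apply: le_trans (rnormD _ _) _; apply: lerD.
    by apply: le_trans (tb _ _) _; apply: ler_wpM2l.
  rewrite -Lb; apply: le_trans (hL _) _; apply: ler_wpM2l => //.
  by apply: le_trans hN; exact: (perp_pproj N (@perp_shiftU j)).
exists (Kof bK) => // x.
apply: (@eq_small_mul _ _ (C + C)); first by rewrite addr_ge0.
move=> e e0; have [N hN] := hlim_trunc (mval x) e0.
have [N' hN'] := hlim_pproj orthoU (mval_inK u_inner x) e0.
have {}hN := hN _ (leq_maxl N N'); have {}hN' := hN' _ (leq_maxr N N').
have -> : L x - mdot x (Kof bK) = L (x - Kproj (maxn N N') (mval x)) -
    (hdot (mval x) b - hdot (trunc (maxn N N') (mval x)) b).
  by rewrite LB Lb opprB addrA subrK.
rewrite mulrDl; apply: le_trans (rnormD _ _) _; rewrite rnormN; apply: lerD.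
  by apply: le_trans (hL _) _; apply: ler_wpM2l.
by apply: le_trans (tb _ _) _; apply: ler_wpM2l.
Qed.

Lemma mdot_inj x y : (forall w, mdot w x = mdot w y) -> x = y.
Proof.
move=> h; apply/eqP; rewrite -subr_eq0 -(@dnorm_eq0 _ _ (@mdot R u)); apply/eqP.
by rewrite linearBr /= h subrr.
Qed.

Lemma adjoint_exists (T : K -> K) : bounded_op T ->
  exists2 T' : K -> K, bounded_op T' & adjoint_op (@mdot R u) T T'.
Proof.
move=> /bounded_opP[lT [C C0 hC]].
have h x : exists b : K, (forall y, mdot (T y) x = mdot y b) /\ rnorm b <= C * rnorm x.
  have [|c y z|y|b hb bn] := @riesz (fun y => mdot (T y) x) (C * rnorm x).
  - by rewrite mulr_ge0 ?rnorm_ge0.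
  - by rewrite lT mdot_linearl.
  - apply: le_trans (hdot_CS _ _) _; rewrite mulrAC; apply: ler_wpM2r; rewrite ?rnorm_ge0//.
    exact: hC.
  by exists b.
have [T' hT'] := choice h; exists T'; last by move=> y x; exact: (hT' x).1.
apply/bounded_opP; split; last by exists C => // x; exact: (hT' x).2.
move=> c x y; apply: mdot_inj => w.
by rewrite -(hT' _).1 !mdot_linearr -!(hT' _).1.
Qed.

(** The kernel of the adjoint is replaced by the orthogonal complement of the range, which can be
    studied without a formula for the adjoint. *)
Lemma fredholm_cokernel (T : K -> K) : bounded_op T -> closed (range T) ->
  finite_dim (kernel_op T) -> finite_dim [set x | forall y, mdot (T y) x = 0] ->
  fredholm (@mdot R u) T.
Proof.
move=> bT cT kT [n [e he]]; split=> //; have [T' bT' aT] := adjoint_exists bT.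
exists T'; split=> //; exists n, e => x hx; apply: he => y.
by rewrite [LHS](aT y x) hx linear0r.
Qed.

Lemma inverse_fredholm (T T' : K -> K) : bounded_op T -> inverse_op T T' ->
  fredholm (@mdot R u) T.
Proof.
move=> bT hT; have iT := inverse_op_inj hT; case: hT => _ _ h.
have rT : range T = setT by apply/seteqP; split=> // y _; exists (T' y).
apply: fredholm_cokernel => //; first by rewrite rT; exact: closedT.
  apply: (@finite_dim_line _ u _ 0) => x hx; exists 0; rewrite scaler0; apply: iT.
  by rewrite hx linear_op0//; exact: bT.1.
apply: (@finite_dim_line _ u _ 0) => x hx; exists 0; rewrite scaler0.
by apply: mdot_inj => w; rewrite linear0r -(h w); exact: hx.
Qed.

(** The dimension is at most 1: an element [x] of the complement is determined by the number
    [c x = <z x, U>]. *)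
Lemma M_cokernel_finite_dim m : rnorm m < 1 ->
  finite_dim [set x : K | forall y : K, mdot (M m y) x = 0].
Proof.
move=> m1; set N := [set x | _].
pose c (x : K) := hdot (S (mval x)) U.
have N0 x : N x -> c x = 0 -> x = 0.
  (* If [c x = 0], then [y = conj m x - z x] is in K_u and [<y, y> = <(m - X) y, x> = 0]. So
     multiplication by [z], an isometry, acts on [x] as a factor of modulus below 1, and [x = 0]. *)
  move=> Nx cx; have zK : inK U (m^* *: mval x - S (mval x)).
    apply: inKB; first exact/inKZ/mval_inK.
    by move=> [|k]; [exact: cx|rewrite iterS -hdot_bshift bshiftK; exact: mval_inK].
  have e : m^* *: mval x = S (mval x).
    apply/eqP; rewrite -subr_eq0 -(@dnorm_eq0 _ _ (@hdot R)); apply/eqP.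
    rewrite linearBr linearZr_LR /= conjCK -hdot_bshift.
    have := Nx (Kof zK); rewrite /mdot mval_M linearBl /= linearZl_LR.
    by [].
  have : rnorm m * rnorm x = rnorm x.
    by rewrite -(rnorm_conj m) -[rnorm x]/(rnorm (mval x)) -vnormZ e hnorm_fshift.
  move=> /eqP; rewrite -{2}[rnorm x]mul1r -subr_eq0 -mulrBl mulf_eq0 subr_eq0 lt_eqF//=.
  by rewrite vnorm_eq0 => /eqP.
have [[x0 Nx0 c0]|h] := pselect (exists2 x0, N x0 & c x0 != 0); last first.
  apply: (@finite_dim_line _ u _ 0) => x Nx; exists 0; rewrite scaler0; apply: N0 => //.
  by apply/eqP; apply: contra_notT h => cx; exists x.
apply: (@finite_dim_line _ u _ x0) => x Nx; exists (c x / c x0).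
apply/eqP; rewrite -subr_eq0; apply/eqP; apply: N0.
  by move=> y; rewrite linearBr linearZr_LR /= Nx Nx0 mulr0 subrr.
rewrite /c -[mval (x - _)]/(mval x - (c x / c x0) *: mval x0).
by rewrite fshiftB fshiftZ linearBl /= linearZl_LR /= -/(c x) -/(c x0) divfK// subrr.
Qed.

End Adjoints.

Lemma inv_le_swap (R : realType) (a b : R) : 0 < a -> a^-1 <= b -> b^-1 <= a.
Proof.
move=> a0 ab; have b0 : 0 < b by apply: lt_le_trans ab; rewrite invr_gt0.
by rewrite -[leRHS]invrK lef_pV2 // posrE invr_gt0.
Qed.

Lemma div_succ_le1 (R : realType) (a : R) : 0 <= a -> a / (a + 1) <= 1.
Proof. by move=> a0; rewrite ler_pdivrMr ?ltr_wpDl// mul1r lerDl. Qed.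

(** * Spectra and norm of the difference quotient operator *)

Section DifferenceQuotient.
Variables (R : realType) (u : R[i] -> R[i]) (zeta : R[i]).
Hypothesis u_inner : inner_function u.
Hypothesis zeta1 : rnorm zeta = 1.
Hypothesis zeta_regular : ~ inner_spectrum u zeta.
Notation K := (model_space u).
Notation X := (@model_shift R u).
Notation Q := (difference_quotient (u := u) zeta).
Notation M := (@M R u).
Implicit Types (x y : K) (l m eta : R[i]).

Lemma zeta_conj : zeta * zeta^* = 1.
Proof. by rewrite -normCK normr_rnorm zeta1 expr1n. Qed.

Lemma X_linear : linear X. Proof. by case/bounded_opP: (@model_shift_bounded R u). Qed.

Lemma inverse_op_sym (T T' : K -> K) : bounded_op T -> inverse_op T T' -> inverse_op T' T.
Proof. by move=> bT [_ h1 h2]. Qed.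

Lemma inverse_op_comp (A A' B B' : K -> K) : inverse_op A A' -> inverse_op B B' ->
  inverse_op (fun x => A (B x)) (fun x => B' (A' x)).
Proof.
move=> [bA hA hA'] [bB hB hB']; split; first exact: bounded_op_comp.
  by move=> x; rewrite hA hB.
by move=> x; rewrite hB' hA'.
Qed.

Lemma bounded_op_scale c : bounded_op (fun x : K => c *: x).
Proof.
apply/bounded_opP; split; first by move=> a x y; rewrite scalerDr !scalerA mulrC.
by exists (rnorm c); rewrite ?rnorm_ge0// => x; rewrite vnormZ.
Qed.

Lemma inverse_op_scale c : c != 0 -> inverse_op (fun x : K => c *: x) (fun x => c^-1 *: x).
Proof.
move=> c0; split; first exact: bounded_op_scale.
  by move=> x; rewrite scalerA mulVf// scale1r.
by move=> x; rewrite scalerA mulfV// scale1r.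
Qed.

Definition D x : K := x - zeta *: X x.

Lemma D_bounded : bounded_op D.
Proof.
have := bounded_op_lin 1 (- zeta) (@model_shift_bounded R u).
by rewrite (_ : (fun x => _) = D)//; apply/funext => x; rewrite scale1r scaleNr.
Qed.

(** [1 - zeta X = zeta (conj zeta - X)] because [|zeta| = 1], and [zeta] is outside the spectrum of
    [u]. *)
Lemma D_inverse : exists B, inverse_op D B.
Proof.
have [|B hB] := @M_regular R u u_inner zeta^*; first by rewrite conjCK.
have z0 : zeta != 0 by rewrite -rnorm_gt0 zeta1 ltr01.
exists (fun x => B (zeta^-1 *: x)).
have -> : D = fun x => zeta *: M zeta^* x.
  by apply/funext => x; rewrite /M scalerBr scalerA zeta_conj scale1r.
exact: inverse_op_comp (inverse_op_scale z0) hB.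
Qed.

Notation B := (opinv D).

Lemma B_inverse : inverse_op D B.
Proof. by have [B' hB] := D_inverse; rewrite (opinvP hB). Qed.

Lemma QE x : Q x = B (X x). Proof. by []. Qed.

Lemma BK : cancel D B. Proof. by case: B_inverse. Qed.
Lemma DK : cancel B D. Proof. by case: B_inverse. Qed.
Lemma B_bounded : bounded_op B. Proof. by case: B_inverse. Qed.
Lemma B_linear : linear B. Proof. by case: B_bounded. Qed.

Lemma DX x : D (X x) = X (D x).
Proof. by rewrite /D (linear_opB _ _ X_linear) (linear_opZ _ _ X_linear). Qed.

Lemma BX x : B (X x) = X (B x).
Proof. by rewrite -{1}(DK x) -DX BK. Qed.

Lemma Q_bounded : bounded_op Q.
Proof. exact: (bounded_op_comp B_bounded (@model_shift_bounded R u)). Qed.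

(** [l - Q = B (l D - X)], as [B] inverts [D = 1 - zeta X] and [Q = B X]. *)
Lemma sub_QE l x : l *: x - Q x = B (l *: x - (1 + l * zeta) *: X x).
Proof.
rewrite QE -{1}(BK x) -(linear_opZ _ _ B_linear) -(linear_opB _ _ B_linear).
congr B; rewrite /D scalerBr scalerA scalerDl scale1r.
by rewrite [X x + _]addrC opprD addrA.
Qed.

Lemma sub_Q_M l x : 1 + l * zeta != 0 ->
  l *: x - Q x = (1 + l * zeta) *: B (M (l / (1 + l * zeta)) x).
Proof.
move=> c0; rewrite sub_QE /M -(linear_opZ _ _ B_linear).
by rewrite scalerBr scalerA mulrCA mulfV// mulr1.
Qed.

Lemma sub_Q_bounded l : bounded_op (fun x => l *: x - Q x).
Proof.
have := bounded_op_lin l (-1) Q_bounded.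
by rewrite (_ : (fun x => _) = fun x => l *: x - Q x)//; apply/funext => x; rewrite scaleN1r.
Qed.

Lemma sub_Q_inverse0 l : 1 + l * zeta = 0 -> exists T, inverse_op (fun x => l *: x - Q x) T.
Proof.
move=> c0; have l0 : l != 0.
  by apply: contra_eq_neq c0 => ->; rewrite mul0r addr0 oner_eq0.
exists (fun x => D (l^-1 *: x)).
have -> : (fun x => l *: x - Q x) = fun x => l *: B x.
  apply/funext => x; by rewrite sub_QE c0 scale0r subr0 (linear_opZ _ _ B_linear).
exact: inverse_op_comp (inverse_op_scale l0) (inverse_op_sym D_bounded B_inverse).
Qed.

Lemma sub_Q_inverse l : 1 + l * zeta != 0 ->
  (exists T, inverse_op (M (l / (1 + l * zeta))) T) <->
  exists T, inverse_op (fun x => l *: x - Q x) T.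
Proof.
move=> c0; have iB := inverse_op_sym D_bounded B_inverse; split=> -[T hT].
  have := inverse_op_comp (inverse_op_comp (inverse_op_scale c0) iB) hT.
  rewrite (_ : (fun x => _) = fun x => l *: x - Q x); first by eexists; exact: H.
  by apply/funext => x; rewrite sub_Q_M.
have ic : (1 + l * zeta)^-1 != 0 by rewrite invr_eq0.
have := inverse_op_comp (inverse_op_comp B_inverse (inverse_op_scale ic)) hT.
rewrite (_ : (fun x => _) = M (l / (1 + l * zeta))) => [H|]; first by eexists; exact: H.
by apply/funext => x; rewrite sub_Q_M// scalerA mulVf// scale1r DK.
Qed.

Lemma sub_Q_injective l : 1 + l * zeta != 0 ->
  injective (fun x => l *: x - Q x) <-> injective (M (l / (1 + l * zeta))).
Proof.
move=> c0; have iB : injective B by exact: can_inj DK.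
split=> h x y e; apply: h => //=; first by rewrite !sub_Q_M// e.
by move: e; rewrite !sub_Q_M// => /(scalerI c0)/iB.
Qed.

(** [B] commutes with [X], so it can be moved to the right of [M], where an invertible factor does
    not change the range. *)
Lemma sub_Q_range l : 1 + l * zeta != 0 ->
  range (fun x => l *: x - Q x) = range (M (l / (1 + l * zeta))).
Proof.
move=> c0; set mu := l / _; have BM x : B (M mu x) = M mu (B x).
  by rewrite /M (linear_opB _ _ B_linear) (linear_opZ _ _ B_linear) BX.
apply/seteqP; split=> _ [x _ <-].
  exists ((1 + l * zeta) *: B x) => //; rewrite sub_Q_M// -/mu BM.
  by rewrite (linear_opZ _ _ (M_linear mu)).
exists ((1 + l * zeta)^-1 *: D x) => //; rewrite sub_Q_M// -/mu BM.
rewrite (linear_opZ _ _ B_linear) BK (linear_opZ _ _ (M_linear mu)).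
by rewrite scalerA mulfV// scale1r.
Qed.

(** The map is inverted by [conj eta = l / (1 + l zeta)], since
    [1 + l zeta = 1 / (1 - zeta conj eta)]. The denominator [1 - zeta conj eta] vanishes only at
    [eta = zeta], which is not in the spectrum of [u]. *)
Lemma spectral_image (E : set R[i]) l : E `<=` inner_spectrum u ->
  [set eta^* / (1 - zeta * eta^*) | eta in E] l <->
  1 + l * zeta != 0 /\ E (l / (1 + l * zeta))^*.
Proof.
move=> Es; have d0 eta : E eta -> 1 - zeta * eta^* != 0.
  move=> /Es he; apply: contra_notN zeta_regular; rewrite subr_eq0 => /eqP e.
  have -> : zeta = eta; last by [].
  apply: (can_inj (@conjCK _)); rewrite -[LHS]mulr1 e mulrA [_^* * _]mulrC zeta_conj mul1r.
  by [].
split=> [[eta he <-]|[c0 he]]; last first.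
  exists (l / (1 + l * zeta))^* => //; rewrite conjCK; field; rewrite c0 /=.
  by rewrite [l * zeta]mulrC addrK oner_eq0.
have h := d0 _ he.
have e : 1 + eta^* / (1 - zeta * eta^*) * zeta = (1 - zeta * eta^*)^-1 by field.
by rewrite e invr_eq0 h invrK divfK// conjCK.
Qed.

Lemma Q_spectrum :
  spectrum Q = [set eta^* / (1 - zeta * eta^*) | eta in inner_spectrum u].
Proof.
apply/seteqP; split=> l.
  move=> h; apply/(spectral_image _ (@subset_refl _ _)); have [/eqP c0|c0] := boolP (1 + l * zeta == 0).
    by case: h; exact: sub_Q_inverse0.
  split; first exact: isT.
  apply: contrapT => /(M_regular u_inner) hM; apply: h; exact/sub_Q_inverse.
by move=> /(spectral_image _ (@subset_refl _ _))[c0 hs] /(sub_Q_inverse c0); exact: M_spectrum.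
Qed.

Lemma Q_point_spectrum : point_spectrum Q =
  [set eta^* / (1 - zeta * eta^*) | eta in inner_spectrum u `&` @disk R].
Proof.
have Es : inner_spectrum u `&` @disk R `<=` inner_spectrum u.
  move=> eta [he _]; exact: he.
apply/seteqP; split=> l.
  move=> h; apply/(spectral_image _ Es); have [/eqP c0|c0] := boolP (1 + l * zeta == 0).
    by case: h; have [T] := sub_Q_inverse0 c0; exact: inverse_op_inj.
  split; first exact: isT.
  have hs : inner_spectrum u (l / (1 + l * zeta))^*.
    apply: contrapT => /(M_regular u_inner)[T hT]; apply: h.
    by apply/sub_Q_injective => //; exact: inverse_op_inj hT.
  split; first exact: hs.
  apply/diskP; rewrite rnorm_conj lt_neqAle; apply/andP; split; last first.
    by have /inner_spectrumP[] := hs; rewrite rnorm_conj.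
  apply/eqP => m1; apply: h; apply/(sub_Q_injective c0); exact: M_injective m1.
move=> /(spectral_image _ Es)[c0 [hs /diskP m1]] /(sub_Q_injective c0) hi; have u0 := (inner_spectrum_disk u_inner m1).1 hs.
rewrite rnorm_conj in m1; have [x x0 hx] := M_eigenvector u_inner m1 u0.
move/eqP: x0; apply; apply: (hi x 0).
exact: (etrans hx (esym (linear_op0 (M_linear _)))).
Qed.

Lemma Q_essential_spectrum : essential_spectrum (@mdot R u) Q =
  [set eta^* / (1 - zeta * eta^*) | eta in inner_spectrum u `&` @circle R].
Proof.
have Es : inner_spectrum u `&` @circle R `<=` inner_spectrum u.
  move=> eta [he _]; exact: he.
apply/seteqP; split=> l.
  have bQ := sub_Q_bounded l.
  move=> h; apply/(spectral_image _ Es); have [/eqP c0|c0] := boolP (1 + l * zeta == 0).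
    by case: h; have [T] := sub_Q_inverse0 c0; exact: inverse_fredholm.
  split; first exact: isT.
  have hs : inner_spectrum u (l / (1 + l * zeta))^*.
    apply: contrapT => /(M_regular u_inner)/(sub_Q_inverse c0)[T hT]; apply: h.
    exact: inverse_fredholm hT.
  split; first exact: hs.
  apply/circleP/eqP; rewrite eq_le; apply/andP; split.
    by have /inner_spectrumP[] := hs.
  rewrite leNgt; apply/negP => m1; apply: h.
  have u0 := (inner_spectrum_disk u_inner m1).1 hs; rewrite rnorm_conj in m1.
  have rE := sub_Q_range c0; apply: (fredholm_cokernel u_inner bQ).
  - by rewrite rE; exact: (M_closed_range u_inner m1 u0).
  - have [n [e he]] := @M_kernel_finite_dim R u (l / (1 + l * zeta)).
    exists n, e => x hx; apply: he; apply: (can_inj DK); apply: (scalerI c0).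
    have B0 : (1 + l * zeta) *: B 0 = 0 by rewrite (linear_op0 B_linear) scaler0.
    exact: (etrans (esym (sub_Q_M x c0)) (etrans hx (esym B0))).
  have [n [e he]] := M_cokernel_finite_dim u_inner m1.
  exists n, e => x hx; apply: he => y.
  have : range (fun x => l *: x - Q x) (M (l / (1 + l * zeta)) y) by rewrite rE; exists y.
  by move=> [w _ <-]; exact: hx.
move=> /(spectral_image _ Es)[c0 [hs /circleP m1]] [+ _ _]; rewrite (sub_Q_range c0).
by rewrite rnorm_conj in m1; exact: (M_not_closed u_inner m1 hs).
Qed.

Lemma le_opnorm_Q x : rnorm (Q x) <= opnorm Q * rnorm x.
Proof.
have /bounded_opP[lQ [C C0 hC]] := Q_bounded.
have [x0|x0] := eqVneq (rnorm x) 0.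
  by apply: le_trans (hC x) _; rewrite x0 !mulr0.
have xp : 0 < rnorm x by rewrite lt_neqAle eq_sym x0 rnorm_ge0.
have i0 : 0 <= (rnorm x)^-1 by rewrite invr_ge0 rnorm_ge0.
have := @opnorm_ge _ _ Q C ((rnorm x)^-1%:C%C *: x) hC.
rewrite (linear_opZ _ _ lQ) !vnormZ rnormR ger0_norm// mulVf// => /(_ (lexx _)).
by rewrite mulrC ler_pdivrMr.
Qed.

(** As [1 - zeta conj eta = (eta - zeta) conj eta], the spectral point [l] has modulus
    [1 / |zeta - eta|]. Approximate eigenvectors of [M] are approximate eigenvectors of [Q] at [l],
    whence the bound. *)
Lemma le_opnorm_dist eta : inner_spectrum u eta -> rnorm eta = 1 ->
  (rnorm (zeta - eta))^-1 <= opnorm Q.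
Proof.
move=> hs e1; have [l lE] : exists l, l = eta^* / (1 - zeta * eta^*) by eexists.
have [c0 hm] : 1 + l * zeta != 0 /\ inner_spectrum u (l / (1 + l * zeta))^*.
  apply/(spectral_image l (@subset_refl _ _)); exists eta; [exact: hs|exact: esym lE].
have <- : rnorm l = (rnorm (zeta - eta))^-1.
  have zE : 1 - zeta * eta^* = (eta - zeta) * eta^*.
    by rewrite mulrBl -normCK normr_rnorm e1 expr1n.
  by rewrite lE zE rnormM rnormV rnormM rnorm_conj e1 mul1r mulr1 rnormB.
have /bounded_opP[_ [C C0 hC]] := B_bounded.
have [r rE] : exists r, r = rnorm (1 + l * zeta) by eexists.
have k0 : 0 <= r * C by apply: mulr_ge0 C0; rewrite rE; exact: rnorm_ge0.
have A0 : 0 < r * C + 1 by apply: ltr_wpDl k0 _; exact: ltr01.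
apply/ler_addgt0Pr => e e0.
(* [l - Q] is [M] followed by [B] and by a factor of modulus [r], which together enlarge the error
   at most [r * C] times. *)
have [x x0 hx] := M_approx_eigen u_inner hm (divr_gt0 e0 A0).
have [t tE] : exists t, t = rnorm x by eexists.
have hl : rnorm (l *: x - Q x) <= e * t.
  rewrite (sub_Q_M x c0) vnormZ -rE.
  apply: (@le_trans _ _ (r * (C * (e / (r * C + 1) * t)))).
    apply: ler_wpM2l; first by rewrite rE; exact: rnorm_ge0.
    by apply: le_trans (hC _) _; apply: (ler_wpM2l C0); rewrite tE; exact: hx.
  have -> : r * (C * (e / (r * C + 1) * t)) = r * C / (r * C + 1) * (e * t) by ring.
  rewrite -[leRHS]mul1r; apply: ler_wpM2r.
    by apply: mulr_ge0; [exact: ltW|rewrite tE; exact: rnorm_ge0].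
  exact: div_succ_le1.
rewrite -(ler_pM2r x0) mulrDl -vnormZ -[l *: x](subrK (Q x)) -tE addrC.
by apply: le_trans (vnormD _ _) _; apply: lerD hl; rewrite tE; exact: le_opnorm_Q.
Qed.

Lemma opnorm_Q_ge0 : 0 <= opnorm Q.
Proof.
have /bounded_opP[lQ [C C0 hC]] := Q_bounded.
have := @opnorm_ge _ _ Q C 0 hC; rewrite (linear_op0 lQ) vnorm0; apply.
exact: ler01.
Qed.

(** The infimum is taken in the inverted form [1 / |Q| <= |zeta - eta|]. This also excludes a
    distance 0, whose inverse would be [+oo]. *)
Lemma opnorm_Q_dist :
  ((dist zeta (inner_spectrum u `&` @circle R))^-1 <= (opnorm Q)%:E)%E.
Proof.
have [h|h] := pselect (exists eta, (inner_spectrum u `&` @circle R) eta); last first.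
  (* Without spectrum on the circle the distance is [+oo] and its inverse 0. *)
  rewrite /dist (_ : [set _ | _ in _] = set0) ?ereal_inf0 ?invey ?lee_fin ?opnorm_Q_ge0//.
  by apply/seteqP; split=> [r [eta he _]|r []]; case: h; exists eta.
have zn eta : inner_spectrum u eta -> 0 < rnorm (zeta - eta).
  move=> hs; rewrite rnorm_gt0 subr_eq0; apply/eqP => e.
  by have := zeta_regular; rewrite e => /(_ hs).
have N0 : 0 < opnorm Q.
  have [eta [hs /circleP h1]] := h; apply: lt_le_trans (le_opnorm_dist hs h1).
  by rewrite invr_gt0 zn.
have : ((opnorm Q)^-1%:E <= dist zeta (inner_spectrum u `&` @circle R))%E.
  apply: le_ereal_inf_tmp => _ [eta [hs /circleP h1] <-]; rewrite lee_fin.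
  exact: (inv_le_swap (zn _ hs) (le_opnorm_dist hs h1)).
case: (dist _ _) => [r| |//]; last by rewrite invey lee_fin opnorm_Q_ge0.
rewrite lee_fin => Nr; have r0 : 0 < r.
  by apply: lt_le_trans Nr; rewrite invr_gt0.
by rewrite inver (gt_eqF r0) lee_fin; exact: (inv_le_swap N0 Nr).
Qed.

End DifferenceQuotient.

Theorem theorem2p1 (R : realType) (u : R[i] -> R[i]) (zeta : R[i])
    (u_inner : inner_function u) (zeta_circle : circle zeta)
    (zeta_spec : ~ inner_spectrum u zeta) :
  let Q := difference_quotient (u := u) zeta in
  [/\ spectrum Q =
        [set eta^* / (1 - zeta * eta^*) | eta in inner_spectrum u],
      point_spectrum Q =
        [set eta^* / (1 - zeta * eta^*) | eta in inner_spectrum u `&` @disk R],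
      essential_spectrum (@mdot R u) Q =
        [set eta^* / (1 - zeta * eta^*) | eta in inner_spectrum u `&` @circle R]
    & ((dist zeta (inner_spectrum u `&` @circle R))^-1 <= (opnorm Q)%:E)%E].
Proof.
move=> Q; have zeta1 := (circleP zeta).1 zeta_circle.
split.
- exact: Q_spectrum u_inner zeta1 zeta_spec.
- exact: Q_point_spectrum u_inner zeta1 zeta_spec.
- exact: Q_essential_spectrum u_inner zeta1 zeta_spec.
exact: opnorm_Q_dist u_inner zeta1 zeta_spec.
Qed.
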